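(* Let $u$ be the entropy solution of $$u_t+f(k(x),u)_x=0\ \text{ in }\mathbb{R}\times(0,T),\qquad u(x,0)=u_0(x),\ x\in\mathbb{R},$$ and let $u_{\Delta t}$ be the numerical solution given by the upwind finite volume scheme with discrete Rankine--Hugoniot condition (both as defined in the context). Then $$\|u(\cdot,T)-u_{\Delta t}(\cdot,T)\|_{\mathrm{L}^1(\mathbb{R})}\le C\sqrt{\Delta x}$$ for some constant $C$ independent of $\Delta x$.
   Context: Standing assumptions. $T>0$; $u_0\in(\mathrm{L}^1\cap\mathrm{BV})(\mathbb{R})$; $k$ is piecewise constant with finitely many discontinuities $\xi_1<\dots<\xi_N$; put $\xi_0=-\infty$, $\xi_{N+1}=\infty$, $D_i=(\xi_i,\xi_{i+1})$ for $i=0,\dots,N$, and $f^{(i)}(\cdot):=f(k(x),\cdot)$ for $x\in D_i$. Each $f^{(i)}\in C^1(\mathbb{R})$ and there is $\alpha>0$ with $(f^{(i)})'\ge\alpha$ for all $i$ (so $f^{(i)}$ is invertible). Entropy solution. $u\in\mathcal{C}([0,T];\mathrm{L}^1(\mathbb{R}))\cap\mathrm{L}^\infty((0,T)\times\mathbb{R})$ is an entropy solution if for all $c\in\mathbb{R}$ and all nonnegative compactly supported $\varphi\in\mathcal{C}^\infty(\mathbb{R}\times[0,T])$, $$\sum_{i=0}^N\Big(\int_0^T\!\!\int_{D_i}\big(|u-c_i|\varphi_t+\operatorname{sign}(u-c_i)(f^{(i)}(u)-f^{(i)}(c_i))\varphi_x\big)\,dx\,dt-\int_{D_i}|u(x,T)-c_i|\varphi(x,T)\,dx+\int_{D_i}|u_0(x)-c_i|\varphi(x,0)\,dx$$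 $$-\int_0^T\operatorname{sign}(u(\xi_{i+1}-,t)-c_i)\big(f^{(i)}(u(\xi_{i+1}-,t))-f^{(i)}(c_i)\big)\varphi(\xi_{i+1},t)\,dt+\int_0^T\operatorname{sign}(u(\xi_i+,t)-c_i)\big(f^{(i)}(u(\xi_i+,t))-f^{(i)}(c_i)\big)\varphi(\xi_i,t)\,dt\Big)\ge0,$$ where $c_0=c$, $c_{i+1}=(f^{(i+1)})^{-1}(f^{(i)}(c_i))$ for $i=0,\dots,N-1$, the terms at $\xi_0=-\infty$ and $\xi_{N+1}=\infty$ are zero, and $u(\xi\pm,t)$ denote one-sided spatial traces. Existence and uniqueness of the entropy solution, and existence of these traces, are known. The entropy solution satisfies the Rankine--Hugoniot condition $f^{(i-1)}(u(\xi_i-,t))=f^{(i)}(u(\xi_i+,t))$. Grid. $\Delta x,\Delta t>0$, $\lambda=\Delta t/\Delta x$ is a fixed constant; cells $\mathcal{C}_j=(x_{j-1/2},x_{j+1/2})$, $x_{j+1/2}-x_{j-1/2}=\Delta x$, $j\in\mathbb{Z}$; $t^n=n\Delta t$, $\mathcal{C}^n=(t^n,t^{n+1})$, $T=(M+1)\Delta t$; $\mathcal{C}_j^n=\mathcal{C}_j\times\mathcal{C}^n$. The grid is aligned: $\xi_i=x_{P_i-1/2}$ with integers $P_i$, $i=1,\dots,N$; put $P_0=-\infty$, $P_{N+1}=\infty$. Scheme. $$u_j^0=\frac1{\Delta x}\int_{\mathcal{C}_j}u_0\,dx,\quad j\in\mathbb{Z};\qquad u_j^{n+1}=u_j^n-\lambda\big(f^{(i)}(u_j^n)-f^{(i)}(u_{j-1}^n)\big),\quad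 n\ge0,\ P_i<j<P_{i+1},\ 0\le i\le N;$$ $$u_{P_i}^{n+1}=(f^{(i)})^{-1}\big(f^{(i-1)}(u_{P_i-1}^{n+1})\big),\quad n\ge0,\ 0<i\le N.$$ The numerical solution is $u_{\Delta t}(x,t)=u_j^n$ for $x\in\mathcal{C}_j$, $t\in[t^n,t^{n+1})$, so $u_{\Delta t}(x,T)=u_j^{M+1}$ on $\mathcal{C}_j$. CFL condition. $\lambda\max_i\max_{u}(f^{(i)})'(u)\le1$, where for each $i$ the inner maximum is over the bounded interval $J_i$ of relevant values: $J_0=[\operatorname{ess\,inf}_{D_0}u_0,\operatorname{ess\,sup}_{D_0}u_0]$, and $J_i$ is the smallest closed interval containing $[\operatorname{ess\,inf}_{D_i}u_0,\operatorname{ess\,sup}_{D_i}u_0]$ and $(f^{(i)})^{-1}(f^{(i-1)}(J_{i-1}))$. *)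

(* Defs.v *)
Set Warnings "-notation-incompatible-prefix,-notation-overridden,-ambiguous-paths".
From HB Require Import structures.
From mathcomp Require Export all_boot all_order all_algebra.
From mathcomp Require Export all_classical all_reals all_analysis.
From mathcomp Require Export ess_sup_inf.
Export Order.TTheory GRing.Theory Num.Theory.
Export numFieldNormedType.Exports.

Set Implicit Arguments.
Unset Strict Implicit.
Unset Printing Implicit Defensive.

Local Open Scope classical_set_scope.
Local Open Scope ring_scope.

Section Defs.
Context {R : realType}.
Local Notation mu := (@lebesgue_measure R).

(* BV(R) is a space of classes modulo a.e. equality: some representative has
   finite total variation over the whole line. *)
Definition bounded_variation_line (g : R -> R) : Prop :=
  exists2 h : R -> R, {ae mu, forall x, g x = h x} &
    (ereal_sup [set total_variation p.1 p.2 h |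
       p in [set p : R * R | (p.1 <= p.2)%R]] < +oo)%E.

(* The jump points are xi 1 < ... < xi N (other values of xi are irrelevant);
   this is ]xi_i, xi_{i+1}[ for 0 <= i <= N, with xi_0 = -oo and
   xi_{N+1} = +oo. *)
Definition subdomain (N : nat) (xi : nat -> R) (i : nat) : interval R :=
  Interval (if (0 < i)%N then BRight (xi i) else -oo%O)
           (if (i < N)%N then BLeft (xi i.+1) else +oo%O).

Definition piecewise_constant (N : nat) (xi : nat -> R) (k : R -> R) : Prop :=
  [/\ forall i, (0 < i < N)%N -> xi i < xi i.+1,
      forall i x y, (i <= N)%N ->
        x \in subdomain N xi i -> y \in subdomain N xi i -> k x = k y &
      forall i, (0 < i <= N)%N -> ~ {for xi i, continuous k}].

Definition inverse_fun (g : R -> R) : R -> R := 'pinv_(fun=> 0) setT g.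

(* F i stands for the flux f^(i). *)
Definition flux_family (N : nat) (xi : nat -> R) (k : R -> R)
    (f : R -> R -> R) (F : nat -> R -> R) : Prop :=
  forall i x, (i <= N)%N -> x \in subdomain N xi i -> F i = f (k x).

Definition regular_increasing (alpha : R) (g : R -> R) : Prop :=
  [/\ forall v, derivable g v 1,
      continuous (derive1 g) &
      forall v, alpha <= derive1 g v].

Fixpoint interface_constants (F : nat -> R -> R) (c : R) (i : nat) : R :=
  if i is i'.+1 then inverse_fun (F i) (F i' (interface_constants F c i'))
  else c.

Definition d_x (phi : R -> R -> R) (x t : R) : R := derive1 (phi^~ t) x.
Definition d_t (phi : R -> R -> R) (x t : R) : R := derive1 (phi x) t.

Fixpoint of_class_C (n : nat) (phi : R -> R -> R) : Prop :=
  continuous (fun p : R * R => phi p.1 p.2) /\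
  if n is m.+1 then
    [/\ forall x t, derivable (phi^~ t) x 1,
        forall x t, derivable (phi x) t 1,
        of_class_C m (d_x phi) & of_class_C m (d_t phi)]
  else True.

(* A smooth function on the closed strip R x [0, T] is the restriction of a
   smooth function on the plane; sign and support only matter on the strip. *)
Definition test_function (T : R) (phi : R -> R -> R) : Prop :=
  [/\ forall n, of_class_C n phi,
      forall x t, 0 <= t <= T -> 0 <= phi x t &
      exists K : R, forall x t, 0 <= t <= T -> K < `|x| -> phi x t = 0].

Definition continuous_L1 (T : R) (u : R -> R -> R) : Prop :=
  (forall t, 0 <= t <= T -> u^~ t \in Lfun mu 1%E) /\
  (forall t, 0 <= t <= T ->
    (fun s => 'N[mu]_1[(fun x => (u x s - u x t)%:E)])%E
      @ within `[0, T] (nbhs t) --> (0 : \bar R)%E).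

Definition bounded_Linfty (T : R) (u : R -> R -> R) : Prop :=
  measurable_fun (setT `*` `]0, T[) (fun p : R * R => u p.1 p.2) /\
  exists B : R, {ae (mu \x mu)%E, forall p : R * R,
    0 < p.2 < T -> `|u p.1 p.2| <= B}.

(* Strong one-sided traces: essential one-sided limits in L^1(0, T). *)
Definition left_trace (T : R) (u : R -> R -> R) (y : R) (g : R -> R) : Prop :=
  measurable_fun `]0, T[ g /\
  forall e : R, 0 < e -> exists2 d : R, 0 < d &
    {ae mu, forall x, y - d < x < y ->
      (\int[mu]_(t in `]0%R, T[) `|u x t - g t|%:E <= e%:E)%E}.

Definition right_trace (T : R) (u : R -> R -> R) (y : R) (g : R -> R) : Prop :=
  measurable_fun `]0, T[ g /\
  forall e : R, 0 < e -> exists2 d : R, 0 < d &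
    {ae mu, forall x, y < x < y + d ->
      (\int[mu]_(t in `]0%R, T[) `|u x t - g t|%:E <= e%:E)%E}.

Definition entropy_flux (g : R -> R) (c v : R) : R :=
  Num.sg (v - c) * (g v - g c).

(* um i and up i are the traces u(xi_i -, .) and u(xi_i +, .). *)
Definition entropy_functional (T : R) (N : nat) (xi : nat -> R)
    (F : nat -> R -> R) (u0 : R -> R) (u : R -> R -> R)
    (um up : nat -> R -> R) (c : R) (phi : R -> R -> R) : R :=
  \sum_(0 <= i < N.+1)
    let ci := interface_constants F c i in
    let D := [set` subdomain N xi i] in
    (\int[mu]_(t in `]0, T[) (\int[mu]_(x in D)
        (`|u x t - ci| * d_t phi x t
         + entropy_flux (F i) ci (u x t) * d_x phi x t))
     - \int[mu]_(x in D) (`|u x T - ci| * phi x T)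
     + \int[mu]_(x in D) (`|u0 x - ci| * phi x 0)
     - (if (i < N)%N then
          \int[mu]_(t in `]0, T[)
             (entropy_flux (F i) ci (um i.+1 t) * phi (xi i.+1) t)
        else 0)
     + (if (0 < i)%N then
          \int[mu]_(t in `]0, T[)
             (entropy_flux (F i) ci (up i t) * phi (xi i) t)
        else 0)).

(* The boundary terms make each summand of the entropy functional a statement
   about one subdomain only, so the coupling across the interfaces has to come
   from the Rankine-Hugoniot condition on the traces. *)
Definition entropy_solution (T : R) (N : nat) (xi : nat -> R)
    (F : nat -> R -> R) (u0 : R -> R) (u : R -> R -> R) : Prop :=
  [/\ continuous_L1 T u,
      bounded_Linfty T u &
      exists um up : nat -> R -> R,
      [/\ forall i, (0 < i <= N)%N -> left_trace T u (xi i) (um i),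
          forall i, (0 < i <= N)%N -> right_trace T u (xi i) (up i),
          forall i, (0 < i <= N)%N ->
            {ae mu, forall t, 0 < t < T -> F i.-1 (um i t) = F i (up i t)} &
          forall (c : R) (phi : R -> R -> R), test_function T phi ->
            0 <= entropy_functional T N xi F u0 u um up c phi]].

(* The grid point x_{j - 1/2}; the offset a = x_{-1/2} of the grid is free. *)
Definition grid_point (a dx : R) (j : int) : R := a + j%:~R * dx.

(* P_i < j < P_{i+1}, with P_0 = -oo and P_{N+1} = +oo. *)
Definition between_interfaces (N : nat) (P : nat -> int) (i : nat) (j : int) :=
  ((0 < i)%N ==> (P i < j)) && ((i < N)%N ==> (j < P i.+1)).

(* U n j stands for u_j^n. *)
Definition upwind_scheme (N : nat) (F : nat -> R -> R) (u0 : R -> R)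
    (lambda a dx : R) (P : nat -> int) (U : nat -> int -> R) : Prop :=
  [/\ forall j, U 0%N j =
        dx^-1 * \int[mu]_(x in `]grid_point a dx j, grid_point a dx (j + 1)[)
                  u0 x,
      forall n i j, (i <= N)%N -> between_interfaces N P i j ->
        U n.+1 j = U n j - lambda * (F i (U n j) - F i (U n (j - 1))) &
      forall n i, (0 < i <= N)%N ->
        U n.+1 (P i) = inverse_fun (F i) (F i.-1 (U n.+1 (P i - 1)))].

(* Value u_j^n on the cell [x_{j-1/2}, x_{j+1/2}[ x [t^n, t^{n+1}[. *)
Definition numerical_solution (a dx dt : R) (U : nat -> int -> R)
    (x t : R) : R :=
  U (Num.truncn (t / dt)) (Num.floor ((x - a) / dx)).

Definition essential_range_hull (I : interval R) (g : R -> R) : set R :=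
  [set v : R |
    (ess_inf (mrestr mu (measurable_itv I)) (EFin \o g) <= v%:E)%E /\
    (v%:E <= ess_sup (mrestr mu (measurable_itv I)) (EFin \o g))%E].

Definition smallest_closed_interval (A : set R) : set R :=
  smallest [set J : set R | exists a b : R, J = [set` `[a, b]]] A.

Fixpoint relevant_values (N : nat) (xi : nat -> R) (F : nat -> R -> R)
    (u0 : R -> R) (i : nat) : set R :=
  if i is i'.+1 then
    smallest_closed_interval
      (essential_range_hull (subdomain N xi i) u0 `|`
       inverse_fun (F i) @` (F i' @` relevant_values N xi F u0 i'))
  else essential_range_hull (subdomain N xi 0) u0.

Definition CFL (N : nat) (xi : nat -> R) (F : nat -> R -> R) (u0 : R -> R)
    (lambda : R) : Prop :=
  forall i v, (i <= N)%N -> relevant_values N xi F u0 i v ->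
    lambda * derive1 (F i) v <= 1.

End Defs.

(* Main.v *)
Require Import Defs.
From mathcomp Require Import measurable_realfun ring lra zify.
Set Implicit Arguments.
Unset Strict Implicit.
Unset Printing Implicit Defensive.
Local Open Scope classical_set_scope.
Local Open Scope ring_scope.

(** The proof doubles the variables in the manner of Kuznetsov, with the cell
    values of the scheme in the role of the constants of the entropy
    inequality of [u].

    Every flux is increasing, so the flux value [q = F_i(U)] can be used as
    the unknown.  It is continuous across an interface, for the scheme by the
    discrete Rankine--Hugoniot condition and for [u] by the one on the traces.
    Moreover the constants [c_0, c_1, ...] that the entropy inequality attaches
    to one another are exactly the numbers [F_i^-1(q)] with the same [q]
    ([interface_constants_flux]).  Hence each cell value of the scheme, read as
    a flux value, is admissible on the whole line, and the boundary terms at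
    the interfaces cancel in pairs ([interface_flux_cancel]).

    The test functions are products of a [hat] in [x] and a [hat] in [t]: the
    indicator functions of the mesh cells smoothed, from one side, at the scale
    [eps = sqrt dx].  They form a partition of unity, and their derivatives are
    differences of neighbouring values of one kernel [ker].  Adding the entropy
    inequalities of all cells gives [entropy_summed], with three contributions.

    - At the times [T] and [0] the hats average the scheme over a distance
      [eps] in space and in time, which costs [eps] times a total variation;
      what is left is the distance of [u(., T)] to the scheme, which is to be
      estimated, and the distance of [u_0] to its cell averages, which is
      [O(dx)] in L1.
    - In the interior, summation by parts in both indices moves the differences
      from the kernels to the scheme ([discrete_entropy_by_parts]).  What
      appears is the entropy residual of the scheme, nonpositive by
      monotonicity of the upwind step ([scheme_entropy]) except on the
      interface cells and on cells seen from the wrong side of an interface.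
      Those only matter on strips of width [eps + dx] around the interfaces.
    - The weights produced by the two summations are not the same, but they
      differ by a second order quantity in [dx / eps] ([kernel_mismatch]).

    All this needs bounds on the variation of the flux values that are uniform
    in the grid.  They come from one inequality, [flux_val_variation]: the jump
    in space plus the increment in time entering a cell dominate those leaving
    it, on regular cells by monotonicity and the CFL condition and on interface
    cells by the triangle inequality.  Summed along the grid it bounds both the
    variation in space at every time level and the variation in time of every
    cell ([variation_bound]).

    Finally, the sums range over a finite window of cells.  The scheme is
    upwind, so the right end of the window contributes a term with a favourable
    sign, while the left end contributes one that vanishes as the window
    recedes, because [u] is integrable over the strip ([flux_left_tail]) and
    the scheme tends to [0] on the left at each time level
    ([flux_far_left]).  Monotone convergence in the window gives the estimate
    on the line ([L1_error_le]), and with [eps = sqrt dx] every error is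
    [O(sqrt dx)]. *)

(** * Smooth functions of one variable *)
Section SmoothFunctions.
Context {R : realType}.
Implicit Types (f g : R -> R).

(** Iterated differentiability with explicit derivatives: closure under products
    and quotients is then an induction, and products of such functions of
    separate variables are of class C^n in the plane. *)
Fixpoint smooth_upto (n : nat) f : Prop :=
  if n is m.+1 then
    exists2 f' : R -> R, (forall x : R, is_derive x 1 f (f' x)) & smooth_upto m f'
  else continuous f.

Definition smooth f := forall n, smooth_upto n f.

Lemma is_derive_continuous f (f' : R -> R) :
  (forall x : R, is_derive x 1 f (f' x)) -> continuous f.
Proof.
by move=> df x; apply/differentiable_continuous/derivable1_diffP; have [] := df x.
Qed.

Lemma smooth_upto_continuous n f : smooth_upto n f -> continuous f.
Proof. by case: n => [//|n [f' /is_derive_continuous]]. Qed.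

Lemma smooth_upto_leS n f : smooth_upto n.+1 f -> smooth_upto n f.
Proof.
elim: n f => [|n IH] f [f' df sf']; first exact: is_derive_continuous df.
by exists f' => //; exact: IH.
Qed.

Lemma smooth_uptoD n f g :
  smooth_upto n f -> smooth_upto n g -> smooth_upto n (fun x => f x + g x).
Proof.
elim: n f g => [|n IH] f g /=.
  by move=> cf cg x; apply: cvgD; [exact: cf|exact: cg].
move=> [f' df sf'] [g' dg sg']; exists (fun x => f' x + g' x); last exact: IH.
by move=> x; exact: is_deriveD.
Qed.

Lemma smooth_uptoM n f g :
  smooth_upto n f -> smooth_upto n g -> smooth_upto n (fun x => f x * g x).
Proof.
elim: n f g => [|n IH] f g.
  by move=> cf cg x; apply: cvgM; [exact: cf|exact: cg].
move=> sf sg; case: (sf) (sg) => f' df sf' [g' dg sg'].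
exists (fun x => f x * g' x + g x * f' x); last first.
  by apply: smooth_uptoD; apply: IH => //; exact: smooth_upto_leS.
by move=> x; exact: is_deriveM.
Qed.

Lemma smooth_upto_cst n (c : R) : smooth_upto n (fun=> c).
Proof.
elim: n c => [|n IH] c /=; first by move=> x; exact: cvg_cst.
by exists (fun=> 0) => // x; exact: is_derive_cst.
Qed.

Lemma smooth_uptoV n f : (forall x, f x != 0) ->
  smooth_upto n f -> smooth_upto n (fun x => (f x)^-1).
Proof.
move=> f0; elim: n => [|n IH].
  by move=> cf x; apply: cvgV => //; exact: cf.
move=> sf; have sV := IH (smooth_upto_leS sf); case: sf => f' df sf'.
exists (fun x => -1 * ((f x)^-1 * (f x)^-1 * f' x)); last first.
  apply: smooth_uptoM; first exact: smooth_upto_cst.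
  by do 2! apply: smooth_uptoM => //.
move=> x; have := is_deriveV (f0 x) (df x).
by move=> drv; apply: (is_derive_eq drv); rewrite /GRing.scale /= expr2 invfM; ring.
Qed.

Lemma is_derive_affine f (f' : R -> R) (a b : R) :
  (forall x : R, is_derive x 1 f (f' x)) ->
  forall x : R, is_derive x 1 (fun x => f (a * x + b)) (a * f' (a * x + b)).
Proof.
move=> df x.
have dl : is_derive x 1 (fun x => a * x + b) a.
  have da : is_derive x 1 (fun x : R => a *: x) (a *: (1:R)).
    exact: (is_deriveZ (f := id)).
  have := @is_deriveD _ _ _ (fun x : R => a *: x) (cst b) x 1 _ _ da
    (is_derive_cst b x 1).
  by move=> drv; apply: (is_derive_eq drv); rewrite addr0 /GRing.scale /= mulr1.
have := @is_derive1_comp R f (fun x => a * x + b) x _ _ (df _) dl.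
by move=> drv; apply: (is_derive_eq drv); rewrite mulrC.
Qed.

Lemma smooth_upto_affine n f (a b : R) :
  smooth_upto n f -> smooth_upto n (fun x => f (a * x + b)).
Proof.
elim: n f => [|n IH] f.
  move=> cf x; apply: (@continuous_comp _ _ _ (fun x => a * x + b) f); last exact: cf.
  apply: cvgD; last exact: cvg_cst.
  by apply: cvgM; [exact: cvg_cst|exact: cvg_id].
move=> [f' df sf']; exists (fun x => a * f' (a * x + b)).
  exact: is_derive_affine.
by apply: smooth_uptoM; [exact: smooth_upto_cst|exact: IH].
Qed.

Lemma is_derive_tensor_x (A B : R -> R) (a x t : R) : is_derive x 1 A a ->
  is_derive x 1 (fun x => A x * B t) (a * B t).
Proof.
move=> dA; have := @is_deriveM _ _ A (cst (B t)) x 1 _ _ dA (is_derive_cst _ _ _).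
by move=> drv; apply: (is_derive_eq drv); rewrite /GRing.scale /= mulr0 add0r mulrC.
Qed.

Lemma is_derive_tensor_t (A B : R -> R) (b x t : R) : is_derive t 1 B b ->
  is_derive t 1 (fun t => A x * B t) (A x * b).
Proof.
move=> dB; have := @is_deriveM _ _ (cst (A x)) B t 1 _ _ (is_derive_cst _ _ _) dB.
by move=> drv; apply: (is_derive_eq drv); rewrite /GRing.scale /= mulr0 addr0.
Qed.

Lemma d_x_tensor (A A' B : R -> R) : (forall x : R, is_derive x 1 A (A' x)) ->
  d_x (fun x t => A x * B t) = fun x t => A' x * B t.
Proof.
move=> dA; apply/funext => x; apply/funext => t; rewrite /d_x derive1E.
by have [] := is_derive_tensor_x B t (dA x).
Qed.

Lemma d_t_tensor (A B B' : R -> R) : (forall t : R, is_derive t 1 B (B' t)) ->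
  d_t (fun x t => A x * B t) = fun x t => A x * B' t.
Proof.
move=> dB; apply/funext => x; apply/funext => t; rewrite /d_t derive1E.
by have [] := is_derive_tensor_t A x (dB t).
Qed.

Lemma of_class_C_tensor n (A B : R -> R) :
  smooth_upto n A -> smooth_upto n B -> of_class_C n (fun x t => A x * B t).
Proof.
have cont f g : continuous f -> continuous g ->
    continuous (fun p : R * R => f p.1 * g p.2).
  move=> cf cg [x t]; apply: cvgM => /=.
    by apply: (@cvg_comp _ _ _ fst f); [exact: cvg_fst|exact: cf].
  by apply: (@cvg_comp _ _ _ snd g); [exact: cvg_snd|exact: cg].
elim: n A B => [|n IH] A B sA sB /=; first by split=> //; exact: cont.
split; first by apply: cont; [exact: smooth_upto_continuous sA|exact: smooth_upto_continuous sB].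
have sA' := smooth_upto_leS sA; have sB' := smooth_upto_leS sB.
case: sA sB => A' dA sdA [B' dB sdB]; split.
- by move=> x t; have [] := is_derive_tensor_x B t (dA x).
- by move=> x t; have [] := is_derive_tensor_t A x (dB t).
- by rewrite (d_x_tensor B dA); exact: IH.
- by rewrite (d_t_tensor A dB); exact: IH.
Qed.

End SmoothFunctions.

(** * A smooth step *)
Section SmoothStep.
Context {R : realType}.

(** The functions [p(1/x) exp(-1/x)], extended by [0] to [x <= 0].  The family
    is closed under differentiation, so that smoothness of all its members
    reduces to one derivative computation. *)
Definition flat (p : {poly R}) (x : R) : R :=
  if 0 < x then p.[x^-1] * expR (- x^-1) else 0.

Lemma pow_expRN_bounded k : exists2 C : R, 0 <= C &
  forall y, 0 <= y -> y ^+ k * expR (- y) <= C.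
Proof.
exists k.+1`!%:R => // y y0.
have [y1|y1] := leP y 1.
  rewrite (@le_trans _ _ 1) ?ler1n ?fact_gt0//.
  by rewrite mulr_ile1 ?exprn_ge0 ?expR_ge0 ?exprn_ile1// expR_le1 oppr_le0.
have := @expR_ge1Dxn R y k y0; rewrite expRN ler_pdivrMr ?expR_gt0// => h.
have f0 : (0:R) < k.+1`!%:R by rewrite ltr0n fact_gt0.
rewrite mulrC -ler_pdivrMr// (le_trans _ h)//.
rewrite (@le_trans _ _ (y ^+ k.+1 / k.+1`!%:R)) ?lerDr//.
by rewrite ler_pM2r ?invr_gt0// exprS ler_peMl ?exprn_ge0// ltW.
Qed.

Lemma poly_expRN_bounded (p : {poly R}) : exists2 C : R, 0 <= C &
  forall y, 0 <= y -> `|p.[y]| * expR (- y) <= C.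
Proof.
elim/poly_ind: p => [|p c [C C0 hC]].
  by exists 0 => // y y0; rewrite horner0 normr0 mul0r.
have /all_sig2 [D D0 hD] : forall k, {D : R | 0 <= D &
    forall y, 0 <= y -> y ^+ k * expR (- y) <= D}.
  by move=> k; apply/cid2/pow_expRN_bounded.
exists (\sum_(i < size (p * 'X + c%:P)) `|(p * 'X + c%:P)`_i| * D i).
  by apply: sumr_ge0 => i _; rewrite mulr_ge0.
move=> y y0; rewrite horner_coef.
apply: (@le_trans _ _ ((\sum_(i < size (p * 'X + c%:P)) `|(p * 'X + c%:P)`_i| * y ^+ i) * expR (- y))).
  rewrite ler_wpM2r ?expR_ge0// (le_trans (ler_norm_sum _ _ _))//.
  apply: ler_sum => i _; rewrite normrM ler_wpM2l// ger0_norm ?exprn_ge0//.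
rewrite mulr_suml; apply: ler_sum => i _.
by rewrite -mulrA ler_wpM2l// hD.
Qed.

(** A quadratic bound at the origin is what differentiability there needs. *)
Lemma flat_quadratic p : exists2 C : R, 0 <= C & forall x, `|flat p x| <= C * x ^+ 2.
Proof.
have [C C0 hC] := poly_expRN_bounded ('X^2 * p).
exists C => // x; rewrite /flat; case: ifPn => [x0|]; last first.
  by move=> _; rewrite normr0 mulr_ge0// sqr_ge0.
have := hC x^-1; rewrite invr_ge0 (ltW x0) => /(_ isT).
rewrite hornerM hornerXn normrM (ger0_norm (x := _ ^+ 2)) ?sqr_ge0// => h.
rewrite normrM (ger0_norm (expR_ge0 _)).
have x20 : 0 < x ^+ 2 by rewrite exprn_gt0.
rewrite -ler_pdivrMr// mulrC; apply: le_trans h; rewrite exprVn mulrA.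
by [].
Qed.

Lemma is_derive_flat p (x : R) :
  is_derive x 1 (flat p) (flat ('X^2 * (p - p^`())) x).
Proof.
have [x0|x0|->] := ltgtP x 0.
- have -> : flat ('X^2 * (p - p^`())) x = 0 by rewrite /flat ltNge (ltW x0).
  have e : \near x, cst (0:R) x = flat p x.
    by near=> y; rewrite /flat ltNge ltW//=; near: y; exact: lt_nbhsl.
  exact: near_eq_is_derive e (is_derive_cst (0:R) x (1:R)).
- have e : \near x, p.[x^-1] * expR (- x^-1) = flat p x.
    by near=> y; rewrite /flat ifT//; near: y; exact: lt_nbhsr.
  apply: near_eq_is_derive e _.
  rewrite [flat _ x]/flat x0.
  have xn0 : x != 0 by rewrite gt_eqF.
  have dV : is_derive x 1 (fun y : R => y^-1) (- x ^- 2 *: (1:R)).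
    exact: (is_deriveV (f := id)).
  have dp := @is_derive1_comp R (horner p) (fun y => y^-1) x _ _ (is_derive_poly _ _) dV.
  have dN : is_derive x 1 (fun y : R => - y^-1) (- (- x ^- 2 *: (1:R))).
    exact: (is_deriveN (f := fun y : R => y^-1)).
  have de := @is_derive1_comp R expR (fun y => - y^-1) x _ _ (is_derive_expR _) dN.
  have := is_deriveM dp de; move=> drv; apply: (is_derive_eq drv).
  by rewrite /GRing.scale /= !hornerE /= exprVn; ring.
- have [C C0 hC] := flat_quadratic p.
  have -> q : flat q 0 = 0 :> R by rewrite /flat ltxx.
  suff h : (h^-1 *: (flat p (h *: (1:R) + 0) - flat p 0)) @[h --> 0^'] --> (0:R).
    split; first by rewrite /derivable; apply/cvg_ex; exists 0; exact: h.
    by rewrite /derive; apply/cvg_lim => //; exact: h.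
  apply/cvgrPdist_le => e e0; near=> h.
  rewrite sub0r normrN addr0 (_ : flat p 0 = 0) ?subr0; last by rewrite /flat ltxx.
  rewrite /GRing.scale /= mulr1.
  have h0 : h != 0 by near: h; exact: nbhs_dnbhs_neq.
  rewrite normrM normfV mulrC ler_pdivrMr ?normr_gt0//.
  apply: le_trans (hC _) _; rewrite -normr_id -real_normK ?num_real//.
  rewrite normr_id expr2 mulrA ler_wpM2r// .
  have : `|h| <= e / (C + 1).
    near: h; apply: dnbhs0_le; rewrite divr_gt0// ltr_wpDl//.
  rewrite ler_pdivlMr ?ltr_wpDl// => he.
  by apply: le_trans he; rewrite mulrC ler_wpM2l// lerDl.
Unshelve. all: by end_near. Qed.

Lemma smooth_flat p : smooth (flat p).
Proof.
move=> n; elim: n p => [|n IH] p /=.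
  exact: is_derive_continuous (is_derive_flat p).
exists (flat ('X^2 * (p - p^`()))); last exact: IH.
exact: is_derive_flat.
Qed.

Lemma flat_le0 p (x : R) : x <= 0 -> flat p x = 0.
Proof. by move=> x0; rewrite /flat ltNge x0. Qed.

(** The denominator is positive everywhere because [x] and [1 - x] are not both
    nonpositive. *)
Definition step (x : R) : R := flat 1 x * (flat 1 x + flat 1 (1 - x))^-1.

Definition dstep (x : R) : R :=
  (flat 'X^2 x * flat 1 (1 - x) + flat 1 x * flat 'X^2 (1 - x))
  * ((flat 1 x + flat 1 (1 - x))^-1 * (flat 1 x + flat 1 (1 - x))^-1).

Lemma flat1_ge0 (x : R) : 0 <= flat 1 x.
Proof. by rewrite /flat; case: ifP => // _; rewrite hornerC mul1r expR_ge0. Qed.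

Lemma flat1_gt0 (x : R) : 0 < x -> 0 < flat 1 x.
Proof. by move=> x0; rewrite /flat x0 hornerC mul1r expR_gt0. Qed.

Lemma flatX2_ge0 (x : R) : 0 <= flat 'X^2 x.
Proof.
rewrite /flat; case: ifP => // _.
by rewrite hornerXn mulr_ge0 ?sqr_ge0 ?expR_ge0.
Qed.

Lemma step_den_gt0 (x : R) : 0 < flat 1 x + flat 1 (1 - x).
Proof.
have [x0|x0] := ltP 0 x; first by rewrite ltr_pwDl ?flat1_gt0 ?flat1_ge0.
by rewrite ltr_wpDl ?flat1_ge0// flat1_gt0// subr_gt0 (le_lt_trans x0).
Qed.

Lemma is_derive_flat1 (x : R) : is_derive x 1 (flat 1) (flat 'X^2 x).
Proof. by have := is_derive_flat 1 x; rewrite derivC subr0 mulr1. Qed.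

Lemma is_derive_step (x : R) : is_derive x 1 step (dstep x).
Proof.
have d1 := is_derive_flat1 x.
have d2 : is_derive x 1 (fun x => flat 1 (1 - x)) (- flat 'X^2 (1 - x)).
  have := is_derive_affine (-1) 1 is_derive_flat1 x.
  rewrite (_ : (fun _ => _) = (fun x => flat 1 (1 - x))).
    by move=> drv; apply: (is_derive_eq drv); rewrite mulN1r mulN1r addrC.
  by apply/funext => y; rewrite mulN1r addrC.
have d3 := is_deriveD d1 d2.
have d4 := is_deriveV (f := fun x => flat 1 x + flat 1 (1 - x)) (lt0r_neq0 (step_den_gt0 x)) d3.
have := is_deriveM d1 d4; move=> drv; apply: (is_derive_eq drv).
rewrite /GRing.scale /= /dstep.
have /gt_eqF/negbT := step_den_gt0 x.
move: (flat 1 x) (flat 1 (1 - x)) (flat 'X^2 x) (flat 'X^2 (1 - x)) => a b c d ab.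
by field.
Qed.

Lemma smooth_dstep : smooth dstep.
Proof.
move=> n.
have den : smooth_upto n (fun x => flat 1 x + flat 1 (1 - x)).
  apply: smooth_uptoD; first exact: smooth_flat.
  rewrite (_ : (fun _ => _) = (fun x => flat 1 (-1 * x + 1))).
    exact/smooth_upto_affine/smooth_flat.
  by apply/funext => y; rewrite mulN1r addrC.
have den0 x : flat 1 x + flat 1 (1 - x) != 0 by rewrite gt_eqF ?step_den_gt0.
have rev p : smooth_upto n (fun x => flat p (1 - x)).
  rewrite (_ : (fun _ => _) = (fun x => flat p (-1 * x + 1))).
    exact/smooth_upto_affine/smooth_flat.
  by apply/funext => y; rewrite mulN1r addrC.
apply: smooth_uptoM; last by apply: smooth_uptoM; apply: smooth_uptoV.
by apply: smooth_uptoD; apply: smooth_uptoM => //; exact: smooth_flat.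
Qed.

Lemma dstep_ge0 (x : R) : 0 <= dstep x.
Proof.
by rewrite mulr_ge0 ?addr_ge0 ?mulr_ge0 ?invr_ge0 ?flat1_ge0 ?flatX2_ge0
  ?(ltW (step_den_gt0 _)).
Qed.

Lemma dstep_out (x : R) : x <= 0 \/ 1 <= x -> dstep x = 0.
Proof.
move=> [x0|x1]; rewrite /dstep.
  by rewrite !(flat_le0 _ x0) !mul0r addr0 mul0r.
have x1' : 1 - x <= 0 by rewrite subr_le0.
by rewrite !(flat_le0 _ x1') !mulr0 addr0 mul0r.
Qed.

Lemma continuous_bounded_supp (f : R -> R) : continuous f ->
  (forall x, x < 0 \/ 1 < x -> f x = 0) ->
  exists2 c : R, 0 < c & forall x, `|f x| <= c.
Proof.
move=> cf f0.
have cn : {within `[0, 1], continuous (fun x => `|f x| : R)}.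
  by apply: continuous_subspaceT => x; apply: cvg_norm; exact: cf.
have [c _ hc] := EVT_max ler01 cn.
exists (`|f c| + 1); first by rewrite ltr_wpDl.
move=> x; have [x0|x0] := ltP x 0; first by rewrite f0 ?normr0 ?addr_ge0//; left.
have [x1|x1] := ltP 1 x; first by rewrite f0 ?normr0 ?addr_ge0//; right.
by rewrite (le_trans (hc x _)) ?lerDl// ?in_itv/= ?x0 ?x1// (le_trans (ler_norm _))// lerDl.
Qed.

Lemma lipschitz_of_derive (f f' : R -> R) c :
  (forall x : R, is_derive x 1 f (f' x)) -> (forall x, `|f' x| <= c) ->
  forall x y, `|f x - f y| <= c * `|x - y|.
Proof.
move=> df fc x y; wlog yx : x y / y <= x.
  move=> H; have [/H//|/ltW/H] := leP y x.
  by rewrite distrC (distrC x).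
have cf : {within `[y, x], continuous f}.
  exact/continuous_subspaceT/is_derive_continuous.
have [z _ ->] := @MVT_segment R f f' y x yx (fun x _ => df x) cf.
by rewrite normrM ler_wpM2r.
Qed.

(** What the estimates use of a smooth step [H] with derivative [b]: the bound
    [c1] gives the size of the kernels and the Lipschitz constant [c2] of [b]
    the second order remainder of [H]. *)
Record step_profile (H b : R -> R) (c1 c2 : R) : Prop := StepProfile {
  sp_c1 : 0 < c1;
  sp_c2 : 0 < c2;
  sp_smooth : smooth H;
  sp_deriv : forall x : R, is_derive x 1 H (b x);
  sp_le0 : forall x, x <= 0 -> H x = 0;
  sp_ge1 : forall x, 1 <= x -> H x = 1;
  sp_b_ge0 : forall x, 0 <= b x;
  sp_b_le : forall x, b x <= c1;
  sp_b_out : forall x, x <= 0 \/ 1 <= x -> b x = 0;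
  sp_b_lip : forall x y, `|b x - b y| <= c2 * `|x - y| }.

Lemma step_profile_exists : exists H b c1 c2, step_profile H b c1 c2.
Proof.
have cd : continuous dstep := smooth_dstep 0.
have [c1 c10 h1] := continuous_bounded_supp cd
  (fun x hx => dstep_out (match hx with or_introl h => or_introl (ltW h)
                                      | or_intror h => or_intror (ltW h) end)).
have [d2 ds sd2] := smooth_dstep 1.
have [c2 c20 h2] : exists2 c : R, 0 < c & forall x, `|d2 x| <= c.
  apply: continuous_bounded_supp => // x hx.
  have e : \near x, dstep x = cst (0 : R) x.
    case: hx => hx; near=> y; apply: dstep_out; [left|right]; apply: ltW; near: y.
      exact: lt_nbhsl.
    exact: lt_nbhsr.
  have [_ <-] := ds x; rewrite (near_eq_derive _ e).
  by have [] := is_derive_cst (0:R) x (1:R).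
exists step, dstep, c1, c2; split => //.
- by move=> [|n]; [exact: is_derive_continuous is_derive_step|exists dstep;
    [exact: is_derive_step|exact: smooth_dstep]].
- exact: is_derive_step.
- by move=> x x0; rewrite /step flat_le0// mul0r.
- move=> x x1; rewrite /step [flat 1 (1 - x)]flat_le0 ?subr_le0// addr0 divff//.
  by rewrite gt_eqF// flat1_gt0// (lt_le_trans ltr01).
- exact: dstep_ge0.
- by move=> x; rewrite (le_trans (ler_norm _)).
- exact: dstep_out.
- exact: lipschitz_of_derive ds h2.
Unshelve. all: by end_near. Qed.

End SmoothStep.

(** * One flux and one upwind step *)
Section Flux.
Context {R : realType}.
Variables (alpha : R) (g : R -> R).
Hypotheses (alpha_gt0 : 0 < alpha) (g_reg : regular_increasing alpha g).

Let g_der (x : R) : is_derive x 1 g (derive1 g x).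
Proof. by case: g_reg => dg _ _; rewrite derive1E; exact/derivableP. Qed.

Lemma flux_continuous : continuous g.
Proof. exact: is_derive_continuous g_der. Qed.

Lemma flux_MVT (x y : R) : y <= x ->
  exists2 c, y <= c <= x & g x - g y = derive1 g c * (x - y).
Proof.
move=> yx; have cf : {within `[y, x], continuous g}.
  exact/continuous_subspaceT/flux_continuous.
have [c] := @MVT_segment R g (derive1 g) y x yx (fun x _ => g_der x) cf.
by rewrite in_itv /= => hc e; exists c.
Qed.

Lemma flux_increase (x y : R) : y <= x -> alpha * (x - y) <= g x - g y.
Proof.
move=> yx; have [c _ ->] := flux_MVT yx; rewrite ler_wpM2r ?subr_ge0//.
by case: g_reg.
Qed.

Lemma flux_le (x y : R) : (g x <= g y) = (x <= y).
Proof.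
apply/idP/idP => [|xy]; last first.
  by rewrite -subr_ge0 (le_trans _ (flux_increase xy))// mulr_ge0 ?subr_ge0// ltW.
apply: contraTT; rewrite -!ltNge => yx; rewrite -subr_gt0.
by rewrite (lt_le_trans _ (flux_increase (ltW yx)))// mulr_gt0 ?subr_gt0.
Qed.

Lemma flux_inj : injective g.
Proof. by move=> x y e; apply/eqP; rewrite eq_le -(flux_le x y) -(flux_le y x) e lexx. Qed.

Lemma flux_dist_ge (x y : R) : alpha * `|x - y| <= `|g x - g y|.
Proof.
wlog yx : x y / y <= x.
  move=> H; have [/H//|/ltW/H] := leP y x.
  by rewrite distrC (distrC (g y)).
rewrite !ger0_norm ?subr_ge0 ?flux_le//; exact: flux_increase.
Qed.

Lemma flux_surj (v : R) : exists x, g x = v.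
Proof.
pose r := `|v - g 0| / alpha.
have r0 : 0 <= r by rewrite divr_ge0 // ltW.
have rE : alpha * r = `|v - g 0| by rewrite mulrC divfK// gt_eqF.
have h1 := @flux_increase r 0 r0; have h2 : alpha * (0 - - r) <= g 0 - g (- r).
  by apply: flux_increase; rewrite oppr_le0.
rewrite subr0 rE in h1; rewrite sub0r opprK rE in h2.
have lo : g (- r) <= v by have := ler_norm (- (v - g 0)); rewrite normrN; lra.
have hi : v <= g r by have := ler_norm (v - g 0); lra.
have cf : {within `[- r, r], continuous g}.
  exact/continuous_subspaceT/flux_continuous.
have Nrr : - r <= r by lra.
have [|c _ ec] := @IVT R g (- r) r v Nrr cf; last by exists c.
by rewrite ge_min lo/= le_max hi orbT.
Qed.

Lemma inverse_funK : cancel g (inverse_fun g).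
Proof.
by move=> x; apply: (@pinvKV _ _ (fun=> 0) setT g) => // [y z _ _ /flux_inj|];
  rewrite ?inE.
Qed.

Lemma inverse_funKV : cancel (inverse_fun g) g.
Proof. by move=> v; have [x <-] := flux_surj v; rewrite inverse_funK. Qed.

Lemma inverse_fun_lip (v w : R) :
  `|inverse_fun g v - inverse_fun g w| <= alpha^-1 * `|v - w|.
Proof.
rewrite -(ler_pM2l alpha_gt0) mulrA mulfV ?gt_eqF// mul1r.
by apply: le_trans (flux_dist_ge _ _) _; rewrite !inverse_funKV.
Qed.

Lemma entropy_fluxE (c v : R) : entropy_flux g c v = `|g v - g c|.
Proof.
rewrite /entropy_flux; have [vc|vc|->] := ltgtP v c.
- rewrite ltr0_sg ?subr_lt0// mulN1r ler0_norm//.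
  by rewrite subr_le0 flux_le ltW.
- rewrite gtr0_sg ?subr_gt0// mul1r ger0_norm//.
  by rewrite subr_ge0 flux_le ltW.
- by rewrite !subrr normr0 mulr0.
Qed.

Section UpwindUpdate.
Variables (lambda : R) (J : set R).
Hypotheses (lambda_gt0 : 0 < lambda).
Hypothesis (J_conv : forall a b z, J a -> J b -> a <= z <= b -> J z).
Hypothesis (J_CFL : forall v, J v -> lambda * derive1 g v <= 1).

Lemma flux_CFL (a b : R) : J a -> J b -> lambda * `|g a - g b| <= `|a - b|.
Proof.
move=> Ja Jb; wlog ba : a b Ja Jb / b <= a.
  move=> H; have [/H|/ltW/H] := leP b a; first exact.
  by rewrite distrC (distrC b); exact.
have [c hc] := flux_MVT ba; rewrite !ger0_norm ?subr_ge0 ?flux_le// => ->.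
by rewrite mulrA ler_piMl ?subr_ge0// J_CFL//; exact: J_conv hc.
Qed.

(** Under the CFL condition [v - lambda g v] is nondecreasing, so the two terms
    of the difference have the same sign as [a - b] and norms subtract. *)
Lemma flux_step_norm (a b : R) : J a -> J b ->
  `|(a - b) - lambda * (g a - g b)| = `|a - b| - lambda * `|g a - g b|.
Proof.
move=> Ja Jb; have := flux_CFL Ja Jb; wlog ba : a b Ja Jb / b <= a.
  move=> H; have [/H|/ltW/H] := leP b a; first exact.
  move=> /(_ Jb Ja) h; rewrite distrC [X in _ <= X -> _]distrC => /h.
  rewrite (distrC b) (distrC (g b)) => <-; rewrite -normrN; congr `|_|; ring.
rewrite !(ger0_norm (x := a - b)) ?(ger0_norm (x := g a - g b)) ?subr_ge0 ?flux_le//.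
by move=> h; rewrite ger0_norm ?subr_ge0.
Qed.

Lemma upwind_mem (u ul : R) : J u -> J ul -> J (u - lambda * (g u - g ul)).
Proof.
move=> Ju Jul; have := flux_CFL Ju Jul.
have [uul|ulu] := leP u ul.
  rewrite !ler0_norm ?subr_le0 ?flux_le// => h; apply: (J_conv Ju Jul).
  have : lambda * (g ul - g u) >= 0 by apply: mulr_ge0; [exact: ltW|rewrite subr_ge0 flux_le].
  lra.
rewrite !ger0_norm ?subr_ge0 ?flux_le ?(ltW ulu)// => h; apply: (J_conv Jul Ju).
have : lambda * (g u - g ul) >= 0 by apply: mulr_ge0; [exact: ltW|rewrite subr_ge0 flux_le ltW].
lra.
Qed.

(** For [w] in [J] this is the contraction of
    [flux_step_norm].  For the other [w] the CFL condition says nothing, but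
    then [w] lies on one side of all three values and the absolute values open
    to an identity. *)
Lemma upwind_entropy (u ul w : R) : J u -> J ul ->
  `|u - lambda * (g u - g ul) - w| - `|u - w|
  + lambda * (`|g u - g w| - `|g ul - g w|) <= 0.
Proof.
move=> Ju Jul; have [Jw|nJw] := pselect (J w).
  have h1 := flux_step_norm Ju Jw.
  have -> : u - lambda * (g u - g ul) - w
    = (u - w - lambda * (g u - g w)) + lambda * (g ul - g w) by ring.
  have := ler_normD (u - w - lambda * (g u - g w)) (lambda * (g ul - g w)).
  by rewrite h1 normrM (gtr0_norm lambda_gt0); lra.
have Ju' := upwind_mem Ju Jul; set u' := u - _ in Ju' *.
have outside a b : J a -> J b -> ~ (a <= w <= b) by move=> Ja Jb /(J_conv Ja Jb).
have side : (u <= w /\ ul <= w /\ u' <= w) \/ (w <= u /\ w <= ul /\ w <= u').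
  have [uw|wu] := leP u w; [left|right]; split => //.
  - by have [|/ltW wul] := leP ul w; have [|/ltW wu'] := leP u' w => //;
      [have := outside u u' Ju Ju'|have := outside u ul Ju Jul
      |have := outside u ul Ju Jul]; rewrite uw ?wul ?wu' => /(_ isT).
  - exact: ltW.
  - by have [|/ltW wul] := leP w ul; have [|/ltW wu'] := leP w u' => //;
      [have := outside u' u Ju' Ju|have := outside ul u Jul Ju
      |have := outside ul u Jul Ju]; rewrite (ltW wu) ?wul ?wu' => /(_ isT).
have gw x : x <= w -> g x <= g w by rewrite flux_le.
have wg x : w <= x -> g w <= g x by rewrite flux_le.
case: side => -[h1 [h2 h3]].
  by rewrite !ler0_norm ?subr_le0 ?gw// /u'; lra.
by rewrite !ger0_norm ?subr_ge0 ?wg// /u'; lra.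
Qed.

(** By the scheme, [lambda] times a flux jump is a time increment.  The increment
    [u'' - u'] is the difference of [v - lambda g v] between [u'] and [u], whose
    norm is given by [flux_step_norm], plus [lambda] times the increment of the
    flux on the left. *)
Lemma upwind_time_variation (u ul u' ul' u'' : R) :
  J u -> J u' -> J ul -> J ul' ->
  u' = u - lambda * (g u - g ul) -> u'' = u' - lambda * (g u' - g ul') ->
  `|g u' - g ul'| + `|g u' - g u| <= `|g u - g ul| + `|g ul' - g ul|.
Proof.
move=> Ju Ju' Jul Jul' e1 e2.
have w1 : `|u' - u| = lambda * `|g u - g ul|.
  by rewrite -(gtr0_norm lambda_gt0) -normrM -normrN; congr `|_|; rewrite e1; ring.
have w2 : `|u'' - u'| = lambda * `|g u' - g ul'|.
  by rewrite -(gtr0_norm lambda_gt0) -normrM -normrN; congr `|_|; rewrite e2; ring.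
rewrite -(ler_pM2l lambda_gt0) !mulrDr -w1 -w2.
have h := flux_step_norm Ju' Ju.
have -> : u'' - u' = (u' - u - lambda * (g u' - g u)) + lambda * (g ul' - g ul).
  by clear -e1 e2; lra.
have := ler_normD (u' - u - lambda * (g u' - g u)) (lambda * (g ul' - g ul)).
by rewrite h [X in _ <= _ + X]normrM (gtr0_norm lambda_gt0); lra.
Qed.

Lemma upwind_time_step (u ul u' : R) : J u -> J ul -> J u' ->
  u' = u - lambda * (g u - g ul) -> `|g u' - g u| <= `|g u - g ul|.
Proof.
move=> Ju Jul Ju' e; rewrite -(ler_pM2l lambda_gt0).
apply: le_trans (flux_CFL Ju' Ju) _.
rewrite -(gtr0_norm lambda_gt0) -normrM -normrN.
by rewrite le_eqVlt; apply/orP; left; apply/eqP; congr `|_|; rewrite e; ring.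
Qed.

End UpwindUpdate.
End Flux.

(** * Variation carried along the grid *)
Section DiscreteVariation.
Context {R : realType}.
Variable p : nat -> nat -> R.
Hypothesis p_step : forall k n,
  `|p k.+1 n.+1 - p k n.+1| + `|p k.+1 n.+1 - p k.+1 n|
  <= `|p k.+1 n - p k n| + `|p k n.+1 - p k n|.

Lemma variation_across_cell k n :
  `|p k.+1 n - p k n| + \sum_(l < n) `|p k.+1 l.+1 - p k.+1 l|
  <= `|p k.+1 0%N - p k 0%N| + \sum_(l < n) `|p k l.+1 - p k l|.
Proof.
elim: n => [|n IH]; first by rewrite !big_ord0.
by rewrite !big_ord_recr /=; have := p_step k n; lra.
Qed.

(** Variation enters the rectangle of [m] cells and [n] time steps through the
    initial row and the left column, and leaves through the final row and the
    right column; [p_step] says that none is created inside. *)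
Lemma variation_bound m n :
  \sum_(k < m) `|p k.+1 n - p k n| + \sum_(l < n) `|p m l.+1 - p m l|
  <= \sum_(k < m) `|p k.+1 0%N - p k 0%N| + \sum_(l < n) `|p 0%N l.+1 - p 0%N l|.
Proof.
elim: m => [|m IH]; first by rewrite !big_ord0.
by rewrite !big_ord_recr /=; have := variation_across_cell m n; lra.
Qed.

End DiscreteVariation.

(** * Subdomains of the grid *)
Section Domains.
Variables (N : nat) (P : nat -> int).
Hypothesis P_lt : forall i, (0 < i < N)%N -> P i < P i.+1.

(** The interface cell [P i] is counted with the subdomain on its right, where
    its value is defined by the flux [F i]. *)
Definition in_dom (i : nat) (j : int) : bool :=
  [&& (i <= N)%N, (0 < i)%N ==> (P i <= j) & (i < N)%N ==> (j < P i.+1)].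

Lemma in_dom_exists j : exists i, in_dom i j.
Proof.
suff [i /and3P[iN h1 h2]] : exists i, [&& (i <= N)%N, (0 < i)%N ==> (P i <= j)
    & (i < N)%N ==> (j < P i.+1)] by exists i; apply/and3P.
elim: N => [|n [i /and3P[i_le h1 h2]]]; first by exists 0%N.
have [h|h] := leP (P n.+1) j; first by exists n.+1; rewrite leqnn h ltnn.
exists i; rewrite (leq_trans i_le)// h1 /=; apply/implyP => _.
by move: i_le; rewrite leq_eqVlt => /orP[/eqP ->//|/(implyP h2)].
Qed.

Definition dom (j : int) : nat := sval (cid (in_dom_exists j)).

Lemma domP j : in_dom (dom j) j.
Proof. exact: svalP (cid (in_dom_exists j)). Qed.

Lemma dom_leN j : (dom j <= N)%N. Proof. by case/and3P: (domP j). Qed.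

Lemma P_mono i i' : (0 < i)%N -> (i <= i' <= N)%N -> P i <= P i'.
Proof.
move=> i0 /andP[]; elim: i' => [|i' IH]; first by rewrite leqn0; case: i i0.
rewrite leq_eqVlt => /orP[/eqP <-//|]; rewrite ltnS => ii' i'N.
apply: le_trans (IH ii' (ltnW i'N)) _; apply/ltW/P_lt.
by rewrite i'N (leq_trans i0).
Qed.

Lemma in_dom_uniq i i' j : in_dom i j -> in_dom i' j -> i = i'.
Proof.
wlog ii' : i i' / (i <= i')%N.
  move=> H; have [/H//|/ltnW/H h a b] := leqP i i'.
  by rewrite (h b a).
move=> /and3P[iN _ h] /and3P[i'N h' _]; apply/eqP; rewrite eqn_leq ii' leqNgt.
apply/negP => lt_ii'; have Pj := implyP h' (leq_ltn_trans (leq0n _) lt_ii').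
have jP := implyP h (leq_trans lt_ii' i'N).
have PP : P i.+1 <= P i' by apply: P_mono; rewrite // lt_ii'.
by have := lt_le_trans jP (le_trans PP Pj); rewrite ltxx.
Qed.

Lemma dom_eq i j : in_dom i j -> dom j = i.
Proof. exact: in_dom_uniq (domP j). Qed.

Definition iface (j : int) : bool := (0 < dom j)%N && (j == P (dom j)).

Lemma dom_pred j : ~~ iface j -> dom (j - 1) = dom j.
Proof.
rewrite /iface => nj; apply: dom_eq; have /and3P[iN h1 h2] := domP j.
apply/and3P; split => //; apply/implyP => h.
  by have := implyP h1 h; move: nj; rewrite h /=; lia.
by have := implyP h2 h; lia.
Qed.

Lemma dom_pred_iface j : iface j -> dom (j - 1) = (dom j).-1.
Proof.
move=> /andP[i0 /eqP jP]; apply: dom_eq; have /and3P[iN h1 h2] := domP j.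
apply/and3P; split; first exact: leq_trans (leq_pred _) iN.
  apply/implyP => h; have : P (dom j).-1 < P (dom j).-1.+1.
    by apply: P_lt; rewrite h /= (leq_trans _ iN)// prednK.
  by rewrite prednK// -jP; lia.
by apply/implyP => h; rewrite prednK// -jP; lia.
Qed.

Lemma between_dom j : ~~ iface j -> between_interfaces N P (dom j) j.
Proof.
rewrite /iface => nj; have /and3P[iN h1 h2] := domP j.
apply/andP; split => //; apply/implyP => h.
by have := implyP h1 h; move: nj; rewrite h /=; lia.
Qed.

End Domains.

(** * Monotonicity and variation of the scheme *)
Section Scheme.
Context {R : realType}.
Variables (N : nat) (F : nat -> R -> R) (alpha lambda : R) (J : nat -> set R)
  (P : nat -> int) (U : nat -> int -> R).
Hypotheses (alpha_gt0 : 0 < alpha) (lambda_gt0 : 0 < lambda).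
Hypothesis F_reg : forall i, (i <= N)%N -> regular_increasing alpha (F i).
Hypothesis J_conv : forall i a b z, (i <= N)%N -> J i a -> J i b -> a <= z <= b -> J i z.
Hypothesis J_CFL : forall i v, (i <= N)%N -> J i v -> lambda * derive1 (F i) v <= 1.
Hypothesis J_next : forall i v, (i < N)%N -> J i v ->
  J i.+1 (inverse_fun (F i.+1) (F i v)).
Hypothesis P_lt : forall i, (0 < i < N)%N -> P i < P i.+1.

Local Notation dom := (dom N P).
Local Notation iface := (iface N P).
Local Notation between_dom := (@between_dom N P).
Local Notation dom_pred := (dom_pred P_lt).
Local Notation dom_pred_iface := (dom_pred_iface P_lt).
Local Notation dom_leN := (dom_leN N P).
Hypothesis U_init : forall j, J (dom j) (U 0%N j).
Hypothesis U_step : forall n i j, (i <= N)%N -> between_interfaces N P i j ->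
  U n.+1 j = U n j - lambda * (F i (U n j) - F i (U n (j - 1))).
Hypothesis U_iface : forall n i, (0 < i <= N)%N ->
  U n.+1 (P i) = inverse_fun (F i) (F i.-1 (U n.+1 (P i - 1))).

Lemma U_regular n j : ~~ iface j ->
  U n.+1 j = U n j - lambda * (F (dom j) (U n j) - F (dom j) (U n (j - 1))).
Proof. by move=> nj; apply: U_step; [exact: dom_leN|exact: between_dom]. Qed.

Lemma U_interface n j : iface j ->
  F (dom j) (U n.+1 j) = F (dom (j - 1)) (U n.+1 (j - 1)).
Proof.
move=> ij; rewrite dom_pred_iface//; move: ij => /andP[i0 /eqP jP].
have iN := dom_leN j.
have e : U n.+1 j = inverse_fun (F (dom j)) (F (dom j).-1 (U n.+1 (j - 1))).
  by rewrite {1 4}jP U_iface ?i0.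
by rewrite e (inverse_funKV alpha_gt0 (F_reg iN)).
Qed.

(** Double induction: an interface value at the new level is obtained from the
    value on its left at the same level, which lies in the previous
    subdomain. *)
Lemma U_mem n j : J (dom j) (U n j).
Proof.
elim: n j => [//|n IH] j.
move: {2}(dom j) (erefl (dom j)) => i; elim: i j => [|i IHi] j e.
  have nj : ~~ iface j by rewrite /iface e.
  rewrite (U_regular n nj); have iN := dom_leN j.
  apply: (upwind_mem alpha_gt0 (F_reg iN) lambda_gt0).
  - by move=> a b z; exact: J_conv.
  - by move=> v; exact: J_CFL.
  - exact: IH.
  - by rewrite -(dom_pred nj); exact: IH.
have [ij|nj] := boolP (iface j); last first.
  rewrite (U_regular n nj); have iN := dom_leN j.
  apply: (upwind_mem alpha_gt0 (F_reg iN) lambda_gt0).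
  - by move=> a b z; exact: J_conv.
  - by move=> v; exact: J_CFL.
  - exact: IH.
  - by rewrite -(dom_pred nj); exact: IH.
have dj := dom_pred_iface ij; rewrite e /= in dj.
have iN := dom_leN j; rewrite e in iN.
move: (ij) => /andP[i0 /eqP jP].
have -> : U n.+1 j = inverse_fun (F (dom j)) (F (dom j).-1 (U n.+1 (j - 1))).
  by rewrite {1 4}jP U_iface ?i0 ?dom_leN.
rewrite e; apply: J_next => //=.
by rewrite -dj; apply: IHi.
Qed.

(** The scheme in the flux variable, in which it has no jump at an interface
    after the initial level. *)
Definition flux_val (n : nat) (j : int) : R := F (dom j) (U n j).
Local Notation q := flux_val.

Let Fr j := F_reg (dom_leN j).
Let Jc j : forall a b z, J (dom j) a -> J (dom j) b -> a <= z <= b -> J (dom j) z.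
Proof. by move=> a b z; apply: J_conv; exact: dom_leN. Qed.
Let Jl j : forall v, J (dom j) v -> lambda * derive1 (F (dom j)) v <= 1.
Proof. by move=> v; apply: J_CFL; exact: dom_leN. Qed.
Let U_mem_pred n j : ~~ iface j -> J (dom j) (U n (j - 1)).
Proof. by move=> nj; rewrite -(dom_pred nj); exact: U_mem. Qed.

Lemma flux_val_iface n j : iface j -> q n.+1 j = q n.+1 (j - 1).
Proof. exact: U_interface. Qed.

(** On an interface cell the new spatial jump vanishes and the new value equals
    its left neighbour, so that the triangle inequality suffices. *)
Lemma flux_val_variation n j :
  `|q n.+1 j - q n.+1 (j - 1)| + `|q n.+1 j - q n j|
  <= `|q n j - q n (j - 1)| + `|q n.+1 (j - 1) - q n (j - 1)|.
Proof.
have [ij|nj] := boolP (iface j).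
  rewrite flux_val_iface// subrr normr0 add0r addrC (distrC (q n j)).
  apply: le_trans (ler_normD _ _).
  by rewrite le_eqVlt; apply/orP; left; apply/eqP; congr `|_|; ring.
rewrite /flux_val (dom_pred nj).
apply: (upwind_time_variation alpha_gt0 (Fr j) lambda_gt0 (@Jc j) (@Jl j)
  (U_mem _ _) (U_mem _ _) (U_mem_pred _ nj) (U_mem_pred _ nj) (U_regular n nj)
  (U_regular n.+1 nj)).
Qed.

Lemma flux_val_time_step n j : ~~ iface j ->
  `|q n.+1 j - q n j| <= `|q n j - q n (j - 1)|.
Proof.
move=> nj; rewrite /flux_val (dom_pred nj).
exact: (upwind_time_step alpha_gt0 (Fr j) lambda_gt0 (@Jc j) (@Jl j)
  (U_mem _ _) (U_mem_pred _ nj) (U_mem _ _) (U_regular n nj)).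
Qed.

(** Size of the entropy residual of a cell that is read with a flux other than
    its own, or that is an interface cell.  On a regular cell the spatial jump
    is itself [1 / lambda] times a time increment, which accounts for the
    factor [2]. *)
Definition defect (n : nat) (j : int) : R :=
  2 / alpha * `|q n.+1 j - q n j|
  + lambda * (iface j)%:R * `|q n j - q n (j - 1)|.

Let Fi_inv_lip i v w x : (i <= N)%N ->
  `|x - inverse_fun (F i) v| - `|x - inverse_fun (F i) w| <= alpha^-1 * `|v - w|.
Proof.
move=> iN; apply: le_trans (inverse_fun_lip alpha_gt0 (F_reg iN) v w).
rewrite (distrC (inverse_fun _ v)).
apply: le_trans (lerB_dist _ _) _; rewrite le_eqVlt; apply/orP; left; apply/eqP.
by congr `|_|; ring.
Qed.

(** In its own subdomain this is [upwind_entropy].  In another subdomain [i] the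
    two time values are compared through the Lipschitz inverse of [F i], and the
    spatial difference is estimated with the entropy inequality of the cell at
    the constant with flux value [F i w]. *)
Lemma scheme_entropy n j i w : (i <= N)%N ->
  `|w - inverse_fun (F i) (q n.+1 j)| - `|w - inverse_fun (F i) (q n j)|
  + lambda * (`|F i w - q n j| - `|F i w - q n (j - 1)|)
  <= (iface j || (dom j != i))%:R * defect n j.
Proof.
move=> iN; have a2 : 2 / alpha = alpha^-1 + alpha^-1 by field; rewrite gt_eqF.
have ai : 0 <= alpha^-1 by rewrite invr_ge0 ltW.
have h1 := Fi_inv_lip (q n.+1 j) (q n j) w iN.
have [ij|nj] := boolP (iface j).
  rewrite /= mul1r /defect ij mulr1 a2 mulrDl.
  have h2 : `|F i w - q n j| - `|F i w - q n (j - 1)| <= `|q n j - q n (j - 1)|.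
    apply: le_trans (lerB_dist _ _) _; rewrite le_eqVlt; apply/orP; left.
    by apply/eqP; rewrite -normrN; congr `|_|; ring.
  have h3 : 0 <= alpha^-1 * `|q n.+1 j - q n j| by rewrite mulr_ge0.
  have := ler_wpM2l (ltW lambda_gt0) h2; lra.
have ent w' := @upwind_entropy R alpha _ alpha_gt0 (Fr j) lambda _ lambda_gt0
  (@Jc j) (@Jl j) _ _ w' (U_mem n j) (U_mem_pred n nj).
have gq m : inverse_fun (F (dom j)) (q m j) = U m j.
  by rewrite /flux_val (inverse_funK alpha_gt0 (Fr j)).
have := ent; rewrite -(U_regular n nj) => {}ent.
have [ji|ji] /= := eqVneq (dom j) i.
  rewrite mul0r -ji !gq; have := ent w.
  rewrite /flux_val (dom_pred nj) (distrC w) (distrC w (U n j)).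
  by rewrite (distrC (F _ w)) (distrC (F _ w) (F _ (U n (j-1)))).
rewrite mul1r /defect (negbTE nj) mulr0 mul0r addr0 a2 mulrDl.
have := ent (inverse_fun (F (dom j)) (F i w)).
rewrite (inverse_funKV alpha_gt0 (Fr j)) -!gq.
have -> : F (dom j) (inverse_fun (F (dom j)) (q n j)) = q n j.
  by rewrite (inverse_funKV alpha_gt0 (Fr j)).
have -> : F (dom j) (U n (j - 1)) = q n (j - 1) by rewrite /flux_val (dom_pred nj).
have := Fi_inv_lip (q n j) (q n.+1 j) (inverse_fun (F (dom j)) (F i w)) (dom_leN j).
rewrite (distrC (F i w)) (distrC (F i w) (q n (j - 1))) (distrC (q n j) (q n.+1 j)).
rewrite (distrC (inverse_fun _ (F i w))).
rewrite (distrC (inverse_fun _ (F i w)) (inverse_fun _ (q n.+1 j))).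
by lra.
Qed.

End Scheme.

(** * Integrals over lines and strips *)
Section RintegralExtra.
Context d (X : measurableType d) (R : realType) (m : {measure set X -> \bar R}).

Lemma ae_imply (P Q : X -> Prop) : (forall x, P x -> Q x) ->
  {ae m, forall x, P x} -> {ae m, forall x, Q x}.
Proof. by move=> PQ; apply: filterS. Qed.

Lemma Rintegrable_sum (D : set X) (mD : measurable D) (I : Type) (s : seq I)
    (Q : pred I) (f : I -> X -> R) :
  (forall i, Q i -> m.-integrable D (EFin \o f i)) ->
  m.-integrable D (EFin \o (fun x => \sum_(i <- s | Q i) f i x)).
Proof.
move=> h; have := integrable_sum mD s (P := Q) (h := fun i => EFin \o f i) h.
by apply: eq_integrable => // x _; rewrite /= sumEFin.
Qed.

Lemma Rintegral_sum (D : set X) (mD : measurable D) (I : Type) (s : seq I)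
    (f : I -> X -> R) :
  (forall i, m.-integrable D (EFin \o f i)) ->
  \int[m]_(x in D) (\sum_(i <- s) f i x) = \sum_(i <- s) \int[m]_(x in D) f i x.
Proof.
move=> h; elim: s => [|i s IH].
  rewrite big_nil; under eq_Rintegral do rewrite big_nil.
  by rewrite Rintegral_cst// mul0r.
rewrite big_cons -IH -RintegralD//.
  by apply: eq_Rintegral => x _; rewrite big_cons.
exact: Rintegrable_sum.
Qed.

Lemma ae_le_Rintegrable (D : set X) (mD : measurable D) (f g : X -> R) :
  measurable_fun D f -> m.-integrable D (EFin \o g) ->
  {ae m, forall x, D x -> `|f x| <= g x} -> m.-integrable D (EFin \o f).
Proof.
move=> mf ig fg; apply/integrableP; split; first exact/measurable_EFinP.
have /integrableP[mg] := ig; apply: le_lt_trans.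
apply: ae_ge0_le_integral => //.
- exact/measurableT_comp/measurable_EFinP.
- exact: measurableT_comp.
- apply: filterS fg => x fg Dx; rewrite /= lee_fin.
  by rewrite (le_trans (fg Dx))// ler_norm.
Qed.

Lemma ge0_subset_Rintegral (A D : set X) (f : X -> R) :
  measurable A -> measurable D -> A `<=` D -> m.-integrable D (EFin \o f) ->
  (forall x, D x -> 0 <= f x) ->
  \int[m]_(x in A) f x <= \int[m]_(x in D) f x.
Proof.
move=> mA mD AD fi f0; apply: fine_le.
- by apply: integrable_fin_num => //; exact: integrableS fi.
- exact: integrable_fin_num.
- apply: ge0_subset_integral => //; first exact: (measurable_int m fi).
Qed.

Lemma integrable_cst_indic (D A : set X) (c : R) : measurable D ->
  measurable A -> (m A < +oo)%E -> m.-integrable D (EFin \o (fun z => c * \1_A z)).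
Proof.
move=> mD mA Aoo; have := @integrableZl _ _ _ m D mD c (fun z => (\1_A z)%:E).
move=> h; apply: h; apply/integrableP; split.
  by apply/measurable_EFinP; exact: measurable_indic.
rewrite (eq_integral (fun z => (\1_A z)%:E)); last first.
  by move=> z _; rewrite gee0_abs// lee_fin.
rewrite integral_indic//; apply: le_lt_trans Aoo.
by apply: le_measure; rewrite ?inE//; exact: measurableI.
Qed.

End RintegralExtra.

Section Strip.
Context {R : realType}.
Local Notation mu := (@lebesgue_measure R).
Local Notation mm := (mu \x mu)%E.
Variable T : R.
Local Notation S := (`]0, T[%classic : set R).

(** Double integrals are taken against the product measure, where sums and
    comparisons are immediate; the iterated integrals of the entropy functional
    are converted once, in [iterated_strip_integral]. *)
Definition strip_integrable (D : set R) (f : R -> R -> R) : Prop :=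
  mm.-integrable (D `*` S) (fun z : R * R => (f z.1 z.2)%:E).

Definition strip_integral (D : set R) (f : R -> R -> R) : R :=
  \int[mm]_(z in D `*` S) f z.1 z.2.

(** Fubini, up to the times at which the inner integral is infinite: there the
    real-valued integral is [0] by convention, but they form a null set. *)
Lemma iterated_strip_integral (D : set R) (f : R -> R -> R) : measurable D ->
  strip_integrable D f ->
  \int[mu]_(t in S) (\int[mu]_(x in D) f x t) = strip_integral D f.
Proof.
move=> mD fi.
have mDS : measurable (D `*` S) by exact: measurableX.
pose g := (fun z : R * R => (f z.1 z.2)%:E) \_ (D `*` S).
have gi : mm.-integrable setT g.
  have /(_ (fun z => (f z.1 z.2)%:E)) [h _] := @integrable_mkcond _ _ _ mm (D `*` S) ^~ mDS.
  exact: h fi.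
pose G t := (\int[mu]_x g (x, t))%E.
have mg : measurable_fun setT g := measurable_int mm gi.
have Gi : mu.-integrable setT G.
  have mG : measurable_fun setT G := measurable_fubini_G gi.
  apply/integrableP; split => //.
  have := (integrable21ltyP mu mu mg).1 gi; apply: le_lt_trans.
  apply: ge0_le_integral => //.
  - exact: measurableT_comp.
  - have mag : measurable_fun setT (abse \o g) by exact: measurableT_comp.
    exact: (@measurable_fun_fubini_tonelli_G _ _ _ _ R mu (abse \o g) mag
      (fun z => abse_ge0 _)).
  - move=> t _; apply: le_abse_integral => //; exact: measurableT_comp.
have GE t : S t -> (\int[mu]_(x in D) (f x t)%:E)%E = G t.
  move=> St; rewrite integral_mkcond; apply: eq_integral => x _.
  rewrite /g /patch /=; case: ifPn => xD; case: ifPn => //.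
    by rewrite notin_setE => -[]; split => //=; move: xD; rewrite inE.
  by rewrite inE => -[/= Dx _]; move: xD; rewrite notin_setE.
have G0 t : ~ S t -> G t = 0%E.
  move=> nSt; rewrite /G integral0_eq// => x _; rewrite /g /patch ifF//.
  by apply/negbTE; rewrite notin_setE => -[].
have GiS : mu.-integrable S G by apply: integrableS Gi.
rewrite /strip_integral {1}/Rintegral [RHS]/Rintegral; congr fine.
transitivity (\int[mu]_(t in S) G t)%E.
  transitivity (\int[mu]_(t in S) (fine (G t))%:E)%E.
    by apply: eq_integral => t; rewrite inE => St; rewrite /Rintegral GE.
  apply: ae_eq_integral => //.
  - apply/measurable_EFinP; apply: measurableT_comp => //.
    exact: (measurable_int mu GiS).
  - exact: (measurable_int mu GiS).
  - have ae : {ae mu, forall t, S t -> G t \is a fin_num}.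
      by apply: (@integrable_ae _ _ _ mu S _ G GiS) => //; exact: measurable_itv.
    by apply: ae_imply ae => t h St; rewrite /= fineK// h.
rewrite integral_mkcond; transitivity (\int[mm]_z g z)%E; last first.
  by [].
rewrite -(integral21_prod_meas1 gi) integral_mkcond.
apply: eq_integral => t _; rewrite /patch; case: ifPn => //.
by rewrite notin_setE => /G0 e; rewrite -[RHS]/(G t) e.
Qed.

Hypothesis T_gt0 : 0 < T.

Lemma strip_bounded_integrable (D : set R) (w : R -> R -> R) (A B : R -> R)
    (C CA CB K : R) : measurable D ->
  measurable_fun (setT `*` S) (fun z : R * R => w z.1 z.2) ->
  {ae mm, forall z : R * R, 0 < z.2 < T -> `|w z.1 z.2| <= C} ->
  measurable_fun setT A -> (forall x, `|A x| <= CA) ->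
  (forall x, K < `|x| -> A x = 0) ->
  measurable_fun setT B -> (forall t, 0 <= t <= T -> `|B t| <= CB) ->
  strip_integrable D (fun x t => w x t * (A x * B t)).
Proof.
move=> mD mw wC mA AC AK mB BC.
have mDS : measurable (D `*` S) by exact: measurableX.
have mKS : measurable (`[-K, K]%classic `*` S : set (R * R)) by exact: measurableX.
have CB0 : 0 <= CB by apply: le_trans (BC 0 _); rewrite ?normr_ge0 ?lexx ?ltW.
have CA0 : 0 <= CA by apply: le_trans (AC 0).
pose g (z : R * R) : R := (`|C| * CA * CB) * \1_(`[-K, K]%classic `*` S) z.
have gi : mm.-integrable (D `*` S) (EFin \o g).
  apply: integrable_cst_indic => //.
  pose IK : set R := `[-K, K]%classic.
  have K1 : (mu IK < +oo)%E.
    by rewrite /IK lebesgue_measure_itv /=; case: ifP => _; rewrite ?EFinB ltry.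
  have K2 : (mu S < +oo)%E.
    by rewrite lebesgue_measure_itv /=; case: ifP => _; rewrite ?EFinB ltry.
  have K12 : (mm (IK `*` S) < +oo)%E.
    have e : mm (IK `*` S) = (mu IK * mu S)%E.
      by apply: product_measure1E; exact: measurable_itv.
    by rewrite e lte_mul_pinfty// ge0_fin_numE.
  exact: K12.
apply: (@ae_le_Rintegrable _ _ _ mm (D `*` S) mDS
  (fun z => w z.1 z.2 * (A z.1 * B z.2)) g _ gi).
  apply: measurable_funM.
    by apply: measurable_funS mw => //; [exact: measurableX|move=> z [_ ?]].
  apply: measurable_funTS; apply: measurable_funM.
    exact: (measurableT_comp mA).
  exact: (measurableT_comp mB).
apply: ae_imply wC => -[x t] /= h [_ /= St].
have t0T : 0 < t < T by move: St; rewrite in_itv.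
have t0T' : 0 <= t <= T by case/andP: t0T => /ltW -> /ltW ->.
have [xK|Kx] := leP `|x| K; last first.
  by rewrite AK// mul0r mulr0 normr0 /g mulr_ge0 ?mulr_ge0.
rewrite /g indicE mem_set; last first.
  by split => //=; rewrite in_itv /= -ler_norml.
rewrite mulr1 !normrM -mulrA ler_pM ?mulr_ge0//.
  by rewrite (le_trans (h t0T))// ler_norm.
by rewrite ler_pM ?BC.
Qed.

Lemma strip_integral_tensor (A B : R -> R) :
  strip_integrable setT (fun x t => A x * B t) ->
  mu.-integrable setT (EFin \o A) -> mu.-integrable S (EFin \o B) ->
  strip_integral setT (fun x t => A x * B t)
  = (\int[mu]_x A x) * (\int[mu]_(t in S) B t).
Proof.
move=> h iA iB; rewrite -iterated_strip_integral//.
under eq_Rintegral do rewrite RintegralZr//.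
by rewrite RintegralZl.
Qed.

End Strip.

(** * Smoothed mesh cells *)
Section MeshKernel.
Context {R : realType}.
Variables (H b : R -> R) (c1 c2 eps : R).
Hypotheses (prof : step_profile H b c1 c2) (eps_gt0 : 0 < eps).

(** The indicator of the cell between [y k] and [y k.+1], smoothed towards the
    left over a length [eps]; hence the support reaches down to [y k - eps].
    Since the smoothing is one-sided, the hats see the values of the scheme at
    and to the right of a point, and at and after a time. *)
Definition hat (y : nat -> R) (k : nat) (s : R) : R :=
  H ((y k.+1 - s) / eps) - H ((y k - s) / eps).

Definition ker (y : nat -> R) (k : nat) (s : R) : R := b ((y k - s) / eps) / eps.

Lemma step_ndecr (x y : R) : x <= y -> H x <= H y.
Proof.
move=> xy; have cH : {within `[x, y], continuous H}.
  exact/continuous_subspaceT/is_derive_continuous/(sp_deriv prof).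
have [c _ e] := @MVT_segment R H b x y xy (fun x _ => sp_deriv prof x) cH.
by rewrite -subr_ge0 e mulr_ge0 ?subr_ge0// (sp_b_ge0 prof).
Qed.

Lemma step_ge0 (x : R) : 0 <= H x.
Proof.
have [/(sp_le0 prof)->//|/ltW/step_ndecr] := leP x 0.
by rewrite (sp_le0 prof).
Qed.

Lemma step_le1 (x : R) : H x <= 1.
Proof.
have [/(sp_ge1 prof)->//|/ltW/step_ndecr] := leP 1 x.
by rewrite (sp_ge1 prof (lexx 1)).
Qed.

(** Mean value form of the remainder; [z] is an endpoint because [hat] is compared
    below with the kernel at either end of a cell. *)
Lemma step_taylor (x y z : R) : x <= y -> z = x \/ z = y ->
  `|H y - H x - b z * (y - x)| <= c2 * (y - x) ^+ 2.
Proof.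
move=> xy hz; have cH : {within `[x, y], continuous H}.
  exact/continuous_subspaceT/is_derive_continuous/(sp_deriv prof).
have [c] := @MVT_segment R H b x y xy (fun x _ => sp_deriv prof x) cH.
rewrite in_itv /= => /andP[xc cy] ->.
have yx0 : 0 <= y - x by rewrite subr_ge0.
rewrite -mulrBl normrM (ger0_norm yx0) expr2 mulrA ler_wpM2r//.
apply: le_trans (sp_b_lip prof _ _) _; rewrite ler_wpM2l ?(ltW (sp_c2 prof))//.
by case: hz => ->; rewrite ler_norml; apply/andP; split; lra.
Qed.

Lemma step_lip (x y : R) : x <= y -> H y - H x <= c1 * (y - x).
Proof.
move=> xy; have cH : {within `[x, y], continuous H}.
  exact/continuous_subspaceT/is_derive_continuous/(sp_deriv prof).
have [c _ ->] := @MVT_segment R H b x y xy (fun x _ => sp_deriv prof x) cH.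
by rewrite ler_wpM2r ?subr_ge0// (sp_b_le prof).
Qed.

Section Mesh.
Variables (y : nat -> R) (h : R).
Hypotheses (h_gt0 : 0 < h) (yS : forall k, y k.+1 = y k + h).

Let y_le k s : (y k - s) / eps <= (y k.+1 - s) / eps.
Proof. by rewrite ler_pM2r ?invr_gt0// yS lerD2r lerDl ltW. Qed.

Let y_diff k s : (y k.+1 - s) / eps - (y k - s) / eps = h / eps.
Proof. by rewrite yS -mulrBl; congr (_ / _); ring. Qed.

Lemma mesh_add k l : y (k + l)%N = y k + l%:R * h.
Proof.
elim: l => [|l IH]; first by rewrite addn0 mul0r addr0.
by rewrite addnS yS IH -[in RHS]addn1 natrD mulrDl mul1r addrA.
Qed.

Lemma hat_ge0 k s : 0 <= hat y k s.
Proof. by rewrite subr_ge0 step_ndecr. Qed.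

Lemma ker_ge0 k s : 0 <= ker y k s.
Proof. by rewrite divr_ge0 ?(sp_b_ge0 prof)// ltW. Qed.

Lemma ker_le k s : ker y k s <= c1 / eps.
Proof. by rewrite ler_pM2r ?invr_gt0// (sp_b_le prof). Qed.

Lemma hat_le k s : hat y k s <= c1 * (h / eps).
Proof. by rewrite -(y_diff k s); exact: step_lip. Qed.

Lemma hat_sum k0 m s :
  \sum_(k < m) hat y (k0 + k)%N s
  = H ((y (k0 + m)%N - s) / eps) - H ((y k0 - s) / eps).
Proof.
elim: m => [|m IH]; first by rewrite big_ord0 addn0 subrr.
by rewrite big_ord_recr /= IH /hat addnS; ring.
Qed.

Lemma hat_sum_le1 k0 m s : \sum_(k < m) hat y (k0 + k)%N s <= 1.
Proof.
rewrite hat_sum; have := step_ge0 ((y k0 - s) / eps).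
by have := step_le1 ((y (k0 + m)%N - s) / eps); lra.
Qed.

Lemma hat_sum_eq1 k0 m s : y k0 <= s -> s + eps <= y (k0 + m)%N ->
  \sum_(k < m) hat y (k0 + k)%N s = 1.
Proof.
move=> h1 h2; rewrite hat_sum.
have e1 : 1 <= (y (k0 + m)%N - s) / eps by rewrite ler_pdivlMr// mul1r; lra.
have e0 : (y k0 - s) / eps <= 0 by rewrite pmulr_lle0 ?invr_gt0// subr_le0.
by rewrite (sp_ge1 prof e1) (sp_le0 prof e0) subr0.
Qed.

Lemma hat_eq0 k s : s <= y k - eps \/ y k.+1 <= s -> hat y k s = 0.
Proof.
rewrite /hat => -[sy|sy].
  have e1 : 1 <= (y k - s) / eps by rewrite ler_pdivlMr// mul1r; lra.
  by rewrite (sp_ge1 prof e1) (sp_ge1 prof (le_trans e1 (y_le k s))) subrr.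
have h1 : (y k.+1 - s) / eps <= 0 by rewrite pmulr_lle0 ?invr_gt0// subr_le0.
by rewrite !(sp_le0 prof) ?subrr// (le_trans (y_le _ _)).
Qed.

Lemma hat_supp k s : hat y k s != 0 -> y k - eps < s < y k.+1.
Proof.
apply: contraNT; rewrite negb_and -!leNgt => /orP h'.
by apply/eqP/hat_eq0.
Qed.

Lemma ker_eq0 k s : s <= y k - eps \/ y k <= s -> ker y k s = 0.
Proof.
move=> hs; rewrite /ker (sp_b_out prof) ?mul0r//; case: hs => hs; [right|left].
  by rewrite ler_pdivlMr// mul1r; lra.
by rewrite pmulr_lle0 ?invr_gt0// subr_le0.
Qed.

(** A hat is a difference quotient of the step and the kernel its derivative. *)
Lemma hat_ker k l s : l = k \/ l = k.+1 ->
  `|hat y k s - h * ker y l s| <= c2 * (h / eps) ^+ 2.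
Proof.
move=> hl; rewrite -(y_diff k s).
have -> : h * ker y l s = b ((y l - s) / eps) * ((y k.+1 - s) / eps - (y k - s) / eps).
  by rewrite y_diff /ker; ring.
by apply: step_taylor => //; case: hl => ->; [left|right].
Qed.

Lemma is_derive_hat k (s : R) :
  is_derive s 1 (hat y k) (ker y k s - ker y k.+1 s).
Proof.
have aff z : is_derive s 1 (fun s => H ((z - s) / eps)) (- (b ((z - s) / eps) / eps)).
  have e r : - eps^-1 * r + z / eps = (z - r) / eps by ring.
  have := is_derive_affine (- eps^-1) (z / eps) (sp_deriv prof) s.
  rewrite (_ : (fun _ => _) = (fun s => H ((z - s) / eps))); last first.
    by apply/funext => r; rewrite e.
  by rewrite e => drv; apply: (is_derive_eq drv); ring.
have := @is_deriveB _ _ _ _ _ _ _ _ _ (aff (y k.+1)) (aff (y k)).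
by move=> drv; apply: (is_derive_eq drv); rewrite /ker; ring.
Qed.

Lemma smooth_hat k : smooth (hat y k).
Proof.
move=> n; have aff z : smooth_upto n (fun s => H ((z - s) / eps)).
  rewrite (_ : (fun _ => _) = (fun s => H (- eps^-1 * s + z / eps))).
    exact/smooth_upto_affine/(sp_smooth prof).
  by apply/funext => r; congr H; ring.
rewrite (_ : hat y k = (fun s => H ((y k.+1 - s) / eps) + -1 * H ((y k - s) / eps))).
  apply: smooth_uptoD => //; apply: smooth_uptoM => //; exact: smooth_upto_cst.
by apply/funext => s; rewrite /hat mulN1r.
Qed.

Lemma continuous_hat k : continuous (hat y k).
Proof. exact: (smooth_hat k 0). Qed.

Lemma continuous_ker k : continuous (ker y k).
Proof.
have cb : continuous b.
  move=> x; apply/(@cvgrPdist_le _ _ _ (nbhs x)) => e e0; near=> z.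
  apply: le_trans (sp_b_lip prof _ _) _.
  have c20 := sp_c2 prof.
  rewrite -ler_pdivlMl//; near: z; apply: cvgr_dist_le => //.
  by rewrite mulr_gt0 ?invr_gt0 ?(sp_c2 prof).
move=> s; rewrite /ker; apply: cvgM; last exact: cvg_cst.
apply: (@continuous_comp _ _ _ (fun s => (y k - s) / eps) b); last exact: cb.
apply: cvgM; last exact: cvg_cst.
by apply: cvgB; [exact: cvg_cst|exact: cvg_id].
Unshelve. all: by end_near. Qed.

End Mesh.

Lemma test_function_hat (X tn : nat -> R) (dx dt T : R) k n : 0 < dx -> 0 < dt ->
  (forall k, X k.+1 = X k + dx) -> (forall n, tn n.+1 = tn n + dt) ->
  test_function T (fun x t => hat X k x * hat tn n t).
Proof.
move=> dx0 dt0 XS tS; split.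
- by move=> m; apply: of_class_C_tensor; exact: smooth_hat.
- by move=> x t _; apply: mulr_ge0; [exact: (hat_ge0 dx0 XS)|exact: (hat_ge0 dt0 tS)].
exists (`|X k - eps| + `|X k.+1|) => x t _ hx.
rewrite (hat_eq0 dx0 XS) ?mul0r//.
have [x0|x0] := leP 0 x.
  right; move: hx; rewrite (ger0_norm x0) => hx.
  by have := ler_norm (X k.+1); have := normr_ge0 (X k - eps); lra.
left; move: hx; rewrite (ltr0_norm x0) => hx.
by have := ler_norm (- (X k - eps)); rewrite normrN; have := normr_ge0 (X k.+1); lra.
Qed.

End MeshKernel.

(** * Summation by parts *)
Section SummationByParts.
Context {R : realType}.

Lemma Abel_time (g w : nat -> R) K :
  \sum_(n < K) g n * (w n - w n.+1)
  = \sum_(n < K) (g n.+1 - g n) * w n.+1 + g 0%N * w 0%N - g K * w K.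
Proof.
elim: K => [|K IH]; first by rewrite !big_ord0; ring.
by rewrite !big_ord_recr /= IH; ring.
Qed.

Lemma Abel_space (q w : nat -> R) m :
  \sum_(k < m) q k.+1 * (w k.+1 - w k.+2)
  = \sum_(k < m) (q k.+1 - q k) * w k.+1 + q 0%N * w 1%N - q m * w m.+1.
Proof.
elim: m => [|m IH]; first by rewrite !big_ord0; ring.
by rewrite !big_ord_recr /= IH; ring.
Qed.

(** Here [A] and [s] stand for the hats and kernels in space, [B] and [be] for
    those in time, [G] for the entropy and [Q] for the entropy flux of the
    scheme relative to a fixed value.  The boundary terms at the last time level
    and at the right end are nonpositive and are dropped; at time [0] the kernel
    vanishes; the left end remains.  The entropy inequality carries the weight
    [A * be], so the flux differences have to be moved from the weight [s * B]
    to [lambda * A * be], at the price of the mismatch. *)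
Lemma discrete_entropy_by_parts (G Q : nat -> nat -> R) (A s B be : nat -> R)
    (D : nat -> nat -> R) (lambda : R) m K :
  (forall k n, 0 <= G k n) -> (forall k n, 0 <= Q k n) ->
  (forall k, 0 <= A k) -> (forall k, 0 <= s k) -> (forall n, 0 <= B n) ->
  (forall n, 0 <= be n) -> be 0%N = 0 ->
  (forall k n, (k < m)%N ->
     G k.+1 n.+1 - G k.+1 n + lambda * (Q k.+1 n - Q k n) <= D k n) ->
  \sum_(k < m) \sum_(n < K)
    (G k.+1 n * (A k.+1 * (be n - be n.+1)) + Q k.+1 n * ((s k.+1 - s k.+2) * B n))
  <= \sum_(k < m) \sum_(n < K)
       (D k n * (A k.+1 * be n.+1)
        + `|Q k.+1 n - Q k n| * `|s k.+1 * B n - lambda * (A k.+1 * be n.+1)|)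
     + \sum_(n < K) Q 0%N n * (s 1%N * B n).
Proof.
move=> G0 Q0 A0 s0 B0 be0 be00 HD.
have h1 : \sum_(k < m) \sum_(n < K) G k.+1 n * (A k.+1 * (be n - be n.+1))
    <= \sum_(k < m) \sum_(n < K) (G k.+1 n.+1 - G k.+1 n) * (A k.+1 * be n.+1).
  apply: ler_sum => k _.
  have /= := Abel_time (G k.+1) (fun n => A k.+1 * be n) K.
  under eq_bigr do rewrite -mulrBr; move=> ->.
  rewrite be00 !mulr0 addr0 lerBlDr lerDl.
  by rewrite !mulr_ge0.
have h2 : \sum_(k < m) \sum_(n < K) Q k.+1 n * ((s k.+1 - s k.+2) * B n)
    <= \sum_(k < m) \sum_(n < K) (Q k.+1 n - Q k n) * (s k.+1 * B n)
       + \sum_(n < K) Q 0%N n * (s 1%N * B n).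
  rewrite exchange_big [X in _ <= X + _]exchange_big -big_split /=.
  apply: ler_sum => n _.
  have /= := Abel_space (Q ^~ n) (fun k => s k * B n) m.
  under eq_bigr do rewrite -mulrBl; move=> ->.
  by rewrite lerBlDr lerDl !mulr_ge0.
rewrite (_ : \sum_(k < m) _ = \sum_(k < m) \sum_(n < K) G k.+1 n * (A k.+1 * (be n - be n.+1))
  + \sum_(k < m) \sum_(n < K) Q k.+1 n * ((s k.+1 - s k.+2) * B n)); last first.
  by rewrite -big_split; apply: eq_bigr => k _; rewrite -big_split.
apply: le_trans (lerD h1 h2) _; rewrite addrA lerD2r -big_split /=.
apply: ler_sum => k _; rewrite -big_split /=; apply: ler_sum => n _.
have hD := HD k n (ltn_ord k).
have hA : 0 <= A k.+1 * be n.+1 by rewrite mulr_ge0.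
have hD' := ler_wpM2r hA hD.
set W := s k.+1 * B n; set V := A k.+1 * be n.+1 in hA hD' *.
have : (Q k.+1 n - Q k n) * (W - lambda * V) <= `|Q k.+1 n - Q k n| * `|W - lambda * V|.
  by rewrite -normrM ler_norm.
by move: hD'; lra.
Qed.

End SummationByParts.

Opaque hat ker.

(** * Pointwise bounds for the doubled integrands *)
Section Pointwise.
Context {R : realType}.

Definition ind (a b x : R) : R := (a <= x <= b)%R%:R.

Lemma ind_ge0 a b x : 0 <= ind a b x. Proof. by rewrite ler0n. Qed.

Lemma ind_le1 a b x : ind a b x <= 1. Proof. by rewrite lern1 leq_b1. Qed.

Lemma ind1 a b x : a <= x <= b -> ind a b x = 1. Proof. by rewrite /ind => ->. Qed.

Lemma le_ind (a b x y c : R) : 0 <= c -> y <= c -> (y != 0 -> a <= x <= b) ->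
  y <= c * ind a b x.
Proof.
move=> c0 yc h; have [->|/h ab] := eqVneq y 0; first by rewrite mulr_ge0 ?ind_ge0.
by rewrite ind1// mulr1.
Qed.

Variables (H b : R -> R) (c1 c2 eps : R).
Hypotheses (prof : step_profile H b c1 c2) (eps_gt0 : 0 < eps).
Variables (X tn : nat -> R) (dx dt lambda : R).
Hypotheses (dx_gt0 : 0 < dx) (dt_gt0 : 0 < dt) (lambda_def : dt = lambda * dx).
Hypotheses (XS : forall k, X k.+1 = X k + dx) (tS : forall n, tn n.+1 = tn n + dt).
Hypotheses (lambda_gt0 : 0 < lambda) (tn0 : tn 0%N = 0).
Local Notation hat := (hat H eps).
Local Notation ker := (ker b eps).

Let c1_gt0 := sp_c1 prof.
Let c2_gt0 := sp_c2 prof.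

Lemma ker_ind y h k s : 0 < h -> (forall k, y k.+1 = y k + h) ->
  ker y k s <= c1 / eps * ind (y k - eps) (y k) s.
Proof.
move=> h0 yS; apply: le_ind; first by rewrite divr_ge0 ?ltW.
  exact: (ker_le prof eps_gt0).
move=> s0; have [h1|h1] := leP s (y k - eps).
  by move: s0; rewrite (ker_eq0 prof eps_gt0) ?eqxx//; left.
have [h2|h2] := leP (y k) s.
  by move: s0; rewrite (ker_eq0 prof eps_gt0) ?eqxx//; right.
by rewrite !ltW.
Qed.

Lemma hat_ind y h k s : 0 < h -> (forall k, y k.+1 = y k + h) ->
  hat y k s <= c1 * (h / eps) * ind (y k - eps) (y k.+1) s.
Proof.
move=> h0 yS; apply: le_ind.
- by rewrite mulr_ge0 ?divr_ge0 ?ltW.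
- exact: (hat_le prof eps_gt0 h0 yS).
- by move=> /(hat_supp prof eps_gt0 h0 yS) /andP[/ltW -> /ltW ->].
Qed.

Definition cross_const : R := c1 * c2 * (dt ^+ 2 + lambda * dx ^+ 2) / eps ^+ 3.

Lemma cross_const_ge0 : 0 <= cross_const.
Proof.
rewrite /cross_const divr_ge0 ?exprn_ge0 ?(ltW eps_gt0)//.
by rewrite mulr_ge0 ?addr_ge0 ?mulr_ge0 ?sqr_ge0 ?ltW.
Qed.

(** Both products equal [dt] times a product of two kernels up to second order,
    because [dt = lambda * dx]; the remainders are those of [hat_ker]. *)
Lemma kernel_mismatch k n x t :
  `|ker X k x * hat tn n t - lambda * (hat X k x * ker tn n.+1 t)|
  <= cross_const * (ind (X k - eps) (X k.+1) x * ind (tn n - eps) (tn n.+1) t).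
Proof.
have [h0|] := eqVneq (ker X k x * hat tn n t - lambda * (hat X k x * ker tn n.+1 t)) 0.
  by rewrite h0 normr0 mulr_ge0 ?cross_const_ge0// mulr_ge0 ?ind_ge0.
have [xin|/negP xout] := boolP (X k - eps <= x <= X k.+1); last first.
  have hx : x <= X k - eps \/ X k.+1 <= x.
    have [|h1] := leP x (X k - eps); first by left.
    by right; rewrite leNgt; apply/negP => h2; apply: xout; rewrite !ltW.
  rewrite (hat_eq0 prof eps_gt0 dx_gt0 XS hx) mul0r mulr0 subr0.
  rewrite (ker_eq0 prof eps_gt0) ?mul0r ?eqxx//.
  case: hx => hx; [by left|right]; apply: le_trans hx; rewrite XS lerDl ltW //.
have [tin|/negP tout] := boolP (tn n - eps <= t <= tn n.+1); last first.
  have ht : t <= tn n - eps \/ tn n.+1 <= t.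
    have [|h1] := leP t (tn n - eps); first by left.
    by right; rewrite leNgt; apply/negP => h2; apply: tout; rewrite !ltW.
  rewrite (hat_eq0 prof eps_gt0 dt_gt0 tS ht) mulr0 sub0r.
  rewrite (ker_eq0 prof eps_gt0) ?mulr0 ?oppr0 ?eqxx//.
  case: ht => ht; [left|by right]; apply: le_trans ht _; rewrite tS lerD2r lerDl ltW//.
move=> _; rewrite !ind1// !mulr1.
have -> : ker X k x * hat tn n t - lambda * (hat X k x * ker tn n.+1 t)
  = ker X k x * (hat tn n t - dt * ker tn n.+1 t)
    - lambda * ker tn n.+1 t * (hat X k x - dx * ker X k x).
  by rewrite lambda_def; ring.
apply: le_trans (ler_normB _ _) _.
have k1 := ker_le prof eps_gt0 X k x; have k2 := ker_le prof eps_gt0 tn n.+1 t.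
have p1 := ker_ge0 prof eps_gt0 X k x; have p2 := ker_ge0 prof eps_gt0 tn n.+1 t.
have t1 := hat_ker prof eps_gt0 dt_gt0 tS t (or_intror (erefl n.+1)).
have t2 := hat_ker prof eps_gt0 dx_gt0 XS x (or_introl (erefl k)).
rewrite normrM (normrM (lambda * ker tn n.+1 t)) (normrM lambda).
rewrite (ger0_norm p1) (ger0_norm p2) (gtr0_norm lambda_gt0).
have -> : cross_const = c1 / eps * (c2 * (dt / eps) ^+ 2)
    + lambda * (c1 / eps) * (c2 * (dx / eps) ^+ 2).
  by rewrite /cross_const; field; rewrite gt_eqF.
apply: lerD; apply: ler_pM => //; first by rewrite mulr_ge0 // ltW.
by rewrite ler_wpM2l// ltW.
Qed.

Variables (N : nat) (F : nat -> R -> R) (alpha : R) (xi : nat -> R).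
Hypothesis alpha_gt0 : 0 < alpha.
Hypothesis F_reg : forall i, (i <= N)%N -> regular_increasing alpha (F i).
Variables (m K : nat) (p : nat -> nat -> R) (ifc : nat -> bool) (domk : nat -> nat).
Local Notation g i := (inverse_fun (F i)).

Definition cell_defect (k n : nat) : R :=
  2 / alpha * `|p k.+1 n.+1 - p k.+1 n|
  + lambda * (ifc k)%:R * `|p k.+1 n - p k n|.

(** Only its being at least [1] near the interfaces and having integral
    [N (eps + dx)] matters, so overlaps are counted with multiplicity. *)
Definition near_interface (x : R) : R :=
  \sum_(l < N) ind (xi l.+1 - eps) (xi l.+1 + dx) x.

Lemma near_interface_ge0 x : 0 <= near_interface x.
Proof. by apply: sumr_ge0 => l _; exact: ind_ge0. Qed.

Lemma cell_defect_ge0 k n : 0 <= cell_defect k n.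
Proof.
have a0 := ltW alpha_gt0; have l0 := ltW lambda_gt0.
by rewrite /cell_defect addr_ge0 ?mulr_ge0 ?ler0n ?invr_ge0.
Qed.

Hypothesis entropy : forall i w k n, (i <= N)%N -> (k < m)%N ->
  `|w - g i (p k.+1 n.+1)| - `|w - g i (p k.+1 n)|
  + lambda * (`|F i w - p k.+1 n| - `|F i w - p k n|)
  <= (ifc k || (domk k != i))%:R * cell_defect k n.
Variable D : nat -> set R.
Hypothesis near : forall i k x, (i <= N)%N -> (k < m)%N -> D i x ->
  ifc k || (domk k != i) -> X k.+1 - eps < x < X k.+2 ->
  exists2 l, (l < N)%N & xi l.+1 - eps <= x <= xi l.+1 + dx.

Lemma near_interface_ge1 i k x : (i <= N)%N -> (k < m)%N -> D i x ->
  ifc k || (domk k != i) -> X k.+1 - eps < x < X k.+2 -> 1 <= near_interface x.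
Proof.
move=> iN km Dx bad hx; have [l lN xl] := near iN km Dx bad hx.
rewrite /near_interface (bigD1 (Ordinal lN))//= ind1// lerDl.
by apply: sumr_ge0 => l' _; exact: ind_ge0.
Qed.

Definition err_interface (x t : R) : R :=
  \sum_(k < m) \sum_(n < K) cell_defect k n * (c1 / eps) *
    ((near_interface x * hat X k.+1 x) * ind (tn n.+1 - eps) (tn n.+1) t).

Definition err_mismatch (x t : R) : R :=
  \sum_(k < m) \sum_(n < K) `|p k.+1 n - p k n| * cross_const *
    (ind (X k.+1 - eps) (X k.+2) x * ind (tn n - eps) (tn n.+1) t).

(** The interior part of the summed entropy inequalities at a point [x] of the
    subdomain [i] where [u] takes the value [w]. *)
Definition interior_term i (w x t : R) : R :=
  \sum_(k < m) \sum_(n < K)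
    (`|w - g i (p k.+1 n)| * (hat X k.+1 x * (ker tn n t - ker tn n.+1 t))
     + `|F i w - p k.+1 n| * ((ker X k.+1 x - ker X k.+2 x) * hat tn n t)).

(** The hypothesis [0 <= t] makes the kernel of the initial time vanish at [t],
    so that no boundary term arises there. *)
Lemma interior_term_le i w x t : (i <= N)%N -> D i x -> 0 <= t ->
  interior_term i w x t <= err_interface x t + err_mismatch x t
    + \sum_(n < K) `|F i w - p 0%N n| * (ker X 1%N x * hat tn n t).
Proof.
move=> iN Dx t0.
have := @discrete_entropy_by_parts R (fun k n => `|w - g i (p k n)|)
  (fun k n => `|F i w - p k n|) (fun k => hat X k x) (fun k => ker X k x)
  (fun n => hat tn n t) (fun n => ker tn n t)
  (fun k n => (ifc k || (domk k != i))%:R * cell_defect k n) lambda m K.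
move=> h; apply: le_trans (h _ _ _ _ _ _ _ _) _ => {h} //.
- by move=> k; exact: (hat_ge0 prof eps_gt0 dx_gt0 XS).
- by move=> k; exact: (ker_ge0 prof eps_gt0).
- by move=> k; exact: (hat_ge0 prof eps_gt0 dt_gt0 tS).
- by move=> k; exact: (ker_ge0 prof eps_gt0).
- by apply: (ker_eq0 prof eps_gt0); right; rewrite tn0.
- by move=> k n km; exact: entropy.
rewrite lerD2r -big_split /=; apply: ler_sum => k _.
rewrite -big_split /=; apply: ler_sum => n _; apply: lerD; last first.
  rewrite -[X in _ <= X]mulrA; apply: ler_pM => //.
    apply: le_trans (ler_dist_dist _ _) _.
    rewrite le_eqVlt; apply/orP; left; apply/eqP.
    by rewrite -normrN; congr `|_|; ring.
  exact: kernel_mismatch.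
have hh := hat_ge0 prof eps_gt0 dx_gt0 XS k.+1 x.
have hk := ker_ge0 prof eps_gt0 tn n.+1 t.
have hki := ker_ind n.+1 t dt_gt0 tS.
have cd := cell_defect_ge0 k n.
rewrite -[X in _ <= X]mulrA.
have -> : (ifc k || (domk k != i))%:R * cell_defect k n *
  (hat X k.+1 x * ker tn n.+1 t)
  = cell_defect k n * (((ifc k || (domk k != i))%:R * hat X k.+1 x) * ker tn n.+1 t).
  by ring.
rewrite ler_wpM2l//.
have -> : c1 / eps * (near_interface x * hat X k.+1 x * ind (tn n.+1 - eps) (tn n.+1) t)
  = (near_interface x * hat X k.+1 x) * (c1 / eps * ind (tn n.+1 - eps) (tn n.+1) t).
  by ring.
apply: ler_pM => //; first by rewrite mulr_ge0 ?ler0n.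
have [h0|] := eqVneq (hat X k.+1 x) 0; first by rewrite h0 !mulr0.
move=> /(hat_supp prof eps_gt0 dx_gt0 XS) hx; rewrite ler_wpM2r//.
have [bad|_] := boolP (ifc k || (domk k != i)).
  exact: near_interface_ge1 bad hx.
exact: near_interface_ge0.
Qed.

Variables (n0 K1 : nat).
Hypothesis K1_eps : eps <= K1%:R * dt.

(** At the time level [n0] the hats in time are supported on the levels
    [n0, ..., n0 + K1 - 1], and at [x] the hats in space on the cells that meet
    [x, x + eps]: these are the variations of the flux value seen there. *)
Definition time_osc (k : nat) : R := \sum_(l < K1) `|p k.+1 (n0 + l).+1 - p k.+1 (n0 + l)%N|.

Definition space_osc (x : R) : R :=
  \sum_(l < m) `|p l.+1 n0 - p l n0| * ind (X l.+1 - eps) (X l.+1) x.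

Definition level_err (x : R) : R :=
  alpha^-1 * (\sum_(k < m) time_osc k * hat X k.+1 x + space_osc x).

Lemma space_osc_ge0 x : 0 <= space_osc x.
Proof. by apply: sumr_ge0 => l _; rewrite mulr_ge0 ?ind_ge0. Qed.

Lemma time_osc_ge0 k : 0 <= time_osc k.
Proof. exact: sumr_ge0. Qed.

(** Going from the cell [kap] of [x] at level [n0] to a cell and level felt at
    [x]: first in space at level [n0], then in time.  The alternative [kap = 0]
    allows [x] to lie left of the first cell of the window. *)
Lemma level_compare (k n kap : nat) (x : R) : (k < m)%N ->
  hat X k.+1 x != 0 -> hat tn n (tn n0) != 0 ->
  (kap == 0)%N || (X kap.+1 <= x) -> x < X kap.+2 ->
  `|p k.+1 n - p kap.+1 n0| <= time_osc k + space_osc x.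
Proof.
move=> km /(hat_supp prof eps_gt0 dx_gt0 XS) /andP[xk1 xk2].
move=> /(hat_supp prof eps_gt0 dt_gt0 tS) /andP[tk1 tk2] hkap xkap.
have XD := mesh_add XS; have tD := mesh_add tS.
have tlt a c : (tn a < tn c) = (a < c)%N.
  by rewrite -[a]add0n -[c]add0n !tD ltrD2l ltr_pM2r// ltr_nat.
have tle a c : (tn a <= tn c) = (a <= c)%N.
  by rewrite -[a]add0n -[c]add0n !tD lerD2l ler_pM2r// ler_nat.
have Xlt a c : (X a < X c) = (a < c)%N.
  by rewrite -[a]add0n -[c]add0n !XD ltrD2l ltr_pM2r// ltr_nat.
have Xle a c : (X a <= X c) = (a <= c)%N.
  by rewrite -[a]add0n -[c]add0n !XD lerD2l ler_pM2r// ler_nat.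
have n0n : (n0 <= n)%N by rewrite -ltnS -tlt.
have nK1 : (n < n0 + K1)%N.
  rewrite -tlt tD; apply: lt_le_trans (_ : tn n0 + eps <= _); first by lra.
  by rewrite lerD2l.
have -> : p k.+1 n - p kap.+1 n0
    = (p k.+1 n - p k.+1 n0) + (p k.+1 n0 - p kap.+1 n0) by ring.
apply: le_trans (ler_normD _ _) _; apply: lerD.
  have -> : p k.+1 n - p k.+1 n0
      = \sum_(l < (n - n0)%N) (p k.+1 (n0 + l).+1 - p k.+1 (n0 + l)%N).
    rewrite -(big_mkord predT (fun l => p k.+1 (n0 + l).+1 - p k.+1 (n0 + l)%N)).
    under eq_bigr do rewrite -addnS.
    by rewrite (telescope_sumr (fun l => p k.+1 (n0 + l)%N))// addn0 subnKC.
  apply: le_trans (ler_norm_sum _ _ _) _.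
  have le1 : (n - n0 <= K1)%N by rewrite leq_subLR ltnW.
  rewrite /time_osc (big_ord_widen K1 (fun l => `|p k.+1 (n0 + l).+1 - p k.+1 (n0 + l)%N|) le1).
  rewrite [X in _ <= X](bigID (fun i : 'I_K1 => (i < n - n0)%N))/=.
  by rewrite lerDl; apply: sumr_ge0.
have kapk : (kap <= k)%N.
  case/orP: hkap => [/eqP -> //|hkap].
  by rewrite -ltnS -ltnS -Xlt; apply: le_lt_trans xk2.
have -> : p k.+1 n0 - p kap.+1 n0
    = \sum_(kap.+1 <= l < k.+1) (p l.+1 n0 - p l n0).
  by rewrite (telescope_sumr (p ^~ n0)).
apply: le_trans (ler_norm_sum _ _ _) _.
apply: (@le_trans _ _ (\sum_(kap.+1 <= l < k.+1)
    `|p l.+1 n0 - p l n0| * ind (X l.+1 - eps) (X l.+1) x)).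
  rewrite big_nat_cond [X in _ <= X]big_nat_cond; apply: ler_sum => l.
  rewrite andbT ltnS => /andP[kl lk]; rewrite ind1 ?mulr1//.
  apply/andP; split.
    by rewrite (le_trans _ (ltW xk1))// lerD2r Xle ltnS.
  by rewrite (le_trans (ltW xkap))// Xle.
rewrite /space_osc -(big_mkord predT (fun l => `|p l.+1 n0 - p l n0| * ind (X l.+1 - eps) (X l.+1) x)).
rewrite [X in _ <= X](big_cat_nat _ (n := kap.+1))//=; last by rewrite (leq_trans _ km).
rewrite [X in _ <= _ + X](big_cat_nat _ (n := k.+1))//=.
rewrite addrCA lerDl addr_ge0//; apply: sumr_ge0 => l _; rewrite mulr_ge0 ?ind_ge0//.
Qed.

Let weight_sum_le x (v : nat -> R) (s : R) : 0 <= s -> (forall k, 0 <= v k) ->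
  \sum_(k < m) \sum_(n < K) (v k + s) * (hat X k.+1 x * hat tn n (tn n0))
  <= \sum_(k < m) v k * hat X k.+1 x + s.
Proof.
move=> s0 v0.
have B1 : \sum_(n < K) hat tn n (tn n0) <= 1.
  have := hat_sum_le1 eps prof tn 0%N K (tn n0).
  by under eq_bigr do rewrite add0n.
apply: (@le_trans _ _ (\sum_(k < m) (v k + s) * hat X k.+1 x)).
  apply: ler_sum => k _.
  under eq_bigr do rewrite mulrA; rewrite -mulr_sumr ler_piMr//.
  by apply: mulr_ge0; [exact: addr_ge0|exact: (hat_ge0 prof eps_gt0 dx_gt0 XS)].
under eq_bigr do rewrite mulrDl; rewrite big_split /= lerD2l -mulr_sumr ler_piMr//.
exact: (hat_sum_le1 eps prof X 1%N m x).
Qed.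

Let weighted_compare i (w x : R) (kap k n : nat) : (i <= N)%N -> (k < m)%N ->
  (kap == 0)%N || (X kap.+1 <= x) -> x < X kap.+2 ->
  `|(`|w - g i (p k.+1 n)| - `|w - g i (p kap.+1 n0)|)|
      * (hat X k.+1 x * hat tn n (tn n0))
  <= alpha^-1 * ((time_osc k + space_osc x) * (hat X k.+1 x * hat tn n (tn n0))).
Proof.
move=> iN km h1 h2.
have hx := hat_ge0 prof eps_gt0 dx_gt0 XS k.+1 x.
have ht := hat_ge0 prof eps_gt0 dt_gt0 tS n (tn n0).
have [->|nx] := eqVneq (hat X k.+1 x) 0; first by rewrite !mul0r !mulr0.
have [->|nt] := eqVneq (hat tn n (tn n0)) 0; first by rewrite !mulr0.
rewrite [X in _ <= X]mulrA ler_wpM2r ?mulr_ge0//.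
apply: le_trans (ler_dist_dist _ _) _.
have -> : w - g i (p k.+1 n) - (w - g i (p kap.+1 n0))
  = - (g i (p k.+1 n) - g i (p kap.+1 n0)) by ring.
rewrite normrN; apply: le_trans (inverse_fun_lip alpha_gt0 (F_reg iN) _ _) _.
by rewrite ler_wpM2l ?invr_ge0 ?(ltW alpha_gt0)// level_compare.
Qed.

(** The term of the summed entropy inequalities at the time level [n0]; [w] is
    the value of [u] at [x]. *)
Definition level_term i (w x : R) : R :=
  \sum_(k < m) \sum_(n < K) `|w - g i (p k.+1 n)| * (hat X k.+1 x * hat tn n (tn n0)).

Lemma level_term_ge0 i w x : 0 <= level_term i w x.
Proof.
apply: sumr_ge0 => k _; apply: sumr_ge0 => n _; rewrite mulr_ge0// mulr_ge0//.
  exact: (hat_ge0 prof eps_gt0 dx_gt0 XS).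
exact: (hat_ge0 prof eps_gt0 dt_gt0 tS).
Qed.

Lemma level_term_le i w x kap : (i <= N)%N ->
  (kap == 0)%N || (X kap.+1 <= x) -> x < X kap.+2 ->
  level_term i w x <= `|w - g i (p kap.+1 n0)| + level_err x.
Proof.
move=> iN h1 h2.
pose c := `|w - g i (p kap.+1 n0)|.
apply: (@le_trans _ _ (\sum_(k < m) \sum_(n < K)
   (alpha^-1 * ((time_osc k + space_osc x) * (hat X k.+1 x * hat tn n (tn n0)))
    + (0 + c) * (hat X k.+1 x * hat tn n (tn n0))))).
  apply: ler_sum => k _; apply: ler_sum => n _.
  have := weighted_compare w n iN (ltn_ord k) h1 h2; rewrite -/c add0r.
  have hx := hat_ge0 prof eps_gt0 dx_gt0 XS k.+1 x.
  have ht := hat_ge0 prof eps_gt0 dt_gt0 tS n (tn n0).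
  have hh : 0 <= hat X k.+1 x * hat tn n (tn n0) by rewrite mulr_ge0.
  have := ler_wpM2r hh (ler_norm (`|w - g i (p k.+1 n)| - c)).
  by rewrite mulrBl; lra.
under eq_bigr do rewrite big_split /= -mulr_sumr.
rewrite big_split /= -mulr_sumr addrC; apply: lerD.
  have := @weight_sum_le x (fun=> 0) c (normr_ge0 _) (fun=> lexx _).
  by under [X in _ <= X + _]eq_bigr do rewrite mul0r; rewrite big1_eq add0r.
rewrite /level_err ler_wpM2l ?invr_ge0 ?(ltW alpha_gt0)//.
by apply: weight_sum_le; [exact: space_osc_ge0|exact: time_osc_ge0].
Qed.

(** The opposite inequality needs the hats to sum to [1] at [x] and at the level
    [n0], whence the margin [eps] on the right and the [K1] levels after
    [n0]. *)
Lemma level_term_ge i w x kap : (i <= N)%N -> (n0 + K1 <= K)%N ->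
  X 1%N <= x -> x + eps <= X m.+1 ->
  X kap.+1 <= x -> x < X kap.+2 ->
  `|w - g i (p kap.+1 n0)| - level_err x <= level_term i w x.
Proof.
move=> iN n0K x1 xm h1 h2; have h1' : (kap == 0)%N || (X kap.+1 <= x) by rewrite h1 orbT.
pose c := `|w - g i (p kap.+1 n0)|.
have sA : \sum_(k < m) hat X k.+1 x = 1.
  have := hat_sum_eq1 prof eps_gt0 (y := X) (k0 := 1) (m := m) x1.
  by rewrite add1n => ->.
have t0n : tn 0%N <= tn n0 by rewrite -[n0]add0n (mesh_add tS) lerDl mulr_ge0// ltW.
have sB : \sum_(n < K) hat tn n (tn n0) = 1.
  have := hat_sum_eq1 prof eps_gt0 (y := tn) (k0 := 0) (m := K) t0n.
  under eq_bigr do rewrite add0n; apply; rewrite add0n -(subnKC n0K) !(mesh_add tS).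
  rewrite -addrA lerD2l (le_trans K1_eps)// lerDl mulr_ge0// ltW//.
have cE : c = \sum_(k < m) \sum_(n < K) c * (hat X k.+1 x * hat tn n (tn n0)).
  under eq_bigr do rewrite -mulr_sumr -mulr_sumr sB mulr1.
  by rewrite -mulr_sumr sA mulr1.
rewrite -/c cE lerBlDr.
apply: (@le_trans _ _ (\sum_(k < m) \sum_(n < K)
   (`|w - g i (p k.+1 n)| * (hat X k.+1 x * hat tn n (tn n0))
    + alpha^-1 * ((time_osc k + space_osc x) * (hat X k.+1 x * hat tn n (tn n0)))))).
  apply: ler_sum => k _; apply: ler_sum => n _.
  have := weighted_compare w n iN (ltn_ord k) h1' h2; rewrite -/c.
  have hx := hat_ge0 prof eps_gt0 dx_gt0 XS k.+1 x.
  have ht := hat_ge0 prof eps_gt0 dt_gt0 tS n (tn n0).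
  have hh : 0 <= hat X k.+1 x * hat tn n (tn n0) by rewrite mulr_ge0.
  rewrite distrC; have := ler_wpM2r hh (ler_norm (c - `|w - g i (p k.+1 n)|)).
  by rewrite mulrBl; lra.
under eq_bigr do rewrite big_split /= -mulr_sumr.
rewrite big_split /= -mulr_sumr lerD2l /level_err.
rewrite ler_wpM2l ?invr_ge0 ?(ltW alpha_gt0)//.
by apply: weight_sum_le; [exact: space_osc_ge0|exact: time_osc_ge0].
Qed.

Lemma level_term_out i w x : x <= X 1%N - eps \/ X m.+1 <= x -> level_term i w x = 0.
Proof.
move=> hx; rewrite /level_term big1// => k _; rewrite big1// => n _.
rewrite (hat_eq0 prof eps_gt0 dx_gt0 XS) ?mul0r ?mulr0//.
have XD := mesh_add XS.
have X1k : X 1%N <= X k.+1.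
  by rewrite -[k.+1]add1n XD lerDl mulr_ge0// ltW.
have Xkm : X k.+2 <= X m.+1.
  have -> : X m.+1 = X (k.+2 + (m - k.+1))%N by rewrite addSn subnKC.
  by rewrite XD lerDl mulr_ge0// ltW.
case: hx => hx; [left|right]; first by rewrite (le_trans hx)// lerD2r.
exact: le_trans hx.
Qed.

End Pointwise.

(** * Integrals of the error terms *)
Section BoundedSupport.
Context {R : realType}.
Local Notation mu := (@lebesgue_measure R).

(** A class stable under the operations that build the weights, whose members are
    integrable on every measurable set. *)
Definition bounded_supp (f : R -> R) : Prop :=
  measurable_fun setT f /\
  exists C K : R, forall x, `|f x| <= C /\ (K < `|x| -> f x = 0).

Lemma bs_integrable (D : set R) f : measurable D -> bounded_supp f ->
  mu.-integrable D (EFin \o f).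
Proof.
move=> mD [mf [C [K h]]].
pose I : set R := `[-K, K]%classic.
have Ioo : (mu I < +oo)%E.
  by rewrite /I lebesgue_measure_itv /=; case: ifP => _; rewrite ?EFinB ltry.
apply: (@ae_le_Rintegrable _ _ _ mu D mD f (fun x => C * \1_I x)).
- exact: measurable_funTS.
- by apply: integrable_cst_indic => //; exact: measurable_itv.
apply: aeW => x _; have [h1 h2] := h x.
have C0 : 0 <= C by apply: le_trans h1.
have [xK|Kx] := leP `|x| K; last by rewrite h2// normr0 mulr_ge0.
by rewrite indicE mem_set ?mulr1// /I /= in_itv /= -ler_norml.
Qed.

Lemma bs_add f g : bounded_supp f -> bounded_supp g ->
  bounded_supp (fun x => f x + g x).
Proof.
move=> [mf [C [K h]]] [mg [C' [K' h']]]; split; first exact: measurable_funD.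
exists (C + C'), (Num.max K K') => x; have [h1 h2] := h x; have [h3 h4] := h' x.
split; first by rewrite (le_trans (ler_normD _ _))// lerD.
by rewrite gt_max => /andP[/h2 -> /h4 ->]; rewrite addr0.
Qed.

Lemma bs_scale c f : bounded_supp f -> bounded_supp (fun x => c * f x).
Proof.
move=> [mf [C [K h]]]; split; first exact: measurable_funM.
exists (`|c| * C), K => x; have [h1 h2] := h x.
by split; [rewrite normrM ler_wpM2l|move=> /h2 ->; rewrite mulr0].
Qed.

Lemma bs_mul f g : bounded_supp f -> bounded_supp g ->
  bounded_supp (fun x => f x * g x).
Proof.
move=> [mf [C [K h]]] [mg [C' [K' h']]]; split; first exact: measurable_funM.
exists (C * C'), K => x; have [h1 h2] := h x; have [h3 h4] := h' x.
by split; [rewrite normrM ler_pM|move=> /h2 ->; rewrite mul0r].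
Qed.

Lemma bs_sum n (f : nat -> R -> R) : (forall k, bounded_supp (f k)) ->
  bounded_supp (fun x => \sum_(k < n) f k x).
Proof.
move=> bf; elim: n => [|n IH].
  rewrite (_ : (fun _ => _) = fun=> 0); last by apply/funext => x; rewrite big_ord0.
  split; first exact: measurable_cst.
  by exists 0, 0 => x; rewrite normr0.
rewrite (_ : (fun _ => _) = fun x => \sum_(k < n) f k x + f n x).
  exact: bs_add.
by apply/funext => x; rewrite big_ord_recr.
Qed.

Lemma bs_sub f g : bounded_supp f -> bounded_supp g ->
  bounded_supp (fun x => f x - g x).
Proof.
move=> bf bg; have := bs_add bf (bs_scale (-1) bg).
by under [X in bounded_supp X]eq_fun do rewrite mulN1r.
Qed.

Lemma ind_indic (a b x : R) : ind a b x = \1_(`[a, b]%classic) x.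
Proof. by rewrite /ind indicE mem_setE in_itv. Qed.

Lemma bs_ind (a b : R) : bounded_supp (ind a b).
Proof.
split.
  rewrite (_ : ind a b = \1_(`[a, b]%classic)); last first.
    by apply/funext => x; rewrite ind_indic.
  exact: measurable_indic.
exists 1, (`|a| + `|b|) => x; split; first by rewrite ger0_norm ?ind_ge0 ?ind_le1.
move=> hx; rewrite /ind; case: (boolP (a <= x <= b)) => //= /andP[ax xb].
have := ler_norm (- a); rewrite normrN => h1; have := ler_norm b => h2.
have := normr_ge0 a; have := normr_ge0 b => h3 h4.
by have : `|x| <= `|a| + `|b|; [rewrite ler_norml; apply/andP; split; lra|lra].
Qed.

Lemma Rintegral_ind (a b : R) : a <= b -> \int[mu]_x ind a b x = b - a.
Proof.
move=> ab; rewrite /Rintegral.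
under eq_integral do rewrite ind_indic.
rewrite integral_indic//.
rewrite setIT; transitivity (fine (mu (`[a, b]%classic : set R))); first by [].
rewrite lebesgue_measure_itv /= lte_fin; have [//|ba] := ltP a b.
by apply/esym/eqP; rewrite subr_eq0 eq_le ab ba.
Qed.

Lemma Rintegral_ind_le (D : set R) (a b : R) : measurable D -> a <= b ->
  \int[mu]_(x in D) ind a b x <= b - a.
Proof.
move=> mD ab; rewrite -Rintegral_ind//; apply: ge0_subset_Rintegral => //.
exact: (bs_integrable measurableT (bs_ind a b)).
Qed.

End BoundedSupport.

Section KernelIntegrals.
Context {R : realType}.
Local Notation mu := (@lebesgue_measure R).
Variables (H b : R -> R) (c1 c2 eps : R).
Hypotheses (prof : step_profile H b c1 c2) (eps_gt0 : 0 < eps).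
Local Notation hat := (hat H eps).
Local Notation ker := (ker b eps).

Section Mesh.
Variables (y : nat -> R) (h : R).
Hypotheses (h_gt0 : 0 < h) (yS : forall k, y k.+1 = y k + h).

Lemma bs_hat k : bounded_supp (hat y k).
Proof.
split; first by apply: continuous_measurable_fun; exact: (continuous_hat prof).
have h0 s := hat_ge0 prof eps_gt0 h_gt0 yS k s.
have hi s := hat_ind prof eps_gt0 k s h_gt0 yS.
have [_ [C [K bi]]] := bs_scale (c1 * (h / eps)) (bs_ind (y k - eps) (y k.+1)).
exists C, K => s; have [b1 b2] := bi s; split.
  by apply: le_trans b1; rewrite !ger0_norm// (le_trans (h0 s)).
by move=> /b2 e; apply/eqP; rewrite eq_le h0 andbT -e.
Qed.

Lemma bs_ker k : bounded_supp (ker y k).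
Proof.
split; first by apply: continuous_measurable_fun; exact: (continuous_ker prof).
have h0 s := ker_ge0 prof eps_gt0 y k s.
have hi s := ker_ind prof eps_gt0 k s h_gt0 yS.
have [_ [C [K bi]]] := bs_scale (c1 / eps) (bs_ind (y k - eps) (y k)).
exists C, K => s; have [b1 b2] := bi s; split.
  by apply: le_trans b1; rewrite !ger0_norm// (le_trans (h0 s)).
by move=> /b2 e; apply/eqP; rewrite eq_le h0 andbT -e.
Qed.

Lemma Rintegral_hat_le k : \int[mu]_x hat y k x <= c1 * (h / eps) * (eps + h).
Proof.
have -> : eps + h = y k.+1 - (y k - eps) by rewrite yS; ring.
have ab : y k - eps <= y k.+1 by rewrite yS; have := h_gt0; have := eps_gt0; lra.
rewrite -(Rintegral_ind ab).
rewrite -RintegralZl//; last exact: (bs_integrable measurableT (bs_ind _ _)).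
apply: le_Rintegral => //.
- exact: (bs_integrable measurableT (bs_hat k)).
- exact: (bs_integrable measurableT (bs_scale _ (bs_ind _ _))).
- by move=> x _; exact: (hat_ind prof eps_gt0 k x h_gt0 yS).
Qed.

End Mesh.
End KernelIntegrals.

Section ErrorIntegrals.
Context {R : realType}.
Local Notation mu := (@lebesgue_measure R).
Variables (H b : R -> R) (c1 c2 eps : R).
Hypotheses (prof : step_profile H b c1 c2) (eps_gt0 : 0 < eps).
Variables (X tn : nat -> R) (dx dt lambda : R).
Hypotheses (dx_gt0 : 0 < dx) (dt_gt0 : 0 < dt) (lambda_def : dt = lambda * dx).
Hypotheses (XS : forall k, X k.+1 = X k + dx) (tS : forall n, tn n.+1 = tn n + dt).
Hypothesis (lambda_gt0 : 0 < lambda).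
Variables (T : R) (T_gt0 : 0 < T).
Variables (alpha : R) (alpha_gt0 : 0 < alpha).
Variables (m K N : nat) (p : nat -> nat -> R) (ifc : nat -> bool) (xi : nat -> R) (V : R).
Local Notation hat := (hat H eps).
Local Notation ker := (ker b eps).
Local Notation mm := (mu \x mu)%E.
Local Notation S := (`]0, T[%classic : set R).
Hypothesis space_var : forall n, (n <= K)%N -> \sum_(k < m) `|p k.+1 n - p k n| <= V.
Hypothesis time_var : forall k, (k < m)%N -> \sum_(n < K) `|p k.+1 n.+1 - p k.+1 n| <= V.
Hypothesis ifc_var : forall k, (k < m)%N ->
  \sum_(n < K) (ifc k)%:R * `|p k.+1 n - p k n| <= V.
Hypothesis level_time_var : forall n, (n < K)%N ->
  \sum_(k < m) `|p k.+1 n.+1 - p k.+1 n| <= (1 + N%:R) * V.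
Hypothesis V_ge0 : 0 <= V.

Lemma tensor_strip_integrable (D : set R) (A B : R -> R) : measurable D ->
  bounded_supp A -> bounded_supp B ->
  strip_integrable T D (fun x t => A x * B t).
Proof.
move=> mD [mA [CA [KA hA]]] [mB [CB [KB hB]]].
have := @strip_bounded_integrable R T T_gt0 D (fun _ _ => 1) A B 1 CA CB KA mD.
rewrite /strip_integrable; under [X in (mu \x mu)%E.-integrable _ X]eq_fun do rewrite mul1r.
apply => //.
- by apply: aeW => z _; rewrite normr1.
- by move=> x; case: (hA x).
- by move=> x; case: (hA x).
- by move=> t _; case: (hB t).
Qed.

Lemma tensor_sum_strip_integrable (D : set R) (A B : nat -> nat -> R -> R) (q : nat -> nat -> R) m' K' :
  measurable D ->
  (forall k n, bounded_supp (A k n)) -> (forall k n, bounded_supp (B k n)) ->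
  strip_integrable T D (fun x t => \sum_(k < m') \sum_(n < K') q k n * (A k n x * B k n t)).
Proof.
move=> mD bA bB; rewrite /strip_integrable.
have mDS : measurable (D `*` S) by exact: measurableX.
apply: (@Rintegrable_sum _ _ _ mm _ mDS _ _ xpredT
  (fun (k : 'I_m') (z : R * R) => \sum_(n < K') q k n * (A k n z.1 * B k n z.2))) => k _.
apply: (@Rintegrable_sum _ _ _ mm _ mDS _ _ xpredT
  (fun (n : 'I_K') (z : R * R) => q k n * (A k n z.1 * B k n z.2))) => n _.
have h := tensor_strip_integrable mD (bs_scale (q k n) (bA k n)) (bB k n).
apply: eq_integrable h => //.
by move=> z _ /=; rewrite mulrA.
Qed.

Lemma near_interface_bs : bounded_supp (near_interface eps dx N xi).
Proof. by apply: (bs_sum _ (f := fun l => ind (xi l.+1 - eps) (xi l.+1 + dx))) => l; exact: bs_ind. Qed.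

Lemma tensor_strip_integral_le (A B : R -> R) (cA cB : R) :
  bounded_supp A -> bounded_supp B -> (forall x, 0 <= A x) -> (forall t, 0 <= B t) ->
  \int[mu]_x A x <= cA -> \int[mu]_(t in S) B t <= cB ->
  strip_integral T setT (fun x t => A x * B t) <= cA * cB.
Proof.
move=> bA bB A0 B0 hA hB; rewrite strip_integral_tensor//.
- apply: ler_pM => //; apply: Rintegral_ge0 => ? _; [exact: A0|exact: B0].
- exact: tensor_strip_integrable.
- exact: bs_integrable.
- by apply: bs_integrable => //; exact: measurable_itv.
Qed.

Lemma tensor_sum_strip_integral (A B : nat -> nat -> R -> R) (q : nat -> nat -> R) m' K' :
  (forall k n, bounded_supp (A k n)) -> (forall k n, bounded_supp (B k n)) ->
  strip_integral T setT (fun x t => \sum_(k < m') \sum_(n < K') q k n * (A k n x * B k n t))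
  = \sum_(k < m') \sum_(n < K') q k n * strip_integral T setT (fun x t => A k n x * B k n t).
Proof.
move=> bA bB; rewrite /strip_integral.
have mDS : measurable (setT `*` S : set (R * R)) by exact: measurableX.
have it k n : (mu \x mu)%E.-integrable (setT `*` S)
    (EFin \o (fun z : R * R => A k n z.1 * B k n z.2)).
  exact: (tensor_strip_integrable measurableT (bA k n) (bB k n)).
have it' k n : (mu \x mu)%E.-integrable (setT `*` S)
    (EFin \o (fun z : R * R => q k n * (A k n z.1 * B k n z.2))).
  have h := tensor_strip_integrable measurableT (bs_scale (q k n) (bA k n)) (bB k n).
  apply: eq_integrable h => //.
  by move=> z _ /=; rewrite mulrA.
rewrite (@Rintegral_sum _ _ _ mm _ mDS _ _ (fun (k : 'I_m') (z : R * R) => \sum_(n < K') q k n * (A k n z.1 * B k n z.2))).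
  apply: eq_bigr => k _.
  rewrite (@Rintegral_sum _ _ _ mm _ mDS _ _ (fun (n : 'I_K') (z : R * R) => q k n * (A k n z.1 * B k n z.2))) //.
  by apply: eq_bigr => n _; rewrite RintegralZl.
by move=> k; apply: (@Rintegrable_sum _ _ _ mm _ mDS _ _ xpredT
  (fun (n : 'I_K') (z : R * R) => q k n * (A k n z.1 * B k n z.2))).
Qed.

Lemma cell_defect_sum k : (k < m)%N ->
  \sum_(n < K) cell_defect lambda alpha p ifc k n <= (2 / alpha + lambda) * V.
Proof.
move=> km; rewrite /cell_defect big_split /= -mulr_sumr [X in _ <= X]mulrDl; apply: lerD.
  by rewrite ler_wpM2l ?time_var// divr_ge0// ltW.
under eq_bigr do rewrite -mulrA.
by rewrite -mulr_sumr ler_wpM2l ?ifc_var// ltW.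
Qed.

(** The hats add up to at most [1], so they do not multiply the measure of
    the strips around the interfaces. *)
Lemma Rintegral_near_hat_sum :
  \sum_(k < m) \int[mu]_x (near_interface eps dx N xi x * hat X k.+1 x)
  <= N%:R * (eps + dx).
Proof.
have bh k := bs_hat prof eps_gt0 dx_gt0 XS k.
have bn := near_interface_bs.
have -> : \sum_(k < m) \int[mu]_x (near_interface eps dx N xi x * hat X k.+1 x)
    = \int[mu]_x \sum_(k < m) (near_interface eps dx N xi x * hat X k.+1 x).
  apply/esym/(@Rintegral_sum _ _ _ mu _ measurableT _ _
    (fun (k : 'I_m) x => near_interface eps dx N xi x * hat X k.+1 x)) => k.
  exact: (bs_integrable measurableT (bs_mul bn (bh _))).
apply: (@le_trans _ _ (\int[mu]_x near_interface eps dx N xi x)).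
  apply: le_Rintegral => //.
  - exact: (bs_integrable measurableT (bs_sum m (fun k => bs_mul bn (bh k.+1)))).
  - exact: (bs_integrable measurableT bn).
  - move=> x _; rewrite -mulr_sumr ler_piMr ?near_interface_ge0//.
    exact: (hat_sum_le1 eps prof X 1%N m x).
have -> : \int[mu]_x near_interface eps dx N xi x
    = \sum_(l < N) \int[mu]_x ind (xi l.+1 - eps) (xi l.+1 + dx) x.
  apply: (@Rintegral_sum _ _ _ mu _ measurableT _ _
    (fun (l : 'I_N) x => ind (xi l.+1 - eps) (xi l.+1 + dx) x)) => l.
  exact: (bs_integrable measurableT (bs_ind _ _)).
have -> : N%:R * (eps + dx) = \sum_(l < N) (eps + dx).
  by rewrite sumr_const card_ord mulr_natl.
apply: ler_sum => l _; rewrite Rintegral_ind; first by have -> : xi l.+1 + dx - (xi l.+1 - eps) = eps + dx by ring.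
by rewrite lerD2l; have := eps_gt0; have := dx_gt0; lra.
Qed.

(** For each cell the time kernels integrate to a constant and the defects add up
    to a time variation; the sum over the cells is [Rintegral_near_hat_sum]. *)
Lemma err_interface_integral :
  strip_integral T setT (err_interface H c1 eps X tn dx lambda N alpha xi m K p ifc)
  <= c1 * ((2 / alpha + lambda) * V) * (N%:R * (eps + dx)).
Proof.
have c10 := sp_c1 prof.
have bh k := bs_hat prof eps_gt0 dx_gt0 XS k.
have bn := near_interface_bs.
have cd k n : 0 <= cell_defect lambda alpha p ifc k n by exact: cell_defect_ge0.
have nh0 k x : 0 <= near_interface eps dx N xi x * hat X k x.
  by rewrite mulr_ge0 ?near_interface_ge0 ?(hat_ge0 prof eps_gt0 dx_gt0 XS).
rewrite /err_interface (tensor_sum_strip_integral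
  (A := fun k n x => near_interface eps dx N xi x * hat X k.+1 x)
  (B := fun k n => ind (tn n.+1 - eps) (tn n.+1))
  (fun k n => cell_defect lambda alpha p ifc k n * (c1 / eps))); last 2 first.
- by move=> k n; exact: bs_mul.
- by move=> k n; exact: bs_ind.
set a := fun k => \int[mu]_x (near_interface eps dx N xi x * hat X k.+1 x).
have a0 k : 0 <= a k by apply: Rintegral_ge0.
apply: (@le_trans _ _ (\sum_(k < m) c1 * ((2 / alpha + lambda) * V) * a k)).
  apply: ler_sum => k _.
  apply: (@le_trans _ _ (\sum_(n < K) cell_defect lambda alpha p ifc k n * (c1 * a k))).
    apply: ler_sum => n _.
    rewrite -mulrA ler_wpM2l//.
    have -> : c1 * a k = c1 / eps * (a k * eps) by field; rewrite gt_eqF.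
    rewrite ler_wpM2l ?divr_ge0 ?(ltW c10) ?(ltW eps_gt0)//.
    apply: tensor_strip_integral_le.
    - exact: bs_mul.
    - exact: bs_ind.
    - by move=> x; exact: nh0.
    - by move=> t; exact: ind_ge0.
    - by [].
    - apply: le_trans (Rintegral_ind_le _ _) _ => //.
      + by have := eps_gt0; lra.
      + by rewrite opprB addrC subrK.
  rewrite -mulr_suml.
  have -> : c1 * ((2 / alpha + lambda) * V) * a k
    = (2 / alpha + lambda) * V * (c1 * a k) by ring.
  by rewrite ler_wpM2r ?cell_defect_sum ?mulr_ge0 ?(ltW c10).
rewrite -mulr_sumr ler_wpM2l ?Rintegral_near_hat_sum//.
by rewrite !mulr_ge0 ?addr_ge0 ?divr_ge0 ?(ltW c10) ?(ltW alpha_gt0) ?(ltW lambda_gt0).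
Qed.

(** The variation in space is summed at each of the [K] levels; each pair of
    indices is felt on a rectangle of sides [eps + dx] and [eps + dt]. *)
Lemma err_mismatch_integral :
  strip_integral T setT (err_mismatch c1 c2 eps X tn dx dt lambda m K p)
  <= K%:R * V * cross_const c1 c2 eps dx dt lambda * ((eps + dx) * (eps + dt)).
Proof.
have cc0 : 0 <= cross_const c1 c2 eps dx dt lambda.
  exact: (cross_const_ge0 prof eps_gt0).
rewrite /err_mismatch (tensor_sum_strip_integral
  (A := fun k n => ind (X k.+1 - eps) (X k.+2))
  (B := fun k n => ind (tn n - eps) (tn n.+1))
  (fun k n => `|p k.+1 n - p k n| * cross_const c1 c2 eps dx dt lambda)); last 2 first.
- by move=> k n; exact: bs_ind.
- by move=> k n; exact: bs_ind.
rewrite exchange_big /=.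
apply: (@le_trans _ _ (\sum_(n < K) V * (cross_const c1 c2 eps dx dt lambda * ((eps + dx) * (eps + dt))))); last first.
  by rewrite sumr_const card_ord -!mulrA mulr_natl.
apply: ler_sum => n _.
apply: (@le_trans _ _ (\sum_(k < m) `|p k.+1 n - p k n| * (cross_const c1 c2 eps dx dt lambda * ((eps + dx) * (eps + dt))))).
  apply: ler_sum => k _; rewrite -mulrA ler_wpM2l// ler_wpM2l//.
  apply: tensor_strip_integral_le.
  - exact: bs_ind.
  - exact: bs_ind.
  - move=> t; exact: ind_ge0.
  - move=> t; exact: ind_ge0.
  - rewrite Rintegral_ind; last by rewrite (XS k.+1); have := eps_gt0; have := dx_gt0; lra.
    by rewrite (XS k.+1) le_eqVlt; apply/orP; left; apply/eqP; ring.
  - apply: le_trans (Rintegral_ind_le _ _) _ => //.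
    + by rewrite tS; have := eps_gt0; have := dt_gt0; lra.
    + by rewrite tS le_eqVlt; apply/orP; left; apply/eqP; ring.
rewrite -mulr_suml; apply: ler_wpM2r; last by apply: space_var; exact: ltnW.
by apply: mulr_ge0 => //; apply: mulr_ge0; apply: addr_ge0; exact: ltW.
Qed.

Variables (n0 K1 : nat).
Hypothesis n0K1 : (n0 + K1 <= K)%N.

Lemma level_err_bs : bounded_supp (level_err H eps X alpha m p n0 K1).
Proof.
have bh k := bs_hat prof eps_gt0 dx_gt0 XS k.
apply: bs_scale; apply: bs_add.
  by apply: (bs_sum _ (f := fun k x => time_osc p n0 K1 k * hat X k.+1 x)) => k; exact: bs_scale.
apply: (bs_sum _ (f := fun l x => `|p l.+1 n0 - p l n0| * ind (X l.+1 - eps) (X l.+1) x)) => k.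
exact/bs_scale/bs_ind.
Qed.

Lemma level_err_integral :
  \int[mu]_x level_err H eps X alpha m p n0 K1 x
  <= alpha^-1 * (K1%:R * ((1 + N%:R) * V) * (c1 * (dx / eps) * (eps + dx)) + eps * V).
Proof.
have c10 := sp_c1 prof.
have bh k := bs_hat prof eps_gt0 dx_gt0 XS k.
have b1 : bounded_supp (fun x => \sum_(k < m) time_osc p n0 K1 k * hat X k.+1 x).
  by apply: (bs_sum _ (f := fun k x => time_osc p n0 K1 k * hat X k.+1 x)) => k; exact: bs_scale.
have b2 : bounded_supp (space_osc eps X m p n0).
  apply: (bs_sum _ (f := fun l x => `|p l.+1 n0 - p l n0| * ind (X l.+1 - eps) (X l.+1) x)) => k.
  exact/bs_scale/bs_ind.
rewrite /level_err RintegralZl//; last exact: (bs_integrable measurableT (bs_add b1 b2)).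
rewrite ler_wpM2l ?invr_ge0 ?(ltW alpha_gt0)//.
rewrite RintegralD//; [|exact: (bs_integrable measurableT b1)|exact: (bs_integrable measurableT b2)].
apply: lerD.
  have -> : \int[mu]_x (\sum_(k < m) time_osc p n0 K1 k * hat X k.+1 x)
      = \sum_(k < m) \int[mu]_x (time_osc p n0 K1 k * hat X k.+1 x).
    apply: (@Rintegral_sum _ _ _ mu _ measurableT _ _
      (fun (k : 'I_m) x => time_osc p n0 K1 k * hat X k.+1 x)) => k.
    exact: (bs_integrable measurableT (bs_scale _ (bh _))).
  apply: (@le_trans _ _ (\sum_(k < m) time_osc p n0 K1 k * (c1 * (dx / eps) * (eps + dx)))).
    apply: ler_sum => k _; rewrite RintegralZl//; last exact: (bs_integrable measurableT (bh _)).
    rewrite ler_wpM2l ?time_osc_ge0//.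
    exact: (Rintegral_hat_le prof eps_gt0 dx_gt0 XS).
  rewrite -mulr_suml ler_wpM2r//.
    have d0 : 0 <= dx / eps by apply: divr_ge0; exact: ltW.
    by rewrite mulr_ge0 ?addr_ge0 ?(ltW eps_gt0) ?(ltW dx_gt0)// mulr_ge0// ltW.
  rewrite /time_osc exchange_big /=.
  have -> : K1%:R * ((1 + N%:R) * V) = \sum_(l < K1) (1 + N%:R) * V.
    by rewrite sumr_const card_ord mulr_natl.
  apply: ler_sum => l _; apply: level_time_var.
  by apply: leq_trans n0K1; rewrite ltn_add2l.
have -> : \int[mu]_x space_osc eps X m p n0 x
    = \sum_(l < m) \int[mu]_x (`|p l.+1 n0 - p l n0| * ind (X l.+1 - eps) (X l.+1) x).
  apply: (@Rintegral_sum _ _ _ mu _ measurableT _ _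
    (fun (l : 'I_m) x => `|p l.+1 n0 - p l n0| * ind (X l.+1 - eps) (X l.+1) x)) => l.
  exact: (bs_integrable measurableT (bs_scale _ (bs_ind _ _))).
apply: (@le_trans _ _ (\sum_(l < m) eps * `|p l.+1 n0 - p l n0|)).
  apply: ler_sum => l _; rewrite RintegralZl//; last exact: (bs_integrable measurableT (bs_ind _ _)).
  rewrite mulrC ler_wpM2r// Rintegral_ind; last by have := eps_gt0; lra.
  by rewrite opprB addrC subrK.
rewrite -mulr_sumr ler_wpM2l ?(ltW eps_gt0)// space_var//.
by apply: leq_trans n0K1; rewrite leq_addr.
Qed.

End ErrorIntegrals.

(** * The entropy inequality tested with the mesh cells *)
Section EntropyInequality.
Context {R : realType}.
Local Notation mu := (@lebesgue_measure R).
Local Notation mm := (mu \x mu)%E.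
Variables (T : R) (N : nat) (xi : nat -> R) (F : nat -> R -> R) (alpha : R)
  (u0 : R -> R) (u : R -> R -> R).
Local Notation S := (`]0, T[%classic : set R).
Local Notation g i := (inverse_fun (F i)).
Local Notation D i := ([set` subdomain N xi i] : set R).
Hypotheses (T_gt0 : 0 < T) (alpha_gt0 : 0 < alpha).
Hypothesis F_reg : forall i, (i <= N)%N -> regular_increasing alpha (F i).
Hypothesis u0_L1 : u0 \in Lfun mu 1%E.
Hypothesis u_sol : entropy_solution T N xi F u0 u.

(** Each constant is obtained by inverting one flux at the value of the previous
    one, so the flux value is passed along unchanged. *)
Lemma interface_constants_flux (q : R) i : (i <= N)%N ->
  interface_constants F (g 0%N q) i = g i q.
Proof.
elim: i => [//|i IH] iN /=.
by rewrite IH 1?ltnW// (inverse_funKV alpha_gt0 (F_reg (ltnW iN))).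
Qed.

Lemma measurable_flux i : (i <= N)%N -> measurable_fun setT (F i).
Proof.
by move=> iN; apply: continuous_measurable_fun; exact: (flux_continuous (F_reg iN)).
Qed.

Lemma solution_measurable :
  measurable_fun (setT `*` S) (fun z : R * R => u z.1 z.2).
Proof. by case: u_sol => _ []. Qed.

Lemma solution_bounded : exists2 B : R, 0 <= B &
  {ae mm, forall z : R * R, 0 < z.2 < T -> `|u z.1 z.2| <= B}.
Proof.
case: u_sol => _ [_ [B hB]] _; exists `|B| => //.
by apply: ae_imply hB => z h /h uB; exact: le_trans (ler_norm B).
Qed.

Lemma flux_bounded i (B q v : R) : (i <= N)%N -> `|v| <= B ->
  `|F i v - q| <= `|F i B - q| + `|F i (- B) - q|.
Proof.
move=> iN; rewrite ler_norml => /andP[Bv vB].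
have h1 : F i v <= F i B by rewrite (flux_le alpha_gt0 (F_reg iN)).
have h2 : F i (- B) <= F i v by rewrite (flux_le alpha_gt0 (F_reg iN)).
have := ler_norm (F i B - q); have := normr_ge0 (F i B - q).
have := ler_norm (- (F i (- B) - q)); rewrite normrN; have := normr_ge0 (F i (- B) - q).
by rewrite ler_norml => *; apply/andP; split; lra.
Qed.

Lemma deviation_strip_integrable (E : set R) (c : R) (A B : R -> R) : measurable E ->
  bounded_supp A -> bounded_supp B ->
  strip_integrable T E (fun x t => `|u x t - c| * (A x * B t)).
Proof.
move=> mE [mA [CA [KA hA]]] [mB [CB [KB hB]]]; have [C C0 hC] := solution_bounded.
apply: (@strip_bounded_integrable _ T T_gt0 E _ A B (C + `|c|) CA CB KA) => //.
- apply: measurableT_comp => //; apply: measurable_funB => //.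
  exact: solution_measurable.
- apply: ae_imply hC => z h /h uB; rewrite normr_id.
  by rewrite (le_trans (ler_normB _ _))// lerD2r.
- by move=> x; case: (hA x).
- by move=> x; case: (hA x).
- by move=> t _; case: (hB t).
Qed.

Lemma flux_deviation_strip_integrable (E : set R) j (q : R) (A B : R -> R) :
  measurable E -> (j <= N)%N -> bounded_supp A -> bounded_supp B ->
  strip_integrable T E (fun x t => `|F j (u x t) - q| * (A x * B t)).
Proof.
move=> mE iN [mA [CA [KA hA]]] [mB [CB [KB hB]]]; have [C C0 hC] := solution_bounded.
apply: (@strip_bounded_integrable _ T T_gt0 E _ A B
  (`|F j C - q| + `|F j (- C) - q|) CA CB KA) => //.
- apply: measurableT_comp => //; apply: measurable_funB => //.
  apply: measurableT_comp; [exact: measurable_flux|exact: solution_measurable].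
- apply: ae_imply hC => z h /h uB; rewrite normr_id.
  exact: flux_bounded.
- by move=> x; case: (hA x).
- by move=> x; case: (hA x).
- by move=> t _; case: (hB t).
Qed.

Lemma L1_deviation_integrable (E : set R) (v : R -> R) (c : R) (A : R -> R) :
  measurable E -> v \in Lfun mu 1%E -> bounded_supp A ->
  mu.-integrable E (EFin \o (fun x => `|v x - c| * A x)).
Proof.
move=> mE /Lfun1_integrable iv bA; case: (bA) => mA [CA [KA hA]].
have mv : measurable_fun setT v by apply/measurable_EFinP; exact: (measurable_int mu iv).
have iv' : mu.-integrable setT (EFin \o (fun x => CA * `|v x| + `|c| * `|A x|)).
  have i1 : mu.-integrable setT (EFin \o (fun x => CA * `|v x|)).
    have := @integrableZl _ _ _ mu setT measurableT CA (EFin \o (fun x => `|v x|)).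
    by apply; exact: integrable_norm.
  have bA' : bounded_supp (fun x => `|A x|).
    split; first exact: measurableT_comp.
    exists CA, KA => x; have [h1 h2] := hA x; rewrite normr_id; split => // /h2 ->.
    by rewrite normr0.
  have i2 := bs_integrable measurableT (bs_scale `|c| bA').
  have := integrableD measurableT i1 i2.
  by apply: eq_integrable => // x _.
apply: (@integrableS _ _ _ _ setT) => //.
apply: (@ae_le_Rintegrable _ _ _ mu setT measurableT _ _ _ iv').
  apply: measurable_funM => //; apply: measurableT_comp => //.
  exact: measurable_funB.
apply: aeW => x _; have [h1 _] := hA x.
rewrite normrM normr_id; apply: (@le_trans _ _ ((`|v x| + `|c|) * `|A x|)).
  by rewrite ler_wpM2r// ler_normB.
by rewrite mulrDl lerD2r mulrC ler_wpM2r.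
Qed.

Variables (H b : R -> R) (c1 c2 eps : R).
Hypotheses (prof : step_profile H b c1 c2) (eps_gt0 : 0 < eps).
Variables (X tn : nat -> R) (dx dt : R).
Hypotheses (dx_gt0 : 0 < dx) (dt_gt0 : 0 < dt).
Hypotheses (XS : forall k, X k.+1 = X k + dx) (tS : forall n, tn n.+1 = tn n + dt).
Local Notation hat := (hat H eps).
Local Notation ker := (ker b eps).

Let bhx k := bs_hat prof eps_gt0 dx_gt0 XS k.
Let bht n := bs_hat prof eps_gt0 dt_gt0 tS n.
Let bkx k := bs_ker prof eps_gt0 dx_gt0 XS k.
Let bkt n := bs_ker prof eps_gt0 dt_gt0 tS n.

Definition interior_piece i (q : R) k n (x t : R) : R :=
  `|u x t - g i q| * (hat X k x * (ker tn n t - ker tn n.+1 t))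
  + `|F i (u x t) - q| * ((ker X k x - ker X k.+1 x) * hat tn n t).

Lemma interior_piece_integrable i q k n : (i <= N)%N ->
  strip_integrable T (D i) (interior_piece i q k n).
Proof.
move=> iN; rewrite /strip_integrable.
have mD : measurable (D i) by exact: measurable_itv.
have i1 := deviation_strip_integrable (g i q) mD (bhx k) (bs_sub (bkt n) (bkt n.+1)).
have i2 := flux_deviation_strip_integrable q mD iN (bs_sub (bkx k) (bkx k.+1)) (bht n).
have mDS : measurable (D i `*` S) by apply: measurableX; exact: measurable_itv.
have := @integrableD _ _ _ mm _ mDS _ _ i1 i2.
by apply: eq_integrable => // z _.
Qed.

(** In the flux variable the entropy flux is [|F(u) - q|], which depends on the
    trace only through its flux; the Rankine--Hugoniot condition concludes. *)
Lemma interface_flux_cancel (um up : nat -> R -> R) (q : R) i (phi : R -> R) :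
  (i < N)%N -> measurable_fun S (um i.+1) -> measurable_fun S (up i.+1) ->
  continuous phi ->
  {ae mu, forall t, 0 < t < T -> F i (um i.+1 t) = F i.+1 (up i.+1 t)} ->
  \int[mu]_(t in S) (entropy_flux (F i) (g i q) (um i.+1 t) * phi t)
  = \int[mu]_(t in S) (entropy_flux (F i.+1) (g i.+1 q) (up i.+1 t) * phi t).
Proof.
move=> iN mum mup cphi rh.
have E1 t : entropy_flux (F i) (g i q) (um i.+1 t) = `|F i (um i.+1 t) - q|.
  by rewrite (entropy_fluxE alpha_gt0 (F_reg (ltnW iN))) (inverse_funKV alpha_gt0 (F_reg (ltnW iN))).
have E2 t : entropy_flux (F i.+1) (g i.+1 q) (up i.+1 t) = `|F i.+1 (up i.+1 t) - q|.
  by rewrite (entropy_fluxE alpha_gt0 (F_reg iN)) (inverse_funKV alpha_gt0 (F_reg iN)).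
under eq_Rintegral do rewrite E1.
under [in RHS]eq_Rintegral do rewrite E2.
rewrite /Rintegral; congr fine.
have mphi : measurable_fun S phi.
  by apply: measurable_funTS; exact: continuous_measurable_fun.
apply: ae_eq_integral.
- exact: measurable_itv.
- apply/measurable_EFinP; apply: measurable_funM => //; apply: measurableT_comp => //.
  apply: measurable_funB => //; apply: measurableT_comp => //.
  exact: measurable_flux (ltnW iN).
- apply/measurable_EFinP; apply: measurable_funM => //; apply: measurableT_comp => //.
  apply: measurable_funB => //; apply: measurableT_comp => //.
  exact: measurable_flux iN.
- apply: ae_imply rh => t h; rewrite /= in_itv /= => /h -> //.
Qed.

Lemma entropy_tensor (q : R) k n :
  0 <= \sum_(i < N.+1) (strip_integral T (D i) (interior_piece i q k n)
    - \int[mu]_(x in D i) (`|u x T - g i q| * (hat X k x * hat tn n T))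
    + \int[mu]_(x in D i) (`|u0 x - g i q| * (hat X k x * hat tn n 0))).
Proof.
case: (u_sol) => _ _ [um [up [lt rt rh ent]]].
have tf := test_function_hat prof eps_gt0 T k n dx_gt0 dt_gt0 XS tS.
have := ent (g 0%N q) _ tf; rewrite /entropy_functional.
pose M i := \int[mu]_(t in S) (entropy_flux (F i) (g i q) (um i.+1 t) * (hat X k (xi i.+1) * hat tn n t)).
pose Q i := \int[mu]_(t in S) (entropy_flux (F i) (g i q) (up i t) * (hat X k (xi i) * hat tn n t)).
pose Y i := strip_integral T (D i) (interior_piece i q k n)
    - \int[mu]_(x in D i) (`|u x T - g i q| * (hat X k x * hat tn n T))
    + \int[mu]_(x in D i) (`|u0 x - g i q| * (hat X k x * hat tn n 0)).
have MQ i : (i < N)%N -> M i = Q i.+1.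
  move=> iN; apply: interface_flux_cancel => //.
  - by case: (lt i.+1); rewrite ?iN.
  - by case: (rt i.+1); rewrite ?iN.
  - move=> t; apply: cvgM; first exact: cvg_cst.
    exact: (continuous_hat prof).
  - exact: (rh i.+1).
rewrite (eq_big_nat _ _ (F2 := fun i =>
    Y i + ((if (0 < i)%N then Q i else 0) - (if (i < N)%N then M i else 0)))); last first.
  move=> i; rewrite ltnS => /andP[_ iN] /=.
  rewrite (interface_constants_flux q iN).
  rewrite (d_x_tensor (hat tn n) (is_derive_hat eps prof X k)).
  rewrite (d_t_tensor (hat X k) (is_derive_hat eps prof tn n)).
  have -> : \int[mu]_(t in S) \int[mu]_(x in D i)
      (`|u x t - g i q| * (hat X k x * (ker tn n t - ker tn n.+1 t))
       + entropy_flux (F i) (g i q) (u x t) * ((ker X k x - ker X k.+1 x) * hat tn n t))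
      = strip_integral T (D i) (interior_piece i q k n).
    rewrite -(iterated_strip_integral (measurable_itv _) (interior_piece_integrable q k n iN)).
    apply: eq_Rintegral => t _; apply: eq_Rintegral => x _.
    by rewrite /interior_piece (entropy_fluxE alpha_gt0 (F_reg iN)) (inverse_funKV alpha_gt0 (F_reg iN)).
  by rewrite /Y /Q /M; case: ifP => _; case: ifP => _; ring.
rewrite big_split /= (_ : \sum_(0 <= i < N.+1) (_ - _) = 0); last first.
  rewrite big_split /= sumrN.
  rewrite big_nat_recl//= add0r [X in _ - X]big_nat_recr//= ltnn addr0.
  apply/eqP; rewrite subr_eq0; apply/eqP; rewrite !big_mkord.
  by apply: eq_bigr => i _; rewrite (ltn_ord i) MQ.
by rewrite addr0 big_mkord.
Qed.

Variables (m K M : nat) (p : nat -> nat -> R).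
Hypotheses (tn0 : tn 0%N = 0) (tnM : tn M.+1 = T).

Let u_T_L1 : (u ^~ T) \in Lfun mu 1%E.
Proof. by case: u_sol => -[h _] _ _; apply: h; rewrite lexx ltW. Qed.

Let level_piece_integrable i n0 (v : R -> R) k n : v \in Lfun mu 1%E ->
  mu.-integrable (D i) (EFin \o (fun x =>
    `|v x - g i (p k.+1 n)| * (hat X k.+1 x * hat tn n (tn n0)))).
Proof.
move=> vL; apply: (@L1_deviation_integrable (D i) v _ (fun x => hat X k.+1 x * hat tn n (tn n0))) => //.
have := bs_scale (hat tn n (tn n0)) (bhx k.+1).
by under [X in bounded_supp X]eq_fun do rewrite mulrC.
Qed.

Let level_row_integrable i n0 (v : R -> R) k : v \in Lfun mu 1%E ->
  mu.-integrable (D i) (EFin \o (fun x =>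
    \sum_(n < K) `|v x - g i (p k.+1 n)| * (hat X k.+1 x * hat tn n (tn n0)))).
Proof.
move=> vL; have mD : measurable (D i) by exact: measurable_itv.
apply: (@Rintegrable_sum _ _ _ mu _ mD _ _ xpredT (fun (n : 'I_K) x =>
    `|v x - g i (p k.+1 n)| * (hat X k.+1 x * hat tn n (tn n0)))) => n _.
exact: level_piece_integrable.
Qed.

Lemma level_term_integrable i n0 (v : R -> R) : v \in Lfun mu 1%E ->
  mu.-integrable (D i) (EFin \o (fun x => level_term H eps X tn F m K p n0 i (v x) x)).
Proof.
move=> vL; have mD : measurable (D i) by exact: measurable_itv.
apply: (@Rintegrable_sum _ _ _ mu _ mD _ _ xpredT (fun (k : 'I_m) x =>
    \sum_(n < K) `|v x - g i (p k.+1 n)| * (hat X k.+1 x * hat tn n (tn n0)))) => k _.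
exact: level_row_integrable.
Qed.

Let level_term_integral i n0 (v : R -> R) : v \in Lfun mu 1%E ->
  \sum_(k < m) \sum_(n < K)
    \int[mu]_(x in D i) (`|v x - g i (p k.+1 n)| * (hat X k.+1 x * hat tn n (tn n0)))
  = \int[mu]_(x in D i) level_term H eps X tn F m K p n0 i (v x) x.
Proof.
move=> vL; have mD : measurable (D i) by exact: measurable_itv.
rewrite /level_term (@Rintegral_sum _ _ _ mu _ mD _ _ (fun (k : 'I_m) x =>
    \sum_(n < K) `|v x - g i (p k.+1 n)| * (hat X k.+1 x * hat tn n (tn n0)))).
  apply: eq_bigr => k _; symmetry.
  apply: (@Rintegral_sum _ _ _ mu _ mD _ _ (fun (n : 'I_K) x =>
    `|v x - g i (p k.+1 n)| * (hat X k.+1 x * hat tn n (tn n0)))) => n.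
  exact: level_piece_integrable.
by move=> k; exact: level_row_integrable.
Qed.

(** The test function of the cell [k] and level [n] is used with the constants of
    flux value [p k n].  When [p] is given by the scheme, this is the doubling of
    variables, with the second variable discrete. *)
Lemma entropy_summed :
  0 <= \sum_(i < N.+1) (
    strip_integral T (D i) (fun x t => interior_term H b eps X tn F m K p i (u x t) x t)
    - \int[mu]_(x in D i) level_term H eps X tn F m K p M.+1 i (u x T) x
    + \int[mu]_(x in D i) level_term H eps X tn F m K p 0%N i (u0 x) x).
Proof.
have h : 0 <= \sum_(k < m) \sum_(n < K) \sum_(i < N.+1)
   (strip_integral T (D i) (interior_piece i (p k.+1 n) k.+1 n)
    - \int[mu]_(x in D i) (`|u x T - g i (p k.+1 n)| * (hat X k.+1 x * hat tn n T))
    + \int[mu]_(x in D i) (`|u0 x - g i (p k.+1 n)| * (hat X k.+1 x * hat tn n 0))).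
  by apply: sumr_ge0 => k _; apply: sumr_ge0 => n _; exact: entropy_tensor.
apply: (le_trans h); rewrite le_eqVlt; apply/orP; left; apply/eqP.
under eq_bigr do rewrite exchange_big; rewrite exchange_big /=.
apply: eq_bigr => i _; have iN : (i <= N)%N by rewrite -ltnS.
under eq_bigr do rewrite big_split big_split /= sumrN.
rewrite big_split big_split /= sumrN; congr (_ - _ + _).
- rewrite /strip_integral.
  have mDS : measurable (D i `*` S) by apply: measurableX; exact: measurable_itv.
  have ip k n : mm.-integrable (D i `*` S)
      (EFin \o (fun z : R * R => interior_piece i (p k.+1 n) k.+1 n z.1 z.2)).
    exact: interior_piece_integrable.
  rewrite (@Rintegral_sum _ _ _ mm _ mDS _ _ (fun (k : 'I_m) (z : R * R) =>
    \sum_(n < K) interior_piece i (p k.+1 n) k.+1 n z.1 z.2)).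
    apply: eq_bigr => k _; symmetry.
    exact: (@Rintegral_sum _ _ _ mm _ mDS _ _ (fun (n : 'I_K) (z : R * R) =>
      interior_piece i (p k.+1 n) k.+1 n z.1 z.2)).
  move=> k; exact: (@Rintegrable_sum _ _ _ mm _ mDS _ _ xpredT (fun (n : 'I_K) (z : R * R) =>
      interior_piece i (p k.+1 n) k.+1 n z.1 z.2)).
- by rewrite -(level_term_integral i M.+1 u_T_L1) tnM.
- by rewrite -(level_term_integral i 0%N u0_L1) tn0.
Qed.

Lemma interior_term_integrable i : (i <= N)%N -> strip_integrable T (D i)
  (fun x t => interior_term H b eps X tn F m K p i (u x t) x t).
Proof.
move=> iN.
have mDS : measurable (D i `*` S) by apply: measurableX; exact: measurable_itv.
apply: (@Rintegrable_sum _ _ _ mm _ mDS _ _ xpredT (fun (k : 'I_m) (z : R * R) =>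
    \sum_(n < K) interior_piece i (p k.+1 n) k.+1 n z.1 z.2)) => k _.
apply: (@Rintegrable_sum _ _ _ mm _ mDS _ _ xpredT (fun (n : 'I_K) (z : R * R) =>
    interior_piece i (p k.+1 n) k.+1 n z.1 z.2)) => n _.
exact: interior_piece_integrable.
Qed.

End EntropyInequality.

Section AeRintegral.
Context d (X : measurableType d) (R : realType) (m : {measure set X -> \bar R}).

Lemma ae_ge0_Rintegral (D : set X) (f : X -> R) : measurable D ->
  m.-integrable D (EFin \o f) -> {ae m, forall x, D x -> 0 <= f x} ->
  0 <= \int[m]_(x in D) f x.
Proof.
move=> mD fi f0; have mf := measurable_int m fi.
rewrite /Rintegral (ae_eq_integral (fun x => `|f x|%:E)) //.
- by apply: fine_ge0; apply: integral_ge0 => x _; rewrite lee_fin.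
- by apply/measurable_EFinP; apply: measurableT_comp => //; exact/measurable_EFinP.
- by move: f0; apply: ae_imply => x h Dx; rewrite ger0_norm ?h.
Qed.

Lemma ae_le_Rintegral (D : set X) (f g : X -> R) : measurable D ->
  m.-integrable D (EFin \o f) -> m.-integrable D (EFin \o g) ->
  {ae m, forall x, D x -> f x <= g x} ->
  \int[m]_(x in D) f x <= \int[m]_(x in D) g x.
Proof.
move=> mD fi gi fg; rewrite -subr_ge0 -RintegralB//.
apply: ae_ge0_Rintegral => //; last first.
  by move: fg; apply: ae_imply => x h /h; rewrite subr_ge0.
by have := integrableB mD gi fi; apply: eq_integrable.
Qed.

(** Dominated convergence.  The function [z] plays the part of the space
    coordinate of a point of the strip. *)
Lemma left_tail_integral (D : set X) (f z : X -> R) (e : R) : measurable D ->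
  measurable_fun D z -> m.-integrable D (EFin \o f) -> 0 < e ->
  exists k : nat,
    m.-integrable D (EFin \o (fun x => `|f x| * \1_(`]-oo, (- k%:R)]%classic) (z x)))
    /\ \int[m]_(x in D) (`|f x| * \1_(`]-oo, (- k%:R)]%classic) (z x)) <= e.
Proof.
move=> mD mz fi e0.
have mf : measurable_fun D f by apply/measurable_EFinP; exact: (measurable_int m fi).
pose w (n : nat) x : R := `|f x| * \1_(`]-oo, (- n%:R)]%classic) (z x).
have mw n : measurable_fun D (w n).
  apply: measurable_funM; first exact: measurableT_comp.
  apply: measurableT_comp => //; apply: measurable_indic; exact: measurable_itv.
have w_le n x : `|w n x| <= `|f x|.
  rewrite /w normrM normr_id indicE ler_piMr//.
  by rewrite ger0_norm ?lern1 ?leq_b1.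
have wi n : m.-integrable D (EFin \o w n).
  apply: (ae_le_Rintegrable mD _ (integrable_norm fi)) => //.
  by apply: aeW => x _; exact: w_le.
have [|||||_ _ wcvg] := @dominated_convergence _ _ _ m D mD (fun n => EFin \o w n)
  (cst 0%E) (fun x => `|f x|%:E).
- by move=> n; apply/measurable_EFinP.
- exact: measurable_cst.
- apply: aeW => x _; apply: (@cvg_near_cst _ _ _ _ _ _ _) => /=.
  exists (Num.truncn `|z x|).+1 => // n /= hn; rewrite /w indicE memNset ?mulr0//.
  rewrite /= in_itv /= => xn; have : n%:R <= `|z x|.
    by have := ler_norm (- z x); rewrite normrN; lra.
  rewrite leNgt => /negP; apply; apply: lt_le_trans (truncnS_gt _) _.
  by rewrite ler_nat.
- exact: (integrable_norm fi).
- by apply: aeW => x n _; rewrite /= lee_fin; exact: w_le.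
move: wcvg; rewrite integral_cst// mul0e => /fine_cvgP[_].
move=> /(@cvgrPdist_lt _ _ _ (\oo)) /(_ _ e0) [k _ hk]; exists k; split; first exact: wi.
have := hk k (leqnn k); rewrite /= sub0r normrN => {}hk.
by apply: ltW; apply: le_lt_trans hk; exact: ler_norm.
Qed.

End AeRintegral.

(** * Cell averages of the initial data *)
Section Averages.
Context {R : realType}.
Local Notation mu := (@lebesgue_measure R).
Variable u0 : R -> R.
Hypothesis u0_int : mu.-integrable setT (EFin \o u0).

Definition average (y dx : R) : R := dx^-1 * \int[mu]_(x in `]y, y + dx[) u0 x.

Let cell_cst (y dx c : R) : 0 < dx -> \int[mu]_(x in `]y, y + dx[) c = c * dx.
Proof.
move=> dx0; rewrite Rintegral_cst; last exact: measurable_itv.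
rewrite [X in fine X](_ : _ = dx%:E)//.
transitivity (mu (`]y, (y + dx)[%classic : set R)); first by [].
by rewrite lebesgue_measure_itv /= lte_fin ltrDl dx0 -EFinD addrAC subrr add0r.
Qed.

Let cst_int (y dx c : R) : mu.-integrable `]y, y + dx[ (EFin \o (fun=> c)).
Proof.
have := bs_integrable (measurable_itv `]y, y + dx[) (bs_scale c (bs_ind y (y + dx))).
apply: eq_integrable; first exact: measurable_itv.
by move=> x; rewrite inE /= in_itv /= => /andP[h1 h2]; rewrite ind1 ?mulr1// !ltW.
Qed.

Let cell_int (y dx : R) : mu.-integrable `]y, y + dx[ (EFin \o u0).
Proof. by apply: (integrableS measurableT) u0_int => //; exact: measurable_itv. Qed.

Lemma average_ge (y dx c : R) : 0 < dx ->
  {ae mu, forall x, y < x < y + dx -> c <= u0 x} -> c <= average y dx.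
Proof.
move=> dx0 h; rewrite /average mulrC ler_pdivlMr// -(cell_cst y c dx0).
exact: ae_le_Rintegral.
Qed.

Lemma average_le (y dx c : R) : 0 < dx ->
  {ae mu, forall x, y < x < y + dx -> u0 x <= c} -> average y dx <= c.
Proof.
move=> dx0 h; rewrite /average mulrC ler_pdivrMr// -(cell_cst y c dx0).
exact: ae_le_Rintegral.
Qed.

Lemma average_dist (y dx c r : R) : 0 < dx ->
  {ae mu, forall x, y < x < y + dx -> `|u0 x - c| <= r} -> `|average y dx - c| <= r.
Proof.
move=> dx0 h; rewrite ler_distl; apply/andP; split.
  apply: average_ge => //; move: h; apply: ae_imply => x h /h.
  by rewrite ler_distl => /andP[].
apply: average_le => //; move: h; apply: ae_imply => x h /h.
by rewrite ler_distl => /andP[].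
Qed.

Lemma average_far_left (dx e : R) : 0 < dx -> 0 < e ->
  exists Y : R, forall y, y + dx <= Y -> `|average y dx| <= e.
Proof.
move=> dx0 e0.
have mid : measurable_fun setT (fun x : R => x) by exact: measurable_id.
have [k [fi fk]] := @left_tail_integral _ _ R mu setT u0 id (e * dx)
  measurableT mid u0_int (mulr_gt0 e0 dx0).
exists (- k%:R) => y yk; rewrite /average normrM ger0_norm ?invr_ge0 ?(ltW dx0)//.
rewrite mulrC ler_pdivrMr// (le_trans _ fk)//.
apply: le_trans (le_normr_Rintegral _ (cell_int y dx)) _; first exact: measurable_itv.
apply: (@le_trans _ _ (\int[mu]_(x in `]y, y + dx[) (`|u0 x| * \1_(`]-oo, (- k%:R)]%classic) x))).
  apply: le_Rintegral; first exact: measurable_itv.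
  - exact: integrable_norm.
  - by apply: (integrableS measurableT) fi => //; exact: measurable_itv.
  - move=> x; rewrite /= in_itv /= => /andP[_ h]; rewrite indicE mem_set ?mulr1//.
    by rewrite /= in_itv /= ltW// (lt_le_trans h).
by apply: ge0_subset_Rintegral => // x _; rewrite mulr_ge0.
Qed.

Variables (h : R -> R) (TVh : R).
Hypothesis h_ae : {ae mu, forall x, u0 x = h x}.
Hypothesis h_BV : forall a b, a <= b -> (total_variation a b h <= TVh%:E)%E.

(** Real-valued total variation of the good representative [h]; it is additive,
    whereas the differences of [u0] are only controlled almost everywhere. *)
Definition variation (a b : R) : R := fine (total_variation a b h).

Let tv_fin a b : a <= b -> total_variation a b h \is a fin_num.
Proof.
move=> ab; rewrite ge0_fin_numE; last exact: total_variation_ge0.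
by apply: le_lt_trans (h_BV ab) _; rewrite ltry.
Qed.

Lemma variation_ge0 a b : a <= b -> 0 <= variation a b.
Proof. by move=> ab; apply: fine_ge0; exact: total_variation_ge0. Qed.

Lemma variation_le a b : a <= b -> variation a b <= TVh.
Proof. by move=> ab; rewrite -lee_fin fineK ?tv_fin// h_BV. Qed.

Lemma variation_add a b c : a <= c -> c <= b ->
  variation a b = variation a c + variation c b.
Proof.
move=> ac cb; rewrite /variation (total_variationD h ac cb) fineD ?tv_fin//.
Qed.

Lemma variation_dist a b x y : a <= x <= b -> a <= y <= b ->
  `|h x - h y| <= variation a b.
Proof.
wlog xy : x y / x <= y.
  move=> H; have [/H|/ltW/H H'] := leP x y; first exact.
  by move=> ax ay; rewrite distrC; exact: H'.
move=> /andP[ax xb] /andP[ay yb]; rewrite distrC.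
have h1 : `|h y - h x| <= variation x y.
  by rewrite -lee_fin fineK ?tv_fin//; exact: total_variation_ge.
apply: (le_trans h1).
rewrite (variation_add ax xb) (variation_add xy yb).
by have := variation_ge0 ax; have := variation_ge0 yb; lra.
Qed.

Lemma average_dist_BV y dx x a b : 0 < dx -> a <= y -> y + dx <= b -> a <= x <= b ->
  `|average y dx - h x| <= variation a b.
Proof.
move=> dx0 ay yb ax; apply: average_dist => //.
move: h_ae; apply: ae_imply => z -> /andP[yz zy]; apply: variation_dist => //.
by rewrite (le_trans ay (ltW yz)) (le_trans (ltW zy)).
Qed.

Section MeshVariation.
Variables (X : nat -> R) (dx : R).
Hypotheses (dx_gt0 : 0 < dx) (XS : forall k, X k.+1 = X k + dx).

Let X_le k l : (k <= l)%N -> X k <= X l.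
Proof. by move=> kl; rewrite -(subnKC kl) (mesh_add XS) lerDl mulr_ge0// ltW. Qed.

Lemma mesh_variation m : \sum_(k < m) variation (X k) (X k.+1) <= TVh.
Proof.
apply: (@le_trans _ _ (variation (X 0%N) (X m))); last exact: variation_le (X_le _).
rewrite le_eqVlt; apply/orP; left; apply/eqP.
elim: m => [|m IH]; first by rewrite big_ord0 /variation total_variationxx.
by rewrite big_ord_recr /= IH -variation_add ?X_le.
Qed.

(** The jump between two neighbouring averages is at most the variation over the
    two cells, and each cell is used twice. *)
Lemma average_variation m :
  \sum_(k < m) `|average (X k.+1) dx - average (X k) dx| <= 2 * TVh.
Proof.
pose A k := variation (X k) (X k.+1).
apply: (@le_trans _ _ (\sum_(k < m) A k + \sum_(k < m) A k.+1)).
  rewrite -big_split; apply: ler_sum => k _ /=.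
  have h1 : `|average (X k.+1) dx - h (X k.+1)| <= A k.+1.
    by apply: average_dist_BV; rewrite // -?XS ?lexx ?X_le.
  have h2 : `|average (X k) dx - h (X k.+1)| <= A k.
    by apply: average_dist_BV; rewrite // -?XS ?lexx ?X_le.
  have -> : average (X k.+1) dx - average (X k) dx
    = (average (X k.+1) dx - h (X k.+1)) - (average (X k) dx - h (X k.+1)) by ring.
  by apply: le_trans (ler_normB _ _) _; rewrite addrC; exact: lerD.
have h1 := mesh_variation m; have := mesh_variation m.+1.
rewrite big_ord_recl /= => h2.
have := @variation_ge0 (X 0%N) (X 1%N) (X_le (leq0n _)).
have -> : \sum_(k < m) A k.+1 = \sum_(i < m) variation (X (bump 0 i)) (X (bump 0 i).+1) by [].
by rewrite /A; lra.
Qed.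

End MeshVariation.

End Averages.

(** * Relevant values and grid geometry *)
Section RelevantValues.
Context {R : realType}.
Local Notation mu := (@lebesgue_measure R).
Variables (N : nat) (xi : nat -> R) (F : nat -> R -> R) (u0 : R -> R).

Lemma relevant_values_convex i a b z : relevant_values N xi F u0 i a ->
  relevant_values N xi F u0 i b -> a <= z <= b -> relevant_values N xi F u0 i z.
Proof.
case: i => [|i] /=.
  move=> [a1 _] [_ b2] /andP[az zb]; split.
    by apply: le_trans a1 _; rewrite lee_fin.
  by apply: le_trans b2; rewrite lee_fin.
move=> ha hb /andP[az zb] J [[c [d ->]] AJ].
have := ha _ (conj (ex_intro _ c (ex_intro _ d erefl)) AJ).
have := hb _ (conj (ex_intro _ c (ex_intro _ d erefl)) AJ).
rewrite /= !in_itv /= => /andP[_ bd] /andP[ca _].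
by rewrite (le_trans ca)//= (le_trans zb).
Qed.

Lemma relevant_values_next i v : relevant_values N xi F u0 i v ->
  relevant_values N xi F u0 i.+1 (inverse_fun (F i.+1) (F i v)).
Proof.
move=> hv; apply: sub_gen_smallest; right.
by exists (F i v) => //; exists v.
Qed.

Hypothesis u0_int : mu.-integrable setT (EFin \o u0).

(** An average lies between the essential bounds.  The two impossible cases, an
    infinite bound on the wrong side, would make [u0] infinite on the cell. *)
Lemma average_relevant i y dx : 0 < dx ->
  (forall x, y < x < y + dx -> x \in subdomain N xi i) ->
  relevant_values N xi F u0 i (average u0 y dx).
Proof.
move=> dx0 sub.
suff h : essential_range_hull (subdomain N xi i) u0 (average u0 y dx).
  by case: i sub h => [//|i] sub h; apply: sub_gen_smallest; left.
have restr (Q : R -> Prop) :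
    {ae mrestr mu (measurable_itv (subdomain N xi i)), forall x, Q x} ->
    {ae mu, forall x, y < x < y + dx -> Q x}.
  move=> [Z [mZ Z0 QZ]]; exists (Z `&` [set` subdomain N xi i]); split => //.
    by apply: measurableI => //; exact: measurable_itv.
  move=> x /= /not_implyP[yx nQ]; split; first by apply: QZ.
  exact: sub.
split; rewrite leNgt; apply/negP.
  set e := ess_inf _ _ => le.
  have he := @ess_inf_le _ _ _ (mrestr mu (measurable_itv (subdomain N xi i))) (EFin \o u0).
  case E : e le he => [r| |]; rewrite -/e ?E // ?lte_fin => le he.
    suff : r <= average u0 y dx by rewrite leNgt le.
    apply: (average_ge u0_int dx0); apply: restr; move: he.
    by apply: ae_imply => x; rewrite /= lee_fin.
  suff : average u0 y dx + 1 <= average u0 y dx by lra.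
  apply: (average_ge u0_int dx0); apply: restr; move: he.
  by apply: ae_imply => x; rewrite /= leye_eq.
set e := ess_sup _ _ => le.
have he := @ess_sup_ge _ _ _ (mrestr mu (measurable_itv (subdomain N xi i))) (EFin \o u0).
case E : e le he => [r| |]; rewrite -/e ?E // ?lte_fin => le he.
  suff : average u0 y dx <= r by rewrite leNgt le.
  apply: (average_le u0_int dx0); apply: restr; move: he.
  by apply: ae_imply => x; rewrite /= lee_fin.
suff : average u0 y dx <= average u0 y dx - 1 by lra.
apply: (average_le u0_int dx0); apply: restr; move: he.
by apply: ae_imply => x; rewrite /= leeNy_eq.
Qed.

End RelevantValues.

Section GridGeometry.
Context {R : realType}.
Variables (N : nat) (xi : nat -> R) (a dx : R) (P : nat -> int).
Hypothesis dx_gt0 : 0 < dx.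
Hypothesis xi_lt : forall i, (0 < i < N)%N -> xi i < xi i.+1.
Hypothesis aligned : forall i, (0 < i <= N)%N -> xi i = grid_point a dx (P i).
Local Notation gp := (grid_point a dx).
Local Notation dom := (dom N P).

Lemma grid_point_le j j' : (gp j <= gp j') = (j <= j').
Proof. by rewrite lerD2l ler_pM2r// ler_int. Qed.

Lemma grid_point_lt j j' : (gp j < gp j') = (j < j').
Proof. by rewrite ltrD2l ltr_pM2r// ltr_int. Qed.

Lemma grid_pointS j : gp (j + 1) = gp j + dx.
Proof. by rewrite /grid_point intrD mulrDl mul1r addrA. Qed.

Lemma aligned_lt i : (0 < i < N)%N -> P i < P i.+1.
Proof.
move=> /andP[i0 iN]; rewrite -grid_point_lt -!aligned ?i0 ?iN ?(ltnW iN)//.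
by rewrite xi_lt// i0 iN.
Qed.

Lemma cell_in_subdomain j x : gp j < x < gp (j + 1) -> x \in subdomain N xi (dom j).
Proof.
move=> /andP[jx xj]; have /and3P[iN h1 h2] := domP N P j.
rewrite in_itv /=; apply/andP; split.
  case: ifP => // i0; rewrite /= aligned ?i0//.
  by apply: le_lt_trans jx; rewrite grid_point_le; exact: implyP h1 i0.
case: ifP => // i0; rewrite /= aligned ?i0//.
apply: lt_le_trans xj _; rewrite grid_point_le.
by have := implyP h2 i0; rewrite lezD1.
Qed.

Lemma subdomain_lt_interface i x : (i < N)%N -> x \in subdomain N xi i -> x < xi i.+1.
Proof. by rewrite in_itv /= => -> /andP[]. Qed.

Lemma subdomain_gt_interface i x : (0 < i)%N -> x \in subdomain N xi i -> xi i < x.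
Proof. by rewrite in_itv /= => -> /andP[]. Qed.

Lemma dom_of_point i j x : (i <= N)%N -> x \in subdomain N xi i ->
  gp j <= x < gp (j + 1) -> dom j = i.
Proof.
move=> iN xi_ /andP[jx xj]; apply: (dom_eq aligned_lt); apply/and3P; split => //.
  apply/implyP => i0; have := subdomain_gt_interface i0 xi_.
  rewrite aligned ?i0// => h; have := lt_trans h xj.
  by rewrite grid_point_lt ltzD1.
apply/implyP => i0; have := subdomain_lt_interface i0 xi_.
by rewrite aligned// => h; have := le_lt_trans jx h; rewrite grid_point_lt.
Qed.

(** The smoothing is one-sided: a point of the subdomain [i] only feels cells on
    its right or its own, so an interface at the left end of such a cell, or
    between the point and the cell, is within reach. *)
Lemma near_interface_point i j x eps : (i <= N)%N -> x \in subdomain N xi i ->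
  iface N P j || (dom j != i) -> gp j - eps < x < gp (j + 1) ->
  exists2 l, (l < N)%N & xi l.+1 - eps <= x <= xi l.+1 + dx.
Proof.
move=> iN xi_ bad /andP[jx xj]; have /and3P[dN h1 h2] := domP N P j.
rewrite grid_pointS in xj.
have use l : (l < N)%N -> xi l.+1 <= gp j -> x <= xi l.+1 + dx ->
    exists2 l, (l < N)%N & xi l.+1 - eps <= x <= xi l.+1 + dx.
  move=> lN le1 le2; exists l => //; rewrite le2 andbT.
  by apply: le_trans (ltW jx); rewrite lerD2r.
have [/andP[d0 /eqP jP]|nj] := boolP (iface N P j).
  have e : xi (dom j) = gp j by rewrite {2}jP aligned ?d0.
  have := use (dom j).-1; rewrite prednK// e => h.
  by apply: h => //; rewrite ltW.
move: bad; rewrite (negbTE nj) /= => di.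
have [id|di'] := ltnP i (dom j).
  have iN' := leq_trans id dN; apply: (use i) => //.
    rewrite aligned ?iN'// grid_point_le.
    apply: le_trans (implyP h1 (leq_ltn_trans (leq0n _) id)).
    by apply: (P_mono aligned_lt); rewrite // id.
  by rewrite (le_trans (ltW (subdomain_lt_interface iN' xi_)))// lerDl ltW.
have lt_di : (dom j < i)%N by rewrite ltn_neqAle di.
exfalso; have i0 : (0 < i)%N by apply: leq_ltn_trans lt_di.
have := subdomain_gt_interface i0 xi_; apply/negP; rewrite -leNgt.
apply: le_trans (ltW xj) _; rewrite -grid_pointS aligned ?i0// grid_point_le.
have dN' := leq_trans lt_di iN; have := implyP h2 dN'; rewrite -lezD1 => jP.
by apply: (le_trans jP); apply: (P_mono aligned_lt); rewrite // lt_di.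
Qed.

Lemma dom_far_left : exists j0 : int, forall j, j <= j0 -> dom j = 0%N.
Proof.
have [N0|N0] := posnP N.
  exists 0 => j _; apply/eqP; rewrite -leqn0 -N0; exact: dom_leN.
exists (P 1%N - 1) => j jP; apply: (dom_eq aligned_lt); apply/and3P; split => //.
by apply/implyP => _; move: jP; lia.
Qed.

Lemma subdomain_cover x : (forall i, (0 < i <= N)%N -> x != xi i) ->
  exists2 i, (i <= N)%N & x \in subdomain N xi i.
Proof.
move=> nx; pose j := Num.floor ((x - a) / dx).
have jx : gp j <= x < gp (j + 1).
  rewrite /grid_point -!lerBrDl -?ltrBlDl -ler_pdivlMr// -ltr_pdivrMr//.
  by rewrite floor_le /= floorD1_gt.
have [e|ne] := eqVneq x (gp j); last first.
  exists (dom j); first exact: dom_leN.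
  apply: cell_in_subdomain; case/andP: jx => h1 h2.
  by rewrite lt_neqAle eq_sym ne h1 h2.
have /and3P[iN h1 h2] := domP N P j; exists (dom j) => //.
rewrite in_itv /=; apply/andP; split.
  case: ifP => // i0; rewrite /= lt_neqAle eq_sym nx ?i0//=.
  rewrite aligned ?i0// (le_trans _ (proj1 (andP jx)))// grid_point_le.
  exact: implyP h1 i0.
case: ifP => // i0; rewrite /= aligned// e grid_point_lt; exact: implyP h2 i0.
Qed.

End GridGeometry.

(** * The solution far to the left *)
Section LeftTail.
Context {R : realType}.
Local Notation mu := (@lebesgue_measure R).
Local Notation mm := (mu \x mu)%E.
Variables (T : R) (u : R -> R -> R).
Local Notation S := (`]0, T[%classic : set R).
Hypotheses (T_gt0 : 0 < T).
Hypothesis u_cont : continuous_L1 T u.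
Hypothesis u_meas : measurable_fun (setT `*` S) (fun z : R * R => u z.1 z.2).
Variable B : R.
Hypothesis B_ge0 : 0 <= B.
Hypothesis u_bound : {ae mm, forall z : R * R, 0 < z.2 < T -> `|u z.1 z.2| <= B}.

Let u_int t : 0 <= t <= T -> mu.-integrable setT (EFin \o (u ^~ t)).
Proof. by case: u_cont => h _ /h /Lfun1_integrable. Qed.

Let phi t : R := \int[mu]_x `|u x t|.

Let phi_dist s t : 0 <= s <= T -> 0 <= t <= T ->
  (`|phi s - phi t|%:E <= 'N[mu]_1[(fun x => (u x s - u x t)%:E)])%E.
Proof.
move=> hs ht; rewrite Lnorm1.
have is_ := u_int hs; have it := u_int ht.
have ist : mu.-integrable setT (EFin \o (fun x => u x s - u x t)).
  by have := integrableB measurableT is_ it; apply: eq_integrable.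
have n1 := integrable_norm is_; have n2 := integrable_norm it.
have n3 := integrable_norm ist.
have E : (\int[mu]_x `|(u x s - u x t)%:E|)%E = (\int[mu]_x `|u x s - u x t|)%:E.
  by rewrite /Rintegral fineK//; apply: integrable_fin_num.
rewrite E lee_fin /phi -RintegralB//.
apply: le_trans (le_normr_Rintegral _ _) _ => //.
  by have := integrableB measurableT n1 n2; apply: eq_integrable.
apply: le_Rintegral => //.
  have h := integrableB measurableT n1 n2.
  have : mu.-integrable setT (EFin \o (fun x => `|u x s| - `|u x t|)).
    by move: h; apply: eq_integrable.
  exact: integrable_norm.
by move=> x _; exact: ler_dist_dist.
Qed.

(** Continuity of [u] in time with values in L1 makes its norm continuous on the
    compact interval. *)
Let phi_bounded : exists C : R, forall t, 0 <= t <= T -> phi t <= C.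
Proof.
have c : {within `[0, T], continuous phi}.
  apply/subspace_continuousP => t; rewrite /= in_itv /= => ht.
  apply/(@cvgrPdist_le _ _ _ (within `[0, T] (nbhs t))) => e e0.
  have [_ /(_ t ht)] := u_cont.
  move=> /fine_cvgP[fin /(@cvgrPdist_le _ _ _ (within `[0, T] (nbhs t))) /(_ e e0) cv].
  near=> s.
  have hs : 0 <= s <= T.
    have : `[0, T]%classic s by near: s; exact: near_withinT.
    by rewrite /= in_itv.
  have fs : ('N[mu]_1[(fun x => (u x s - u x t)%:E)])%E \is a fin_num.
    by near: s; exact: fin.
  have cs : `|0 - fine ('N[mu]_1[(fun x => (u x s - u x t)%:E)])%E| <= e.
    by near: s; exact: cv.
  rewrite distrC; apply: le_trans cs; rewrite sub0r normrN.
  have := phi_dist hs ht; rewrite -(fineK fs) lee_fin => h.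
  exact: le_trans (ler_norm _).
have [d _ hd] := EVT_max (ltW T_gt0) c.
by exists (phi d) => t ht; apply: hd; rewrite in_itv.
Unshelve. all: by end_near. Qed.

Lemma solution_strip_integrable : strip_integrable T setT u.
Proof.
have [C hC] := phi_bounded.
have mTS : measurable (setT `*` S : set (R * R)) by exact: measurableX.
pose g := (fun z : R * R => (u z.1 z.2)%:E) \_ (setT `*` S).
have [_ h] := @integrable_mkcond _ _ _ mm (setT `*` S) (fun z : R * R => (u z.1 z.2)%:E) mTS.
apply: h; rewrite -/g.
have mg : measurable_fun setT g.
  apply/(measurable_restrict _ _ measurableT) => //; rewrite ?setTI ?setIT//.
  exact/measurable_EFinP.
apply/(integrable21ltyP mu mu mg).
apply: (@le_lt_trans _ _ (\int[mu]_(t in S) C%:E)%E).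
  rewrite [leRHS]integral_mkcond; apply: ge0_le_integral => //.
  - by move=> t _; apply: integral_ge0.
  - have mag : measurable_fun setT (abse \o g) by exact: measurableT_comp.
    exact: (@measurable_fun_fubini_tonelli_G _ _ _ _ R mu (abse \o g) mag (fun z => abse_ge0 _)).
  - apply/(measurable_restrict _ _ measurableT) => //.
  - move=> t _; rewrite [in leRHS]/patch; case: ifPn => tS.
      rewrite [leLHS](_ : _ = (\int[mu]_x `|u x t|%:E)%E); last first.
        apply: eq_integral => x _; rewrite /g /patch mem_set//; split => //=.
        by move: tS; rewrite inE.
      have ht : 0 <= t <= T.
        by move: tS; rewrite inE /= in_itv /= => /andP[/ltW -> /ltW ->].
      have := hC t ht; rewrite -lee_fin /phi /Rintegral fineK//.
      apply: integrable_fin_num => //; exact: (integrable_norm (u_int ht)).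
    rewrite integral0_eq// => x _; rewrite /g /patch memNset ?abse0// => -[_ /= tS'].
    by move: tS; rewrite notin_setE.
rewrite integral_cst; last exact: measurable_itv.
rewrite [X in (_ * X)%E](_ : _ = T%:E) ?ltry//.
transitivity (mu S); first by [].
by rewrite lebesgue_measure_itv /= lte_fin T_gt0 oppr0 adde0.
Qed.

Variables (alpha : R) (G : R -> R).
Hypotheses (alpha_gt0 : 0 < alpha) (G_reg : regular_increasing alpha G).

(** A flux of class C^1 need not be globally Lipschitz; the bound [B] on [u]
    makes the local constant enough. *)
Let G_lip : exists2 C : R, 0 <= C & forall v, `|v| <= B -> `|G v - G 0| <= C * `|v|.
Proof.
have cG : {within `[- B, B], continuous (derive1 G)}.
  by apply: continuous_subspaceT; case: G_reg.
have BB : - B <= B by rewrite (le_trans _ B_ge0)// oppr_le0.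
have [c _ hc] := EVT_max BB cG.
have d0 x : 0 <= derive1 G x by case: G_reg => _ _ h; rewrite (le_trans (ltW alpha_gt0)).
exists (derive1 G c) => // v; rewrite ler_norml => /andP[Bv vB].
have aux x y : - B <= y -> y <= x -> x <= B -> `|G x - G y| <= derive1 G c * `|x - y|.
  move=> By yx xB; have [z /andP[yz zx] ->] := flux_MVT G_reg yx.
  rewrite normrM ger0_norm// ler_wpM2r// hc// in_itv /=.
  by rewrite (le_trans By)// (le_trans zx).
have [v0|v0] := leP 0 v.
  by have := aux v 0; rewrite subr0; apply => //; rewrite oppr_le0.
by have := aux 0 v; rewrite sub0r normrN distrC; apply => //; exact: ltW.
Qed.

(** Controls the flux entering the window at its left end [y]. *)
Lemma flux_left_tail (eps eta : R) : 0 < eps -> 0 < eta -> exists Y : R, forall y, y <= Y ->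
  strip_integral T setT (fun x t => `|G (u x t) - G 0| * (ind (y - eps) y x * ind 0 T t)) <= eta.
Proof.
move=> eps0 eta0; have [C C0 hC] := G_lip.
have C1 : 0 < C + 1 by rewrite ltr_wpDl.
have mTS : measurable (setT `*` S : set (R * R)) by exact: measurableX.
have mfst : measurable_fun (setT `*` S) (fst : R * R -> R).
  by apply: measurable_funTS; exact: measurable_fst.
have ui : mm.-integrable (setT `*` S) (EFin \o (fun z : R * R => u z.1 z.2)).
  exact: solution_strip_integrable.
have [k [ik hk]] := @left_tail_integral _ _ R mm (setT `*` S) _ fst (eta / (C + 1))
  mTS mfst ui (divr_gt0 eta0 C1).
exists (- k%:R) => y yk; rewrite /strip_integral.
pose f (z : R * R) : R := `|u z.1 z.2| * \1_(`]-oo, (- k%:R)]%classic) z.1.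
have iCf : mm.-integrable (setT `*` S) (EFin \o (fun z => (C + 1) * f z)).
  exact: (@integrableZl _ _ _ mm _ mTS (C + 1) (EFin \o f)).
have le_ae : {ae mm, forall z : R * R, (setT `*` S) z ->
    `|G (u z.1 z.2) - G 0| * (ind (y - eps) y z.1 * ind 0 T z.2) <= (C + 1) * f z}.
  move: u_bound; apply: ae_imply => z hz [_ /= zS].
  have {}hz : `|u z.1 z.2| <= B by apply: hz; move: zS; rewrite in_itv.
  have f0 : 0 <= f z by rewrite /f mulr_ge0.
  have -> : ind 0 T z.2 = 1.
    by rewrite ind1//; move: zS; rewrite in_itv /= => /andP[/ltW -> /ltW ->].
  rewrite mulr1 /ind; case: (boolP (_ <= z.1 <= _)) => [/andP[_ zy]|_]; last first.
    by rewrite mulr0 mulr_ge0// ltW.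
  rewrite mulr1 /f indicE mem_set ?mulr1; last by rewrite /= in_itv /= (le_trans zy).
  by apply: le_trans (hC _ hz) _; rewrite ler_wpM2r// lerDl.
have mG : measurable_fun setT G.
  by apply: continuous_measurable_fun; exact: (flux_continuous G_reg).
have mi : measurable_fun (setT `*` S)
    (fun z : R * R => `|G (u z.1 z.2) - G 0| * (ind (y - eps) y z.1 * ind 0 T z.2)).
  apply: measurable_funM.
    apply: measurableT_comp => //; apply: measurable_funB => //.
    exact: measurableT_comp.
  apply: measurable_funM.
    by apply: measurableT_comp => //; case: (bs_ind (y - eps) y).
  apply: measurableT_comp; first by case: (bs_ind 0 T).
  by apply: measurable_funTS; exact: measurable_snd.
have ii : mm.-integrable (setT `*` S)
    (EFin \o (fun z : R * R => `|G (u z.1 z.2) - G 0| * (ind (y - eps) y z.1 * ind 0 T z.2))).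
  apply: (@ae_le_Rintegrable _ _ _ mm _ mTS _ _ mi iCf).
  move: le_ae; apply: ae_imply => z h Dz; apply: le_trans (h Dz).
  by rewrite ger0_norm// mulr_ge0// mulr_ge0 ?ind_ge0.
apply: le_trans (@ae_le_Rintegral _ _ _ mm _ _ _ mTS ii iCf le_ae) _.
rewrite (@RintegralZl _ _ _ mm _ f (C + 1) mTS ik).
by rewrite mulrC -ler_pdivlMr.
Qed.

End LeftTail.

(** * The estimate on a fixed grid *)
Lemma int_above (L j : int) : L + 1 <= j -> exists n : nat, j = L + n.+1%:Z.
Proof.
move=> Lj; have d0 : 0 <= j - (L + 1) by rewrite subr_ge0.
exists (absz (j - (L + 1))%R).
by rewrite -addn1 PoszD gez0_abs//; ring.
Qed.

Lemma next_cell (L : int) (k : nat) : L + k.+1%:Z = L + k%:Z + 1.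
Proof. by rewrite -[k.+1]addn1 PoszD addrA. Qed.

Section FixedGrid.
Context {R : realType}.
Local Notation mu := (@lebesgue_measure R).
Local Notation mm := (mu \x mu)%E.
Variables (T : R) (N : nat) (xi : nat -> R) (F : nat -> R -> R) (alpha lambda : R)
  (u0 : R -> R) (u : R -> R -> R).
Local Notation S := (`]0, T[%classic : set R).
Local Notation g i := (inverse_fun (F i)).
Local Notation D i := ([set` subdomain N xi i] : set R).
Hypotheses (T_gt0 : 0 < T) (alpha_gt0 : 0 < alpha) (lambda_gt0 : 0 < lambda).
Hypothesis F_reg : forall i, (i <= N)%N -> regular_increasing alpha (F i).
Hypothesis u0_L1 : u0 \in Lfun mu 1%E.
Hypothesis u_sol : entropy_solution T N xi F u0 u.
Hypothesis u_CFL : CFL N xi F u0 lambda.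
Hypothesis xi_lt : forall i, (0 < i < N)%N -> xi i < xi i.+1.
Variables (h : R -> R) (TVh : R).
Hypothesis h_ae : {ae mu, forall x, u0 x = h x}.
Hypothesis h_BV : forall a b, a <= b -> (total_variation a b h <= TVh%:E)%E.
Variables (a dx dt : R) (M : nat) (P : nat -> int) (U : nat -> int -> R).
Hypotheses (dx_gt0 : 0 < dx) (dt_gt0 : 0 < dt) (dt_def : dt = lambda * dx).
Hypothesis T_def : T = M.+1%:R * dt.
Hypothesis aligned : forall i, (0 < i <= N)%N -> xi i = grid_point a dx (P i).
Hypothesis U_scheme : upwind_scheme N F u0 lambda a dx P U.
Local Notation gp := (grid_point a dx).
Local Notation dom := (dom N P).
Local Notation iface := (iface N P).
Local Notation q := (flux_val N F P U).
Local Notation J := (relevant_values N xi F u0).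

Let u0_int : mu.-integrable setT (EFin \o u0).
Proof. exact/Lfun1_integrable. Qed.

Let P_lt := aligned_lt dx_gt0 xi_lt aligned.

Let J_conv i v w z : (i <= N)%N -> J i v -> J i w -> v <= z <= w -> J i z.
Proof. by move=> _; exact: relevant_values_convex. Qed.

Let J_CFL i v : (i <= N)%N -> J i v -> lambda * derive1 (F i) v <= 1.
Proof. exact: u_CFL. Qed.

Let J_next i v : (i < N)%N -> J i v -> J i.+1 (inverse_fun (F i.+1) (F i v)).
Proof. by move=> _; exact: relevant_values_next. Qed.

Lemma scheme_initial j : U 0%N j = average u0 (gp j) dx.
Proof. by case: U_scheme => -> _ _; rewrite /average grid_pointS. Qed.

Let U_init j : J (dom j) (U 0%N j).
Proof.
rewrite scheme_initial; apply: average_relevant => // x.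
by rewrite -grid_pointS; exact: cell_in_subdomain.
Qed.

Let U_step n i j : (i <= N)%N -> between_interfaces N P i j ->
  U n.+1 j = U n j - lambda * (F i (U n j) - F i (U n (j - 1))).
Proof. by case: U_scheme => _ h' _; exact: h'. Qed.

Let U_iface n i : (0 < i <= N)%N ->
  U n.+1 (P i) = inverse_fun (F i) (F i.-1 (U n.+1 (P i - 1))).
Proof. by case: U_scheme => _ _ h'; exact: h'. Qed.

Let q_iface := @flux_val_iface R N F alpha P U alpha_gt0 F_reg P_lt U_iface.

Let q_variation := @flux_val_variation R N F alpha lambda J P U alpha_gt0
  lambda_gt0 F_reg J_conv J_CFL J_next P_lt U_init U_step U_iface.

Let q_time_step := @flux_val_time_step R N F alpha lambda J P U alpha_gt0
  lambda_gt0 F_reg J_conv J_CFL J_next P_lt U_init U_step U_iface.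

Let q_entropy := @scheme_entropy R N F alpha lambda J P U alpha_gt0
  lambda_gt0 F_reg J_conv J_CFL J_next P_lt U_init U_step U_iface.

Let TVh_ge0 : 0 <= TVh.
Proof. by have := h_BV (lexx 0); rewrite total_variationxx lee_fin. Qed.

(** A function of bounded variation is bounded; the initial cell values inherit
    the bound. *)
Definition sup_bound : R := `|h 0| + TVh.

Definition flux_bound : R := \sum_(i < N.+1) (`|F i sup_bound| + `|F i (- sup_bound)|).

Lemma h_bounded x : `|h x| <= sup_bound.
Proof.
have [x0|x0] := leP 0 x.
  have hx : `|h x - h 0| <= TVh.
    apply: le_trans (variation_le h_BV x0).
    by apply: (variation_dist h_BV); rewrite ?lexx ?x0.
  have -> : h x = h 0 + (h x - h 0) by ring.
  by apply: le_trans (ler_normD _ _) _; rewrite lerD2l.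
have hx : `|h x - h 0| <= TVh.
  apply: le_trans (variation_le h_BV (ltW x0)).
  by apply: (variation_dist h_BV); rewrite ?lexx ?(ltW x0).
have -> : h x = h 0 + (h x - h 0) by ring.
by apply: le_trans (ler_normD _ _) _; rewrite lerD2l.
Qed.

Lemma scheme_initial_bounded j : `|U 0%N j| <= sup_bound.
Proof.
rewrite scheme_initial -[X in `|X|]subr0; apply: (average_dist u0_int dx_gt0).
by move: h_ae; apply: ae_imply => x -> _; rewrite subr0; exact: h_bounded.
Qed.

Lemma flux_bound_ge i v : (i <= N)%N -> `|v| <= sup_bound -> `|F i v| <= flux_bound.
Proof.
move=> iN hv; have := flux_bounded alpha_gt0 F_reg 0 iN hv; rewrite !subr0 => h1.
apply: (le_trans h1); rewrite /flux_bound.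
have iN1 : (i < N.+1)%N by [].
rewrite (bigD1 (Ordinal iN1)) //= lerDl; apply: sumr_ge0 => j _.
by rewrite addr_ge0.
Qed.

Lemma grid_far_left y : exists j0 : int, forall j : int, j <= j0 -> gp j <= y.
Proof.
exists (Num.floor ((y - a) / dx)) => j hj.
rewrite /grid_point -lerBrDl -ler_pdivlMr//.
by apply: le_trans (floor_le _); rewrite ler_int.
Qed.

(** Induction on the level.  Initially this is integrability of [u0]; a time step
    on the left subdomain moves the flux value by at most the spatial jump, so
    the deviation at most triples. *)
Lemma flux_far_left_level n e : 0 < e ->
  exists j0 : int, forall j : int, j <= j0 -> `|q n j - F 0%N 0| <= e.
Proof.
have [jd hd] := dom_far_left dx_gt0 xi_lt aligned.
elim: n e => [|n IH] e e0.
  have /cvgrPdist_le /(_ e e0) := @flux_continuous _ _ _ (F_reg (leq0n N)) 0.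
  move=> /nbhs_ballP[d /= d0 hF].
  have d2 : 0 < d / 2 by rewrite divr_gt0.
  have [Y hY] := average_far_left u0_int dx_gt0 d2.
  have [j1 h1] := grid_far_left (Y - dx).
  exists (Num.min jd j1) => j; rewrite le_min => /andP[jjd jj1].
  rewrite /flux_val hd// distrC; apply: hF; rewrite -ball_normE /= sub0r normrN scheme_initial.
  apply: (@le_lt_trans _ _ (d / 2)); last by rewrite ltr_pdivrMr// ltr_pMr// ltr1n.
  by apply: hY; rewrite -lerBrDr; exact: h1.
have [j1 h1] := IH _ (divr_gt0 e0 (ltr0n R 3)).
exists (Num.min jd j1) => j; rewrite le_min => /andP[jjd jj1].
have nj : ~~ iface j by rewrite /iface hd.
have := q_time_step n nj; have := h1 _ jj1.
have jj : j - 1 <= j1 by apply: le_trans jj1; rewrite gerBl.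
have := h1 _ jj; set A := q n.+1 j; set B := q n j; set C := q n (j - 1); set c := F 0%N 0.
move=> hC hB hA.
have -> : A - c = (A - B) + (B - c) by ring.
apply: le_trans (ler_normD _ _) _.
have hBC : `|B - C| <= `|B - c| + `|C - c|.
  have -> : B - C = (B - c) - (C - c) by ring.
  exact: ler_normB.
by lra.
Qed.

Lemma flux_far_left K e : 0 < e -> exists j0 : int, forall n (j : int),
  (n <= K)%N -> j <= j0 -> `|q n j - F 0%N 0| <= e.
Proof.
move=> e0; elim: K => [|K [j1 h1]].
  have [j0 h0] := flux_far_left_level 0 e0.
  by exists j0 => n j; rewrite leqn0 => /eqP -> /h0.
have [j2 h2] := flux_far_left_level K.+1 e0.
exists (Num.min j1 j2) => n j; rewrite le_min leq_eqVlt => /orP[/eqP ->|nK] /andP[l1 l2].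
  exact: h2.
exact: h1.
Qed.

Definition final_state (x : R) : R := numerical_solution a dx dt U x T.

Lemma final_state_cell j x : gp j <= x < gp (j + 1) -> final_state x = U M.+1 j.
Proof.
move=> jx; rewrite /final_state /numerical_solution T_def mulfK ?gt_eqF// natrK.
congr (U _ _); apply: floor_def; move: jx; rewrite /grid_point.
by rewrite -!lerBrDl -?ltrBlDl -ler_pdivlMr// -ltr_pdivrMr.
Qed.

Lemma grid_cell_of x : exists j : int, gp j <= x < gp (j + 1).
Proof.
exists (Num.floor ((x - a) / dx)).
rewrite /grid_point -!lerBrDl -?ltrBlDl -ler_pdivlMr// -ltr_pdivrMr//.
by rewrite floor_le /= floorD1_gt.
Qed.

Lemma measurable_final_state : measurable_fun setT final_state.
Proof.
move=> _ Y mY; rewrite setTI.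
have -> : final_state @^-1` Y = \bigcup_(j : int)
    (if `[< Y (U M.+1 j) >] then `[gp j, gp (j + 1)[%classic else set0).
  apply/seteqP; split => x /=.
    have [j hj] := grid_cell_of x; rewrite (final_state_cell hj) => Yj.
    by exists j => //; rewrite asboolT//= in_itv.
  move=> [j _]; case: ifPn => [/asboolP Yj|//].
  by rewrite /= in_itv /= => /final_state_cell ->.
apply: countable_bigcupT_measurable => [|j]; first exact: countableP.
by case: ifP => _; [exact: measurable_itv|exact: measurable0].
Qed.

Let uT_L1 : u^~ T \in Lfun mu 1%E.
Proof. by case: u_sol => -[h1 _] _ _; apply: h1; rewrite lexx ltW. Qed.

Lemma measurable_error : measurable_fun setT (fun x => u x T - final_state x).
Proof.
have /Lfun1_integrable iv := uT_L1.
apply: measurable_funB measurable_final_state.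
by apply/measurable_EFinP; exact: (measurable_int mu iv).
Qed.

Section Window.
Variables (L : int).
(** Cells are renumbered from [L]: number [0] is the left neighbour of the window,
    whose cells have the numbers [1, ..., m]. *)
Definition cell_point (k : nat) : R := gp (L + k%:Z).
Definition time_point (n : nat) : R := n%:R * dt.
Definition cell_flux (k n : nat) : R := q n (L + k%:Z).
Definition cell_iface (k : nat) : bool := iface (L + k.+1%:Z).
Local Notation X := cell_point.
Local Notation tn := time_point.
Local Notation p := cell_flux.

Lemma cell_pointS k : X k.+1 = X k + dx.
Proof. by rewrite /cell_point intS (addrC 1) addrA grid_pointS. Qed.

Lemma time_pointS n : tn n.+1 = tn n + dt.
Proof. by rewrite /time_point -natr1 mulrDl mul1r. Qed.

Let pred_cell k : L + k.+1%:Z - 1 = L + k%:Z.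
Proof. lia. Qed.

Lemma iface_count m : \sum_(k < m) (cell_iface k)%:R <= N%:R :> R.
Proof.
apply: (@le_trans _ _ (\sum_(k < m) \sum_(i < N) (L + k.+1%:Z == P i.+1)%:R)).
  apply: ler_sum => k _; rewrite /cell_iface /iface.
  have := dom_leN N P (L + k.+1%:Z).
  case: (dom (L + k.+1%:Z)) => [|d] dN /=; first by apply: sumr_ge0.
  rewrite (bigD1 (Ordinal dN)) //= lerDl; exact: sumr_ge0.
rewrite exchange_big /=.
have -> : N%:R = \sum_(i < N) (1 : R) by rewrite sumr_const card_ord.
apply: ler_sum => i _; elim: m => [|m IH]; first by rewrite big_ord0.
rewrite big_ord_recr /=; have [e|_] := eqVneq (L + m.+1%:Z) (P i.+1); last by rewrite addr0.
rewrite big1 ?add0r// => k _; have [e'|//] := eqVneq (L + k.+1%:Z) (P i.+1).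
by exfalso; have := ltn_ord k; move: e'; rewrite -e; lia.
Qed.

(** Inside a subdomain the CFL condition bounds a flux jump by [1 / lambda] times
    the jump of the averages; at the [N] interfaces the initial flux values are
    unrelated and only bounded. *)
Definition init_bound : R := lambda^-1 * (2 * TVh) + N%:R * (2 * flux_bound).

Lemma initial_flux_variation m :
  \sum_(k < m) `|p k.+1 0%N - p k 0%N| <= init_bound.
Proof.
apply: (@le_trans _ _ (\sum_(k < m)
  (lambda^-1 * `|average u0 (X k.+1) dx - average u0 (X k) dx|
   + (cell_iface k)%:R * (2 * flux_bound)))).
  apply: ler_sum => k _; rewrite /cell_flux /flux_val /cell_iface.
  set j := L + k.+1%:Z; have jk : L + k%:Z = j - 1 by rewrite /j pred_cell.
  have [ij|nj] := boolP (iface j); last first.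
    rewrite mul0r addr0 jk (dom_pred P_lt nj) /cell_point -!scheme_initial -/j jk.
    rewrite -ler_pdivrMl ?invr_gt0// invrK.
    apply: (flux_CFL alpha_gt0 (F_reg (dom_leN N P j)) (J := J (dom j))) => //.
    - by move=> v w z; apply: J_conv; exact: dom_leN.
    - by move=> v; apply: J_CFL; exact: dom_leN.
    - by rewrite -(dom_pred P_lt nj); exact: U_init.
  rewrite mul1r; apply: (@le_trans _ _ (2 * flux_bound)).
    apply: le_trans (ler_normB _ _) _.
    rewrite [2](_ : _ = 1 + 1)// mulrDl mul1r.
    by apply: lerD; apply: flux_bound_ge; rewrite ?dom_leN ?scheme_initial_bounded.
  by rewrite lerDr mulr_ge0 ?invr_ge0 // ltW.
rewrite big_split /= -mulr_sumr -mulr_suml; apply: lerD.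
  rewrite ler_wpM2l ?invr_ge0 ?(ltW lambda_gt0)//.
  exact: (average_variation u0_int h_ae h_BV dx_gt0 cell_pointS).
rewrite ler_wpM2r ?iface_count//; rewrite mulr_ge0//.
by apply: sumr_ge0 => i _; rewrite addr_ge0.
Qed.

Variables (m K1 : nat) (eta : R).
Let K := (M.+1 + K1)%N.
Hypothesis base_left : dom (L + 1) = 0%N.
Hypothesis base_flux : forall n, (n <= K)%N -> `|p 0%N n - F 0%N 0| <= eta.
Hypothesis base_time : \sum_(n < K) `|p 0%N n.+1 - p 0%N n| <= 1.

Definition var_bound : R := init_bound + 1.
Local Notation V := var_bound.

Lemma var_bound_ge0 : 0 <= V.
Proof.
have fb : 0 <= flux_bound by apply: sumr_ge0 => i _; rewrite addr_ge0.
have li : 0 <= lambda^-1 by rewrite invr_ge0 ltW.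
rewrite /var_bound addr_ge0// /init_bound; apply: addr_ge0.
  by rewrite mulr_ge0// mulr_ge0.
by rewrite mulr_ge0// mulr_ge0.
Qed.

Let p_step k n : `|p k.+1 n.+1 - p k n.+1| + `|p k.+1 n.+1 - p k.+1 n|
  <= `|p k.+1 n - p k n| + `|p k n.+1 - p k n|.
Proof. by have := q_variation n (L + k.+1%:Z); rewrite pred_cell. Qed.

Let p_var k n : (n <= K)%N ->
  \sum_(l < k) `|p l.+1 n - p l n| + \sum_(l < n) `|p k l.+1 - p k l| <= V.
Proof.
move=> nK; apply: (le_trans (variation_bound p_step k n)).
apply: lerD; first exact: initial_flux_variation.
apply: le_trans base_time.
rewrite (big_ord_widen K (fun l => `|p 0%N l.+1 - p 0%N l|) nK).
by rewrite [X in _ <= X](bigID (fun i : 'I_K => (i < n)%N))/= lerDl sumr_ge0.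
Qed.

Lemma space_variation n : (n <= K)%N -> \sum_(k < m) `|p k.+1 n - p k n| <= V.
Proof.
by move=> nK; apply: le_trans (p_var m nK); rewrite lerDl sumr_ge0.
Qed.

Lemma time_variation k : \sum_(n < K) `|p k.+1 n.+1 - p k.+1 n| <= V.
Proof. by apply: le_trans (p_var k.+1 (leqnn K)); rewrite lerDr sumr_ge0. Qed.

(** After the initial level the flux value has no jump at an interface. *)
Lemma iface_variation k : (k < m)%N ->
  \sum_(n < K) (cell_iface k)%:R * `|p k.+1 n - p k n| <= V.
Proof.
move=> km; rewrite /cell_iface; have [ij|_] := boolP (iface _); last first.
  by rewrite big1 ?var_bound_ge0// => n _; rewrite mul0r.
rewrite /K addSn big_ord_recl big1 => [|n _].
  rewrite mul1r addr0; apply: le_trans (space_variation (leq0n _)).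
  by rewrite (bigD1 (Ordinal km))//= lerDl sumr_ge0.
by rewrite mul1r /cell_flux /= q_iface// pred_cell subrr normr0.
Qed.

(** On regular cells a time increment is bounded by the spatial jump; each of the
    at most [N] interface cells contributes no more than its own time
    variation. *)
Lemma level_time_variation n : (n < K)%N ->
  \sum_(k < m) `|p k.+1 n.+1 - p k.+1 n| <= (1 + N%:R) * V.
Proof.
move=> nK; apply: (@le_trans _ _ (\sum_(k < m) (`|p k.+1 n - p k n| + (cell_iface k)%:R * V))).
  apply: ler_sum => k _; rewrite /cell_iface.
  have [ij|nj] := boolP (iface _); last first.
    rewrite mul0r addr0; have := q_time_step n nj; by rewrite pred_cell.
  rewrite mul1r; apply: (@le_trans _ _ V); last by rewrite lerDr.
  apply: le_trans (time_variation k).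
  by rewrite (bigD1 (Ordinal nK))//= lerDl sumr_ge0.
rewrite big_split /= -mulr_suml mulrDl mul1r; apply: lerD.
  by apply: space_variation; exact: ltnW.
by rewrite ler_wpM2r ?var_bound_ge0// iface_count.
Qed.

Variables (Hs bs : R -> R) (c1 c2 eps tau : R).
Hypotheses (prof : step_profile Hs bs c1 c2) (eps_gt0 : 0 < eps).
Hypothesis K1_eps : eps <= K1%:R * dt.
Hypothesis eta_ge0 : 0 <= eta.
Hypothesis tail_small : strip_integral T setT (fun x t =>
  `|F 0%N (u x t) - F 0%N 0| * (ind (X 1%N - eps) (X 1%N) x * ind 0 T t)) <= tau.
Local Notation hat := (hat Hs eps).
Local Notation ker := (ker bs eps).

Let time_point0 : tn 0%N = 0. Proof. by rewrite /time_point mul0r. Qed.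
Let time_pointM : tn M.+1 = T. Proof. by rewrite /time_point -T_def. Qed.
Let c1_gt0 := sp_c1 prof.

Let cell_index x : X 1%N <= x ->
  exists k : nat, X k.+1 <= x < X k.+2.
Proof.
have [j hj] := grid_cell_of x => x1.
have Lj : L + 1 <= j.
  have : gp (L + 1) < gp (j + 1) by case/andP: hj => _; apply: le_lt_trans.
  by rewrite (grid_point_lt _ dx_gt0) ltzD1.
have [n en] := int_above Lj.
by exists n; rewrite /cell_point (next_cell L n.+1) -en.
Qed.

Let left_of_base i x : (i <= N)%N -> D i x -> x < X 1%N -> i = 0%N.
Proof.
move=> iN Dx x1; apply/eqP; rewrite -leqn0 leqNgt; apply/negP => i0.
have N0 : (0 < N)%N by apply: leq_trans iN.
have := domP N P (L + 1); rewrite base_left => /and3P[_ _ /implyP /(_ N0) L1].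
have x_gt := subdomain_gt_interface i0 Dx.
have : xi i < X 1%N by apply: lt_trans x1.
rewrite aligned ?i0// /cell_point (grid_point_lt _ dx_gt0) => Pi.
have := P_mono P_lt (i := 1) (i' := i) isT; rewrite i0 iN => /(_ isT) P1.
by have := lt_trans L1 (le_lt_trans P1 Pi); rewrite ltxx.
Qed.

Let g_cell_flux i k n : (i <= N)%N -> dom (L + k%:Z) = i -> g i (p k n) = U n (L + k%:Z).
Proof.
move=> iN di; rewrite /cell_flux /flux_val di.
exact: (inverse_funK alpha_gt0 (F_reg iN)).
Qed.

(** Majorant of the flux through the left end of the window: the solution and the
    scheme are both compared with the flux value [F 0 0] of the state [0]. *)
Definition left_flux (x t : R) : R :=
  c1 / eps * (`|F 0%N (u x t) - F 0%N 0| * (ind (X 1%N - eps) (X 1%N) x * ind 0 T t))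
  + c1 / eps * eta * (ind (X 1%N - eps) (X 1%N) x * ind 0 T t).

Lemma left_flux_ge0 x t : 0 <= left_flux x t.
Proof.
have ce : 0 <= c1 / eps by rewrite divr_ge0 // ltW.
rewrite /left_flux; apply: addr_ge0; apply: mulr_ge0.
- by [].
- by rewrite mulr_ge0 ?normr_ge0// mulr_ge0 ?ind_ge0.
- exact: mulr_ge0.
- by rewrite mulr_ge0 ?ind_ge0.
Qed.

Lemma left_flux_ge i (x t : R) : (i <= N)%N -> D i x -> 0 <= t <= T ->
  \sum_(n < K) `|F i (u x t) - p 0%N n| * (ker X 1%N x * hat tn n t) <= left_flux x t.
Proof.
move=> iN Dx tT.
have ce : 0 <= c1 / eps by rewrite divr_ge0 // ltW.
have lf0 := left_flux_ge0 x t.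
have k0 := ker_ge0 prof eps_gt0 X 1%N x.
have h0 n := hat_ge0 prof eps_gt0 dt_gt0 time_pointS n t.
have [x1|x1] := leP (X 1%N) x.
  by rewrite (ker_eq0 prof eps_gt0) ?big1// => [n _|]; [rewrite mul0r mulr0|right].
have i0 := left_of_base iN Dx x1; rewrite i0.
pose c := `|F 0%N (u x t) - F 0%N 0|.
apply: (@le_trans _ _ (\sum_(n < K) (c + eta) * ker X 1%N x * hat tn n t)).
  apply: ler_sum => n _; have kh := mulr_ge0 k0 (h0 n).
  rewrite -mulrA; apply: ler_wpM2r; first exact: kh.
  have -> : F 0%N (u x t) - p 0%N n = (F 0%N (u x t) - F 0%N 0) - (p 0%N n - F 0%N 0) by ring.
  apply: le_trans (ler_normB _ _) _; rewrite lerD2l base_flux//; exact: ltnW.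
have B1 : \sum_(n < K) hat tn n t <= 1.
  have := hat_sum_le1 eps prof tn 0%N K t.
  by under eq_bigr do rewrite add0n.
have c0 : 0 <= c + eta by exact: (addr_ge0 (normr_ge0 _) eta_ge0).
rewrite -mulr_sumr; apply: (@le_trans _ _ ((c + eta) * ker X 1%N x)).
  by apply: ler_piMr => //; exact: mulr_ge0 c0 k0.
have := ker_ind prof eps_gt0 1%N x dx_gt0 cell_pointS => ki.
apply: (le_trans (ler_wpM2l c0 ki)); rewrite /left_flux (ind1 tT) !mulr1 -/c.
by rewrite le_eqVlt; apply/orP; left; apply/eqP; ring.
Qed.

Let EI := err_interface Hs c1 eps X tn dx lambda N alpha xi m K p cell_iface.
Let EM := err_mismatch c1 c2 eps X tn dx dt lambda m K p.

Definition interior_error : R :=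
  c1 * ((2 / alpha + lambda) * V) * (N%:R * (eps + dx))
  + K%:R * V * cross_const c1 c2 eps dx dt lambda * ((eps + dx) * (eps + dt))
  + (c1 / eps * tau + c1 * eta * T).

Let mS : measurable (setT `*` S : set (R * R)).
Proof. exact: measurableX. Qed.

Let mDiS i : measurable (D i `*` S : set (R * R)).
Proof. by apply: measurableX => //; exact: measurable_itv. Qed.

Let EI_int : mm.-integrable (setT `*` S) (EFin \o (fun z : R * R => EI z.1 z.2)).
Proof.
apply: (tensor_sum_strip_integrable T_gt0 (D := setT)
  (A := fun k n x => near_interface eps dx N xi x * hat X k.+1 x)
  (B := fun k n => ind (tn n.+1 - eps) (tn n.+1))
  (fun k n => cell_defect lambda alpha p cell_iface k n * (c1 / eps))) => //.
  move=> k n; apply: bs_mul; first exact: near_interface_bs.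
  exact: (bs_hat prof eps_gt0 dx_gt0 cell_pointS).
by move=> k n; exact: bs_ind.
Qed.

Let EM_int : mm.-integrable (setT `*` S) (EFin \o (fun z : R * R => EM z.1 z.2)).
Proof.
apply: (tensor_sum_strip_integrable T_gt0 (D := setT)
  (A := fun k n => ind (X k.+1 - eps) (X k.+2))
  (B := fun k n => ind (tn n - eps) (tn n.+1))
  (fun k n => `|p k.+1 n - p k n| * cross_const c1 c2 eps dx dt lambda)) => //.
  by move=> k n; exact: bs_ind.
by move=> k n; exact: bs_ind.
Qed.

Let dev (x t : R) : R :=
  `|F 0%N (u x t) - F 0%N 0| * (ind (X 1%N - eps) (X 1%N) x * ind 0 T t).
Let box (x t : R) : R := ind (X 1%N - eps) (X 1%N) x * ind 0 T t.

Let dev_int : mm.-integrable (setT `*` S) (EFin \o (fun z : R * R => dev z.1 z.2)).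
Proof.
by apply: (flux_deviation_strip_integrable T_gt0 alpha_gt0 F_reg u_sol) => //; exact: bs_ind.
Qed.

Let box_int : mm.-integrable (setT `*` S) (EFin \o (fun z : R * R => box z.1 z.2)).
Proof. by apply: tensor_strip_integrable => //; exact: bs_ind. Qed.

Let cdev_int c : mm.-integrable (setT `*` S) (EFin \o (fun z : R * R => c * dev z.1 z.2)).
Proof. exact: (@integrableZl _ _ _ mm _ mS c _ dev_int). Qed.

Let cbox_int c : mm.-integrable (setT `*` S) (EFin \o (fun z : R * R => c * box z.1 z.2)).
Proof. exact: (@integrableZl _ _ _ mm _ mS c _ box_int). Qed.

Let LF_int : mm.-integrable (setT `*` S) (EFin \o (fun z : R * R => left_flux z.1 z.2)).
Proof.
have := @integrableD _ _ _ mm _ mS _ _ (cdev_int (c1 / eps)) (cbox_int (c1 / eps * eta)).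
by apply: eq_integrable.
Qed.

Let EIM_int : mm.-integrable (setT `*` S)
  (EFin \o (fun z : R * R => EI z.1 z.2 + EM z.1 z.2)).
Proof.
have := @integrableD _ _ _ mm _ mS _ _ EI_int EM_int.
by apply: eq_integrable.
Qed.

Let ALL_int : mm.-integrable (setT `*` S)
  (EFin \o (fun z : R * R => EI z.1 z.2 + EM z.1 z.2 + left_flux z.1 z.2)).
Proof.
have := @integrableD _ _ _ mm _ mS _ _ EIM_int LF_int.
by apply: eq_integrable.
Qed.

Lemma box_integral : strip_integral T setT box <= eps * T.
Proof.
apply: tensor_strip_integral_le => //; try exact: bs_ind.
- by rewrite Rintegral_ind; [rewrite opprB addrC subrK|have := eps_gt0; lra].
- apply: le_trans (Rintegral_ind_le _ _) _ => //; last by rewrite subr0.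
  exact: ltW.
Qed.

Lemma interior_integral_le i : (i <= N)%N ->
  strip_integral T (D i)
    (fun x t => interior_term Hs bs eps X tn F m K p i (u x t) x t) <= interior_error.
Proof.
move=> iN.
have iT := interior_term_integrable T_gt0 alpha_gt0 F_reg u_sol prof eps_gt0
  dx_gt0 dt_gt0 cell_pointS time_pointS m K p iN.
have sub : D i `*` S `<=` setT `*` S by move=> z [_ ?].
have ALLi : mm.-integrable (D i `*` S)
    (EFin \o (fun z : R * R => EI z.1 z.2 + EM z.1 z.2 + left_flux z.1 z.2)).
  exact: (@integrableS _ _ _ mm _ _ _ mS (mDiS i) sub ALL_int).
have EI0 x t : 0 <= EI x t.
  apply: sumr_ge0 => k _; apply: sumr_ge0 => n _.
  have h1 := cell_defect_ge0 lambda_gt0 alpha_gt0 p cell_iface k n.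
  have h2 := near_interface_ge0 eps dx N xi x.
  have h3 := hat_ge0 prof eps_gt0 dx_gt0 cell_pointS k.+1 x.
  have h4 : 0 <= c1 / eps by rewrite divr_ge0 // ltW.
  by apply: mulr_ge0; [exact: mulr_ge0|apply: mulr_ge0; [exact: mulr_ge0|exact: ind_ge0]].
have EM0 x t : 0 <= EM x t.
  apply: sumr_ge0 => k _; apply: sumr_ge0 => n _.
  have h1 := cross_const_ge0 prof eps_gt0 dx_gt0 dt_gt0 lambda_gt0.
  by apply: mulr_ge0; [exact: mulr_ge0|apply: mulr_ge0; exact: ind_ge0].
apply: (@le_trans _ _ (\int[mm]_(z in D i `*` S)
    (EI z.1 z.2 + EM z.1 z.2 + left_flux z.1 z.2))).
  apply: (@le_Rintegral _ _ _ mm _ _ _ (mDiS i) iT ALLi) => -[x t] [/= Dx tS].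
  have t0T : 0 <= t <= T.
    by move: tS; rewrite in_itv /= => /andP[/ltW -> /ltW ->].
  have t0 : 0 <= t by case/andP: t0T.
  have := interior_term_le prof eps_gt0 dx_gt0 dt_gt0 dt_def cell_pointS time_pointS
    lambda_gt0 time_point0 (N := N) (F := F) (xi := xi) alpha_gt0 K
    (ifc := cell_iface) (domk := fun k => dom (L + k.+1%:Z)) (p := p) (m := m)
    _ (D := fun i => D i) _ (u x t) iN Dx t0.
  move=> h'; apply: le_trans (h' _ _) _ => {h'}.
  - move=> i' w k n i'N _; have := q_entropy n (L + k.+1%:Z) w i'N.
    by rewrite /cell_defect /defect /cell_flux pred_cell.
  - move=> i' k y i'N _ Dy bad hy.
    apply: (near_interface_point dx_gt0 xi_lt aligned (i := i') (j := L + k.+1%:Z)) => //.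
    by move: hy; rewrite /cell_point (next_cell L k.+1).
  - by rewrite lerD2l; exact: left_flux_ge.
apply: (@le_trans _ _ (\int[mm]_(z in setT `*` S)
    (EI z.1 z.2 + EM z.1 z.2 + left_flux z.1 z.2))).
  apply: (@ge0_subset_Rintegral _ _ _ mm _ _ _ (mDiS i) mS sub ALL_int).
  by move=> z _; exact: (addr_ge0 (addr_ge0 (EI0 _ _) (EM0 _ _)) (left_flux_ge0 _ _)).
rewrite (@RintegralD _ _ _ mm _ _ _ mS EIM_int LF_int).
rewrite (@RintegralD _ _ _ mm _ _ _ mS EI_int EM_int).
apply: lerD; first apply: lerD.
- exact: (err_interface_integral prof eps_gt0 tn dx_gt0 cell_pointS lambda_gt0 T_gt0
    alpha_gt0 N xi (fun k _ => time_variation k) iface_variation var_bound_ge0).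
- exact: (err_mismatch_integral prof eps_gt0 dx_gt0 dt_gt0 cell_pointS time_pointS
    lambda_gt0 T_gt0 space_variation).
- have -> : \int[mm]_(z in setT `*` S) left_flux z.1 z.2
      = c1 / eps * strip_integral T setT dev + c1 / eps * eta * strip_integral T setT box.
    rewrite (@RintegralD _ _ _ mm _ _ _ mS (cdev_int (c1 / eps)) (cbox_int (c1 / eps * eta))).
    by rewrite (@RintegralZl _ _ _ mm _ _ _ mS dev_int) (@RintegralZl _ _ _ mm _ _ _ mS box_int).
  have ce : 0 <= c1 / eps by rewrite divr_ge0 // ltW.
  apply: lerD; first by rewrite ler_wpM2l.
  have -> : c1 * eta * T = c1 / eps * eta * (eps * T) by field; rewrite gt_eqF.
  by rewrite ler_wpM2l ?box_integral// mulr_ge0.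
Qed.

Let LT n0 i w x := level_term Hs eps X tn F m K p n0 i w x.
Let LE n0 x := level_err Hs eps X alpha m p n0 K1 x.
Let W (x : R) : R := ind (X 1%N) (X m.+1 - eps) x.

Definition level_error : R :=
  alpha^-1 * (K1%:R * ((1 + N%:R) * V) * (c1 * (dx / eps) * (eps + dx)) + eps * V).

Let LE_ge0 n0 x : 0 <= LE n0 x.
Proof.
rewrite /LE /level_err; apply: mulr_ge0; first by rewrite invr_ge0 ltW.
apply: addr_ge0; last exact: space_osc_ge0.
apply: sumr_ge0 => k _; apply: mulr_ge0; first exact: time_osc_ge0.
exact: (hat_ge0 prof eps_gt0 dx_gt0 cell_pointS).
Qed.

Let LT_ge0 n0 i w x : 0 <= LT n0 i w x.
Proof. exact: (level_term_ge0 prof eps_gt0 dx_gt0 dt_gt0 cell_pointS time_pointS). Qed.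

Let LT_int n0 i (v : R -> R) : v \in Lfun mu 1%E ->
  mu.-integrable (D i) (EFin \o (fun x => LT n0 i (v x) x)).
Proof. exact: (level_term_integrable N xi F prof eps_gt0 tn dx_gt0 cell_pointS). Qed.

Let mD i : measurable (D i). Proof. exact: measurable_itv. Qed.

Let LE_int n0 (E : set R) : measurable E -> mu.-integrable E (EFin \o LE n0).
Proof.
move=> mE; apply: bs_integrable => //.
exact: (level_err_bs prof eps_gt0 dx_gt0 cell_pointS).
Qed.

Let LE_le n0 i : (n0 + K1 <= K)%N -> \int[mu]_(x in D i) LE n0 x <= level_error.
Proof.
move=> nK; have := level_err_integral prof eps_gt0 dx_gt0 cell_pointS alpha_gt0
  space_variation level_time_variation nK.
apply: le_trans; apply: ge0_subset_Rintegral => //; exact: LE_int.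
Qed.

Let terminal_ge i x : (i <= N)%N -> D i x ->
  `|u x T - final_state x| * W x <= LT M.+1 i (u x T) x + LE M.+1 x.
Proof.
move=> iN Dx; rewrite /W /ind; case: (boolP (_ <= x <= _)) => [/andP[x1 xm]|_]; last first.
  by rewrite mulr0 addr_ge0.
rewrite mulr1; have [k /andP[k1 k2]] := cell_index x1.
have kj : gp (L + k.+1%:Z) <= x < gp (L + k.+1%:Z + 1).
  by move: k1 k2; rewrite /cell_point (next_cell L k.+1) => -> ->.
have dk := dom_of_point dx_gt0 xi_lt aligned iN Dx kj.
have xm' : x + eps <= X m.+1 by rewrite -lerBrDr.
have := level_term_ge prof eps_gt0 dx_gt0 dt_gt0 cell_pointS time_pointS alpha_gt0 F_reg
  p K1_eps (u x T) iN (leqnn K) x1 xm' k1 k2.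
by rewrite (g_cell_flux _ iN dk) -(final_state_cell kj) lerBlDr.
Qed.

(** Distance of [u0] to the cell averages: the variation over the cell of [x], or
    the whole variation on the stretch of length [eps] left of the window that
    the first hat reaches. *)
Let Init x : R := \sum_(k < m) variation h (X k.+1) (X k.+2) * ind (X k.+1) (X k.+2) x
  + TVh * ind (X 1%N - eps) (X 1%N) x.

Let X_le k : X k <= X k.+1.
Proof. by rewrite cell_pointS lerDl ltW. Qed.

Let Init_ge0 x : 0 <= Init x.
Proof.
apply: addr_ge0; last by rewrite mulr_ge0 ?ind_ge0.
by apply: sumr_ge0 => k _; rewrite mulr_ge0 ?ind_ge0 ?variation_ge0.
Qed.

Let initial_le i x : (i <= N)%N -> D i x -> u0 x = h x ->
  LT 0%N i (u0 x) x <= Init x + LE 0%N x.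
Proof.
move=> iN Dx uh.
have out : x <= X 1%N - eps \/ X m.+1 <= x -> LT 0%N i (u0 x) x <= Init x + LE 0%N x.
  move=> o; rewrite /LT (level_term_out prof eps_gt0 tn dx_gt0 cell_pointS F K p 0%N i _ o).
  exact: addr_ge0.
have [x0|x0] := leP x (X 1%N - eps); first by apply: out; left.
have [xm|xm] := leP (X m.+1) x; first by apply: out; right.
have [x1|x1] := ltP x (X 1%N).
  have i0 := left_of_base iN Dx x1.
  have x2 : x < X 2%N by apply: lt_le_trans x1 _; exact: X_le.
  have := level_term_le prof eps_gt0 dx_gt0 dt_gt0 cell_pointS time_pointS alpha_gt0 F_reg
    m K p 0%N K1_eps (u0 x) iN (kap := 0%N) isT x2.
  move=> h1; apply: (le_trans h1); rewrite lerD2r (g_cell_flux _ iN) ?i0//.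
  rewrite scheme_initial distrC uh.
  have h2 : `|average u0 (X 1%N) dx - h x| <= TVh.
    apply: (@le_trans _ _ (variation h x (X 2%N))).
      apply: (average_dist_BV u0_int h_ae h_BV dx_gt0); first exact: ltW.
        by rewrite -cell_pointS.
      by rewrite lexx ltW.
    by apply: variation_le => //; exact: ltW.
  apply: (le_trans h2); rewrite /Init (ind1 (x := x) (a := X 1%N - eps)).
    rewrite mulr1 lerDr; apply: sumr_ge0 => k _.
    by rewrite mulr_ge0 ?ind_ge0 ?variation_ge0.
  by rewrite !ltW.
have [k /andP[k1 k2]] := cell_index x1.
have km : (k < m)%N.
  have : X k.+1 < X m.+1 by apply: le_lt_trans xm.
  by rewrite /cell_point (grid_point_lt _ dx_gt0) ltrD2l.
have kj : gp (L + k.+1%:Z) <= x < gp (L + k.+1%:Z + 1).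
  by move: k1 k2; rewrite /cell_point (next_cell L k.+1) => -> ->.
have dk := dom_of_point dx_gt0 xi_lt aligned iN Dx kj.
have h1 := level_term_le prof eps_gt0 dx_gt0 dt_gt0 cell_pointS time_pointS alpha_gt0 F_reg
    m K p 0%N K1_eps (u0 x) iN (kap := k) (introT orP (or_intror k1)) k2.
apply: (le_trans h1); rewrite lerD2r (g_cell_flux _ iN dk) scheme_initial distrC uh.
have h2 : `|average u0 (X k.+1) dx - h x| <= variation h (X k.+1) (X k.+2).
  apply: (average_dist_BV u0_int h_ae h_BV dx_gt0) => //.
    by rewrite -cell_pointS.
  by rewrite k1 ltW.
apply: (le_trans h2); rewrite /Init (bigD1 (Ordinal km)) //= (ind1 (x := x)) ?k1 ?(ltW k2)//.
rewrite mulr1 -addrA lerDl addr_ge0 ?mulr_ge0 ?ind_ge0//.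
by apply: sumr_ge0 => l _; rewrite mulr_ge0 ?ind_ge0 ?variation_ge0.
Qed.

Let Init_term_bs k : bounded_supp
  (fun x => variation h (X k.+1) (X k.+2) * ind (X k.+1) (X k.+2) x).
Proof. exact: (bs_scale _ (bs_ind _ _)). Qed.

Let Init_edge_bs : bounded_supp (fun x => TVh * ind (X 1%N - eps) (X 1%N) x).
Proof. exact: (bs_scale _ (bs_ind _ _)). Qed.

Let Init_bs : bounded_supp Init.
Proof. exact: (bs_add (bs_sum m Init_term_bs) Init_edge_bs). Qed.

Let Rintegral_scale_ind c (y z : R) : y <= z -> \int[mu]_x (c * ind y z x) = c * (z - y).
Proof.
move=> yz; rewrite (@RintegralZl _ _ _ mu _ _ _ measurableT (bs_integrable measurableT (bs_ind y z))).
by rewrite Rintegral_ind.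
Qed.

Let Init_le i : \int[mu]_(x in D i) Init x <= (dx + eps) * TVh.
Proof.
apply: (@le_trans _ _ (\int[mu]_x Init x)).
  by apply: ge0_subset_Rintegral => //; exact: (bs_integrable measurableT Init_bs).
rewrite (@RintegralD _ _ _ mu _ _ _ measurableT
  (bs_integrable measurableT (bs_sum m Init_term_bs)) (bs_integrable measurableT Init_edge_bs)).
rewrite (@Rintegral_sum _ _ _ mu _ measurableT _ _ (fun (k : 'I_m) x =>
  variation h (X k.+1) (X k.+2) * ind (X k.+1) (X k.+2) x)); last first.
  by move=> k; exact: (bs_integrable measurableT (Init_term_bs k)).
rewrite mulrDl; apply: lerD.
  rewrite (eq_bigr (fun k : 'I_m => dx * variation h (X k.+1) (X k.+2))); last first.
    move=> k _; rewrite Rintegral_scale_ind// mulrC; congr (_ * _).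
    by rewrite (cell_pointS k.+1) addrAC subrr add0r.
  rewrite -mulr_sumr ler_pM2l//.
  exact: (mesh_variation h_BV dx_gt0 (X := fun k => X k.+1) (fun k => cell_pointS k.+1)).
have e1 : X 1%N - eps <= X 1%N by rewrite lerBlDr lerDl ltW.
by rewrite Rintegral_scale_ind// opprB addrC subrK mulrC.
Qed.

Lemma core_integrable i : (i <= N)%N ->
  mu.-integrable (D i) (EFin \o (fun x => `|u x T - final_state x| * W x)).
Proof.
move=> iN.
have gi : mu.-integrable (D i) (EFin \o (fun x => LT M.+1 i (u x T) x + LE M.+1 x)).
  have := @integrableD _ _ _ mu _ (mD i) _ _ (LT_int M.+1 i uT_L1) (LE_int M.+1 (mD i)).
  by apply: eq_integrable.
apply: (@ae_le_Rintegrable _ _ _ mu _ (mD i) _ _ _ gi).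
  apply: measurable_funS (subsetT _) _ => //.
  apply: measurable_funM; last by case: (bs_ind (X 1%N) (X m.+1 - eps)).
  by apply: measurableT_comp => //; exact: measurable_error.
apply: aeW => x Dx; rewrite ger0_norm; first exact: terminal_ge.
by rewrite mulr_ge0 ?ind_ge0.
Qed.

(** The summed entropy inequality solved for its terminal term. *)
Lemma core_estimate :
  \sum_(i < N.+1) \int[mu]_(x in D i) (`|u x T - final_state x| * W x)
    <= N.+1%:R * (interior_error + 2 * level_error + (dx + eps) * TVh).
Proof.
have term i : (i <= N)%N -> \int[mu]_(x in D i) (`|u x T - final_state x| * W x)
    <= \int[mu]_(x in D i) LT M.+1 i (u x T) x + level_error.
  move=> iN; apply: (@le_trans _ _ (\int[mu]_(x in D i) (LT M.+1 i (u x T) x + LE M.+1 x))).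
    apply: (@le_Rintegral _ _ _ mu _ _ _ (mD i) (core_integrable iN)).
      have := @integrableD _ _ _ mu _ (mD i) _ _ (LT_int M.+1 i uT_L1) (LE_int M.+1 (mD i)).
      by apply: eq_integrable.
    by move=> x Dx; exact: terminal_ge.
  rewrite (@RintegralD _ _ _ mu _ _ _ (mD i) (LT_int M.+1 i uT_L1) (LE_int M.+1 (mD i))).
  by rewrite lerD2l; apply: LE_le; exact: leqnn.
have init i : (i <= N)%N -> \int[mu]_(x in D i) LT 0%N i (u0 x) x
    <= (dx + eps) * TVh + level_error.
  move=> iN; have i1 := LT_int 0%N i u0_L1.
  have i2 := bs_integrable (mD i) Init_bs.
  have i3 := LE_int 0%N (mD i).
  apply: (@le_trans _ _ (\int[mu]_(x in D i) (Init x + LE 0%N x))).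
    apply: (@ae_le_Rintegral _ _ _ mu _ _ _ (mD i) i1).
      by have := @integrableD _ _ _ mu _ (mD i) _ _ i2 i3; apply: eq_integrable.
    by move: h_ae; apply: ae_imply => x uh Dx; exact: initial_le.
  rewrite (@RintegralD _ _ _ mu _ _ _ (mD i) i2 i3).
  by apply: lerD; [exact: Init_le|apply: LE_le; exact: leq_addl].
have := entropy_summed T_gt0 alpha_gt0 F_reg u0_L1 u_sol prof eps_gt0 dx_gt0 dt_gt0
  cell_pointS time_pointS m K p time_point0 time_pointM.
rewrite -subr_ge0 => h0.
rewrite -[N.+1 in X in _ <= X]card_ord mulr_natl -sumr_const -subr_ge0 -sumrB.
apply: (le_trans h0); rewrite subr0; apply: ler_sum => i _.
have iN : (i <= N)%N by rewrite -ltnS.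
have := term _ iN; have := init _ iN; have := interior_integral_le iN.
rewrite /LT; lra.
Qed.

End Window.

Variables (Hs bs : R -> R) (c1 c2 eps : R).
Hypotheses (prof : step_profile Hs bs c1 c2) (eps_gt0 : 0 < eps).
Variables (K1 : nat) (eta tau : R).
Hypothesis K1_eps : eps <= K1%:R * dt.
Hypotheses (eta_gt0 : 0 < eta) (tau_gt0 : 0 < tau).

(** The window is chosen last, once the grid, the scale and the tolerances are
    given: its left end far enough for both tails and for [- r], then enough
    cells to reach [r + eps]. *)
Lemma window_exists r : exists (L : int) (m : nat),
  [/\ dom (L + 1) = 0%N,
      forall n, (n <= M.+1 + K1)%N -> `|cell_flux L 0 n - F 0%N 0| <= eta,
      \sum_(n < M.+1 + K1) `|cell_flux L 0 n.+1 - cell_flux L 0 n| <= 1,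
      strip_integral T setT (fun x t => `|F 0%N (u x t) - F 0%N 0|
        * (ind (cell_point L 1 - eps) (cell_point L 1) x * ind 0 T t)) <= tau &
      cell_point L 1 <= - r /\ r <= cell_point L m.+1 - eps].
Proof.
pose K := (M.+1 + K1)%N.
have [jd hd] := dom_far_left dx_gt0 xi_lt aligned.
(* with this tolerance the [K] time increments of the base cell add up to
   at most [1] *)
have K2 : 0 < (2 * K%:R)^-1 :> R by rewrite invr_gt0 mulr_gt0.
have e0 : 0 < Num.min eta (2 * K%:R)^-1 by rewrite lt_min eta_gt0.
have [jf hf] := flux_far_left K.+1 e0.
have [u_cont [mS [B hB]] _] := u_sol.
have hB' : {ae mm, forall z : R * R, 0 < z.2 < T -> `|u z.1 z.2| <= `|B|}.
  by move: hB; apply: ae_imply => z h1 /h1 h2; apply: le_trans h2 (ler_norm _).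
have [Y hY] := flux_left_tail T_gt0 u_cont mS (normr_ge0 B) hB' alpha_gt0
  (F_reg (leq0n N)) eps_gt0 tau_gt0.
have [jY gY] := grid_far_left Y.
have [jr gr] := grid_far_left (- r).
pose L := Num.min (Num.min jd jf) (Num.min jY jr) - 1.
have L1 : L + 1 = Num.min (Num.min jd jf) (Num.min jY jr) by rewrite subrK.
have [/andP[ld lf] /andP[lY lr]] :
    ((L + 1 <= jd) && (L + 1 <= jf)) /\ ((L + 1 <= jY) && (L + 1 <= jr)).
  by rewrite L1 !ge_min !lexx !orbT.
have hf' n : (n <= K.+1)%N -> `|cell_flux L 0 n - F 0%N 0| <= Num.min eta (2 * K%:R)^-1.
  by move=> nK; apply: hf => //; rewrite addr0; apply: le_trans lf; rewrite lerDl.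
exists L, (Num.truncn ((r + eps - gp L) / dx)); split.
- exact: hd.
- move=> n nK; apply: le_trans (hf' n (leqW nK)) _.
  by rewrite ge_min lexx.
- apply: (@le_trans _ _ (\sum_(n < K) K%:R^-1)).
    apply: ler_sum => n _; pose c := F 0%N 0.
    have -> : cell_flux L 0 n.+1 - cell_flux L 0 n
        = (cell_flux L 0 n.+1 - c) - (cell_flux L 0 n - c) by ring.
    apply: le_trans (ler_normB _ _) _.
    have -> : K%:R^-1 = (2 * K%:R)^-1 + (2 * K%:R)^-1 :> R.
      by field; rewrite pnatr_eq0.
    have nK : (n < K)%N := ltn_ord n.
    have hn l : (l <= K.+1)%N -> `|cell_flux L 0 l - c| <= (2 * K%:R)^-1.
      by move=> lK; apply: le_trans (hf' l lK) _; rewrite ge_min lexx orbT.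
    by apply: lerD; apply: hn; [exact: ltnW|exact: leqW (ltnW nK)].
  by rewrite sumr_const card_ord -[X in X <= _]mulr_natl divff// pnatr_eq0.
- by apply: hY; apply: gY.
- split; first exact: gr.
  rewrite lerBrDr /cell_point /grid_point intrD mulrDl addrA -/(gp L).
  rewrite -lerBlDl -ler_pdivrMr//.
  by apply: ltW; exact: truncnS_gt.
Qed.

Lemma ae_off_interfaces :
  {ae mu, forall x, forall i, (0 < i <= N)%N -> x != xi i}.
Proof.
have cr : countable (range xi).
  by apply: card_le_trans (card_image_le _ _) _; exact: countableP.
exists (range xi); split.
- by apply: countable_measurable => // t; exact: measurable_set1.
- exact: countable_lebesgue_measure0.
- move=> x /= /existsNP[i /not_implyP[_ /negP /negPn /eqP ->]].
  by exists i.
Qed.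

Definition total_error : R := N.+1%:R *
  (interior_error K1 eta c1 c2 eps tau + 2 * level_error K1 c1 eps + (dx + eps) * TVh).

(** The bound is the same for all [r], since the window enters it nowhere. *)
Lemma window_estimate (r : R) :
  (\int[mu]_(x in (`[(- r)%R, r]%classic : set R)) `|(u x T - final_state x)%:E| <= total_error%:E)%E.
Proof.
have [L [m [hd hf ht htail [xl xr]]]] := window_exists r.
have core := core_estimate m hd hf ht prof eps_gt0 K1_eps (ltW eta_gt0) htail.
have core_int i := @core_integrable L m K1 Hs bs c1 c2 eps prof eps_gt0 K1_eps i.
pose W x := ind (cell_point L 1) (cell_point L m.+1 - eps) x.
pose f x : R := `|u x T - final_state x| * W x.
have f0 x : 0 <= f x by rewrite mulr_ge0 ?ind_ge0.
have mD i : measurable (D i) by exact: measurable_itv.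
have mdE : measurable_fun setT (fun x => `|(u x T - final_state x)%:E|%E).
  by apply: measurableT_comp => //; apply/measurable_EFinP; exact: measurable_error.
have mf : measurable_fun setT f.
  apply: measurable_funM; [apply: measurableT_comp => //; exact: measurable_error|by case: (bs_ind (cell_point L 1) (cell_point L m.+1 - eps))].
have mfE : measurable_fun setT (EFin \o f) by apply/measurable_EFinP.
apply: (@le_trans _ _ (\int[mu]_x (f x)%:E)%E).
  rewrite integral_mkcond; apply: ge0_le_integral => //.
  - by move=> x _; rewrite erestrict_ge0// => y _.
  - apply/(measurable_restrict _ _ _) => //; rewrite setTI.
    exact: (measurable_funS measurableT (@subsetT _ _) mdE).
  - move=> x _; rewrite /= patchE; case: ifPn => [|_]; last by rewrite lee_fin.
    rewrite inE /= in_itv /= => /andP[x1 x2]; rewrite lee_fin /f /W ind1 ?mulr1//.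
    by rewrite (le_trans xl x1) (le_trans x2 xr).
apply: (@le_trans _ _ (\sum_(i < N.+1) \int[mu]_(x in D i) (f x)%:E)%E).
  have -> : (\sum_(i < N.+1) \int[mu]_(x in D i) (f x)%:E
      = \int[mu]_x \sum_(i < N.+1) ((EFin \o f) \_ (D i)) x)%E.
    rewrite ge0_integral_sum//.
    - apply: eq_bigr => i _; exact: integral_mkcond.
    - move=> i; apply/(measurable_restrict _ _ _) => //.
      by rewrite setTI; exact: (measurable_funS measurableT (@subsetT _ _) mfE).
    - by move=> i x _; rewrite erestrict_ge0// => y _; rewrite lee_fin.
  have r0 (i : 'I_N.+1) x : (0 <= ((EFin \o f) \_ (D i)) x)%E.
    by rewrite erestrict_ge0// => y _; rewrite lee_fin.
  apply: ae_ge0_le_integral => //.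
  - by move=> x _; rewrite lee_fin.
  - by move=> x _; apply: sume_ge0.
  - apply: emeasurable_sum => i; apply/(measurable_restrict _ _ _) => //.
    by rewrite setTI; exact: (measurable_funS measurableT (@subsetT _ _) mfE).
  - apply: ae_imply ae_off_interfaces => x hx _.
    have [i iN Dx] := subdomain_cover dx_gt0 aligned hx.
    have iN1 : (i < N.+1)%N by [].
    rewrite (bigD1 (Ordinal iN1))//= patchE mem_set//=.
    by apply: leeDl; apply: sume_ge0.
rewrite (eq_bigr (fun i : 'I_N.+1 => (\int[mu]_(x in D i) f x)%:E)).
  by rewrite sumEFin lee_fin.
move=> i _; rewrite fineK//; apply: integrable_fin_num => //.
by apply: core_int; rewrite -ltnS.
Qed.

Lemma L1_error_le :
  ('N[mu]_1[(fun x => (u x T - final_state x)%:E)] <= total_error%:E)%E.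
Proof.
rewrite Lnorm1.
pose G (n : nat) : set R := `[- n%:R, n%:R]%classic.
have UG : \bigcup_n G n = setT.
  apply/seteqP; split => // x _; exists (Num.truncn `|x|).+1 => //=.
  by rewrite /G /= in_itv /= -ler_norml ltW// truncnS_gt.
rewrite -UG.
have md : measurable_fun setT (fun x => `|(u x T - final_state x)%:E|%E).
  by apply: measurableT_comp => //; apply/measurable_EFinP; exact: measurable_error.
have nG : {homo G : n n' / (n <= n')%N >-> (n <= n')%O}.
  move=> n n' nn'; apply/subsetPset => x /=; rewrite /G /= !in_itv /= => /andP[x1 x2].
  have le_n : n%:R <= n'%:R :> R by rewrite ler_nat.
  by rewrite (le_trans x2 le_n) andbT; apply: le_trans x1; rewrite lerN2.
have mG n : measurable (G n) by exact: measurable_itv.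
have cv := @ge0_nondecreasing_set_cvg_integral _ (measurableTypeR R) R G
  (fun x => `|(u x T - final_state x)%:E|%E) mu nG mG
  (fun n => measurable_funS measurableT (@subsetT _ _) md) (fun _ _ _ => abse_ge0 _).
rewrite -(cvg_lim _ cv)//; apply: lime_le; first by apply: cvgP; exact: cv.
by apply: nearW => n; exact: window_estimate.
Qed.

End FixedGrid.

(** * The rate *)
Section Rate.
Context {R : realType}.
Variables (T alpha lambda c1 c2 V TVh E : R) (N : nat).
Hypotheses (T_gt0 : 0 < T) (alpha_gt0 : 0 < alpha) (lambda_gt0 : 0 < lambda).
Hypotheses (c1_gt0 : 0 < c1) (c2_gt0 : 0 < c2) (V_ge0 : 0 <= V) (TVh_ge0 : 0 <= TVh).

(** The three rates below are the errors for [eps = sqrt dx] divided by [eps],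
    with [eps] replaced by an upper bound [E] where it remains. *)
Definition interface_rate : R :=
  c1 * ((2 / alpha + lambda) * V) * (N%:R * (1 + E)).

Definition mismatch_rate : R :=
  V * (c1 * c2 * (lambda ^+ 2 + lambda))
  * ((T + E + lambda * E ^+ 2) / lambda * ((1 + E) * (1 + lambda * E))).

Definition level_rate : R :=
  alpha^-1 * ((1 + N%:R) * V * c1 * ((1 + lambda * E) / lambda * (1 + E)) + V).

Variables (dx dt eps K1 K : R).
Hypotheses (dx_def : dx = eps ^+ 2) (dt_def : dt = lambda * dx).
Hypotheses (eps_gt0 : 0 < eps) (eps_E : eps <= E).
Hypotheses (K1_ge0 : 0 <= K1) (K1_le : K1 * dt <= eps + dt) (K_le : K * dt <= T + eps + dt).
Hypothesis K_ge0 : 0 <= K.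

Let eps_ge0 : 0 <= eps. Proof. exact: ltW. Qed.
Let E_ge0 : 0 <= E. Proof. exact: le_trans eps_E. Qed.
Let alpha_ge0 : 0 <= alpha. Proof. exact: ltW. Qed.
Let lambda_ge0 : 0 <= lambda. Proof. exact: ltW. Qed.
Let c1_ge0 : 0 <= c1. Proof. exact: ltW. Qed.
Let c2_ge0 : 0 <= c2. Proof. exact: ltW. Qed.

Lemma interface_rate_le :
  c1 * ((2 / alpha + lambda) * V) * (N%:R * (eps + dx)) <= interface_rate * eps.
Proof.
rewrite dx_def /interface_rate -!mulrA ler_wpM2l //.
have h0 : 0 <= 2 / alpha + lambda by rewrite addr_ge0 ?divr_ge0//.
rewrite ler_wpM2l// ler_wpM2l// ler_wpM2l//.
have -> : eps + eps ^+ 2 = (1 + eps) * eps by ring.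
by rewrite ler_pM2r// lerD2l.
Qed.

(** The mismatch constant is of order [eps], and the [K] rectangles of area
    about [dx] add up to a bounded number because [K * dt] is bounded. *)
Lemma mismatch_rate_le :
  K * V * cross_const c1 c2 eps dx dt lambda * ((eps + dx) * (eps + dt))
    <= mismatch_rate * eps.
Proof.
have -> : K * V * cross_const c1 c2 eps dx dt lambda * ((eps + dx) * (eps + dt))
    = V * (c1 * c2 * (lambda ^+ 2 + lambda))
      * ((K * dt) / lambda * ((1 + eps) * (1 + lambda * eps))) * eps.
  rewrite /cross_const dt_def dx_def; field.
  by rewrite !gt_eqF.
rewrite ler_pM2r// /mismatch_rate ler_wpM2l//.
  by rewrite mulr_ge0// mulr_ge0 ?addr_ge0 ?sqr_ge0 ?mulr_ge0//.
have le2 : eps ^+ 2 <= E ^+ 2 by rewrite ler_sqr ?nnegrE//.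
apply: ler_pM.
- by rewrite divr_ge0 // mulr_ge0// dt_def dx_def mulr_ge0 ?sqr_ge0//.
- by rewrite mulr_ge0 ?addr_ge0 ?mulr_ge0//.
- rewrite ler_pM2r ?invr_gt0//; apply: (le_trans K_le); rewrite dt_def dx_def.
  by rewrite lerD ?lerD2l// ler_pM2l.
- apply: ler_pM; rewrite ?lerD2l ?ler_pM2l// ?addr_ge0 ?mulr_ge0//.
Qed.

Lemma level_rate_le :
  alpha^-1 * (K1 * ((1 + N%:R) * V) * (c1 * (dx / eps) * (eps + dx)) + eps * V)
    <= level_rate * eps.
Proof.
rewrite /level_rate -[X in _ <= X]mulrA ler_wpM2l ?invr_ge0 //.
rewrite [X in _ <= X]mulrDl (mulrC eps V) lerD2r.
have -> : K1 * ((1 + N%:R) * V) * (c1 * (dx / eps) * (eps + dx))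
    = (1 + N%:R) * V * c1 * (K1 * dt / lambda * (1 + eps)).
  by rewrite dt_def dx_def; field; rewrite !gt_eqF.
rewrite -[X in _ <= X]mulrA ler_wpM2l ?mulr_ge0 ?addr_ge0 //.
have -> : (1 + lambda * E) / lambda * (1 + E) * eps
    = ((1 + lambda * E) * eps) / lambda * (1 + E) by ring.
apply: ler_pM.
- by rewrite divr_ge0 // mulr_ge0// dt_def dx_def mulr_ge0 ?sqr_ge0//.
- by rewrite addr_ge0//.
- rewrite ler_pM2r ?invr_gt0//; apply: (le_trans K1_le); rewrite dt_def dx_def.
  have -> : eps + lambda * eps ^+ 2 = (1 + lambda * eps) * eps by ring.
  by rewrite ler_pM2r// lerD2l ler_pM2l.
- by rewrite lerD2l.
Qed.

Definition total_rate : R := N.+1%:R *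
  (interface_rate + mismatch_rate + 2 + 2 * level_rate + (1 + E) * TVh).

End Rate.

Lemma bounded_variation_lineP {R : realType} (u0 : R -> R) :
  bounded_variation_line u0 -> exists h TVh,
  {ae @lebesgue_measure R, forall x, u0 x = h x} /\
  forall a b, a <= b -> (total_variation a b h <= TVh%:E)%E.
Proof.
move=> [h h_ae]; set s := ereal_sup _ => s_lt.
have ub a b : a <= b -> (total_variation a b h <= s)%E.
  by move=> ab; apply: ereal_sup_ubound; exists (a, b).
have s_fin : s \is a fin_num.
  rewrite fin_numE; apply/andP; split; last by rewrite lt_eqF.
  rewrite -ltNye; apply: lt_le_trans (ub 0 0 (lexx 0)).
  by apply: lt_le_trans (total_variation_ge0 h (lexx 0)).
by exists h, (fine s); split=> // a b ab; rewrite fineK//; exact: ub.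
Qed.

Theorem theorem5p1 (R : realType) (T : R) (N : nat) (xi : nat -> R)
    (k : R -> R) (f : R -> R -> R) (F : nat -> R -> R) (alpha lambda : R)
    (u0 : R -> R) (u : R -> R -> R)
    (T_gt0 : 0 < T)
    (u0_L1 : u0 \in Lfun (@lebesgue_measure R) 1%E)
    (u0_BV : bounded_variation_line u0)
    (k_pc : piecewise_constant N xi k)
    (F_flux : flux_family N xi k f F)
    (alpha_gt0 : 0 < alpha)
    (F_reg : forall i, (i <= N)%N -> regular_increasing alpha (F i))
    (lambda_gt0 : 0 < lambda)
    (lambda_CFL : CFL N xi F u0 lambda)
    (u_sol : entropy_solution T N xi F u0 u) :
  exists C : R,
    forall (dx dt a : R) (M : nat) (P : nat -> int) (U : nat -> int -> R),
      0 < dx -> 0 < dt -> dt / dx = lambda -> T = M.+1%:R * dt ->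
      (forall i, (0 < i <= N)%N -> xi i = grid_point a dx (P i)) ->
      upwind_scheme N F u0 lambda a dx P U ->
      ('N[@lebesgue_measure R]_1
         [(fun x => (u x T - numerical_solution a dx dt U x T)%:E)]
       <= (C * Num.sqrt dx)%:E)%E.
Proof.
have [xi_lt _ _] := k_pc.
have [h [TVh [h_ae h_BV]]] := bounded_variation_lineP u0_BV.
have TVh_ge0 : 0 <= TVh.
  by rewrite -lee_fin; apply: le_trans (h_BV 0 0 (lexx 0)); exact: total_variation_ge0.
have [Hs [bs [c1 [c2 prof]]]] := step_profile_exists (R := R).
have c1_gt0 := sp_c1 prof; have c2_gt0 := sp_c2 prof.
pose V := var_bound N F lambda h TVh.
pose E := Num.sqrt (T / lambda).
exists (total_rate T alpha lambda c1 c2 V TVh E N).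
move=> dx dt a M P U dx_gt0 dt_gt0 dt_dx T_def aligned U_scheme.
pose eps := Num.sqrt dx.
have eps_gt0 : 0 < eps by rewrite sqrtr_gt0.
have dx_def : dx = eps ^+ 2 by rewrite sqr_sqrtr// ltW.
have dt_def : dt = lambda * dx by rewrite -dt_dx divfK// gt_eqF.
(* the grid has at least one time step, so [dx] is at most [T / lambda] *)
have eps_E : eps <= E.
  rewrite ler_sqrt; last by rewrite divr_ge0 ?ltW.
  rewrite ler_pdivlMr// mulrC -dt_def T_def ler_peMl ?(ltW dt_gt0)//.
  by rewrite ler1n.
pose K1 := (Num.truncn (eps / dt)).+1.
have K1_eps : eps <= K1%:R * dt.
  by rewrite -ler_pdivrMr// ltW// truncnS_gt.
have K1_le : K1%:R * dt <= eps + dt.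
  rewrite -[K1]addn1 natrD mulrDl mul1r lerD2r -ler_pdivlMr//.
  by rewrite truncn_le// divr_ge0 ?ltW.
have K_le : (M.+1 + K1)%:R * dt <= T + eps + dt.
  by rewrite natrD mulrDl -T_def -addrA lerD2l.
have V_ge0 : 0 <= V by exact: var_bound_ge0.
have eta_gt0 : 0 < eps / (c1 * T) by rewrite divr_gt0 ?mulr_gt0.
(* the two tolerances make each part of the left boundary term equal to [eps] *)
have tau_gt0 : 0 < eps ^+ 2 / c1 by rewrite divr_gt0 ?exprn_gt0.
have := L1_error_le T_gt0 alpha_gt0 lambda_gt0 F_reg u0_L1 u_sol lambda_CFL xi_lt h_ae h_BV
  dx_gt0 dt_gt0 dt_def T_def aligned U_scheme prof eps_gt0 K1_eps eta_gt0 tau_gt0.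
move=> h1; apply: (le_trans h1); rewrite lee_fin /total_error /total_rate -mulrA ler_wpM2l//.
have b1 := interface_rate_le N alpha_gt0 lambda_gt0 c1_gt0 V_ge0 dx_def eps_gt0 eps_E.
have b2 := mismatch_rate_le lambda_gt0 c1_gt0 c2_gt0 V_ge0 dx_def dt_def eps_gt0 eps_E
  K_le (ler0n R _).
have b3 := level_rate_le N alpha_gt0 lambda_gt0 c1_gt0 V_ge0 dx_def dt_def eps_gt0 eps_E
  (ler0n R _) K1_le.
rewrite /interior_error /level_error -/V.
have -> : c1 / eps * (eps ^+ 2 / c1) = eps by field; rewrite !gt_eqF.
have -> : c1 * (eps / (c1 * T)) * T = eps by field; rewrite !gt_eqF.
have b4 : (dx + eps) * TVh <= (1 + E) * TVh * eps.
  have -> : (1 + E) * TVh * eps = ((1 + E) * eps) * TVh by ring.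
  rewrite ler_wpM2r// dx_def.
  have -> : eps ^+ 2 + eps = (1 + eps) * eps by ring.
  by rewrite ler_pM2r// lerD2l.
rewrite -/eps; lra.
Qed.
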